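(* Consider the partially linear MAR model: one observes independent copies $(U_j,V_j,\delta_jY_j,\delta_j)$, $j=1,\ldots,n$, of $(U,V,\delta Y,\delta)$, where $Y=\vartheta^{\top}U+\rho(V)+\varepsilon$ with unknown $\vartheta\in\mathbb{R}^m$, and $\delta$ is an indicator with $P(\delta=1\mid U,V,Y)=P(\delta=1\mid U,V)=\pi(U,V)$ almost surely. Suppose that $\rho$ is twice continuously differentiable, that the error $\varepsilon$ is independent of $(U,V)$, has mean zero, finite variance and a density $f$ with finite Fisher information for location, and that the distribution $G$ of $(U,V)$ satisfies (G1) and (G2) stated in the context. Assume also that $\pi$ is bounded away from zero. Then an estimator $\hat\vartheta$ of $\vartheta$ is efficient in the MAR model if and only if it satisfies $$\hat\vartheta=\vartheta+\frac1n\sum_{j=1}^n\frac{\delta_j}{E[\delta]}\,(J_fW_{\tilde G})^{-1}\bigl(U_j-\mu_{\tilde G}(V_j)\bigr)\ell_f(\varepsilon_j)+o_P(n^{-1/2}),$$ where $\varepsilon_j=Y_j-\vartheta^{\top}U_j-\rho(V_j)$ and $\tilde G$ is the conditional distribution of $(U,V)$ given $\delta=1$. As a consequence, the complete case version of an efficient estimator of $\vartheta$ in the full model is efficient for the MAR model.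
   Context: $U$ takes values in $\mathbb{R}^m$, $V$ takes values in $[0,1]$, $X=(U,V)$. For a distribution $G$ of $(U,V)$ put $\mu_G(V)=E_G[U\mid V]$ and $W_G=E_G[(U-\mu_G(V))(U-\mu_G(V))^{\top}]$; $\mu_{\tilde G},W_{\tilde G}$ are the same quantities computed under $\tilde G$. Conditions: (G1) $V$ has a density that is bounded and bounded away from zero on $[0,1]$. (G2) $E[\|U\|^2]<\infty$ and $W_G$ is positive definite. Finite Fisher information for location: $f$ is absolutely continuous with a.e. derivative $f'$, $\ell_f=-f'/f$, and $J_f=\int\ell_f^2(x)f(x)\,dx<\infty$. $F$ denotes the distribution with density $f$. Efficiency in the MAR model. The distribution of $(X,\delta Y,\delta)$ is parametrized by $G$, $\pi$ and the conditional distribution $Q(u,v,dy)=f(y-\vartheta^{\top}u-\rho(v))\,dy$ of $Y$ given $X=(u,v)$. The tangent space is the sum of the mutually orthogonal spaces $T_1=\{u(X):u\in\mathscr{U}\}$, $T_2=\{\delta v(X,Y):v\in\mathscr{V}\}$, $T_3=\{(\delta-\pi(X))w(X):w\in\mathscr{W}\}$. Here $\mathscr{U}$ is the set of real functions $u$ with $\int u\,dG=0$, $\int u^2\,dG<\infty$ for which there are distributions $G_{nu}$ satisfying the model assumptions on $G$ with $\int\bigl(n^{1/2}(dG_{nu}^{1/2}-dG^{1/2})-\tfrac12u\,dG^{1/2}\bigr)^2\to0$; $\mathscr{W}$ is the set of real functions $w$ with $\int w^2\pi(1-\pi)\,dG<\infty$ for which there are $\pi_{nw}$ satisfying the model assumptions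 on $\pi$ with $\int\bigl(n^{1/2}(dB_{\pi_{nw}(x)}^{1/2}-dB_{\pi(x)}^{1/2})-\tfrac12(\cdot-\pi(x))w(x)\,dB_{\pi(x)}^{1/2}\bigr)^2G(dx)\to0$, where $B_p$ is the Bernoulli distribution with parameter $p$; and $\mathscr{V}$ (the set of Hellinger tangents at $Q$ of the model for the conditional distribution) consists of the functions $$a^{\top}U\ell_f(\varepsilon)+b(V)\ell_f(\varepsilon)+c(\varepsilon),\quad a\in\mathbb{R}^m,\ E[b^2(V)]<\infty,\ c\in L_2(F),\ \int c\,dF=0,\ \int yc(y)\,dF(y)=0,$$ with $\varepsilon=Y-\vartheta^{\top}U-\rho(V)$; the derivative of the functional $\kappa(G,Q,\pi)=\vartheta$ along the direction $(u,v,w)$ with such $v$ is $a$. The canonical gradient (efficient influence function) of $\kappa$ is the $\mathbb{R}^m$-valued function $g_*(X,\delta Y,\delta)$ whose coordinates belong to the tangent space and which satisfies $$E\bigl[g_*(X,\delta Y,\delta)\{u(X)+\delta v(X,Y)+(\delta-\pi(X))w(X)\}\bigr]=a$$ for all $u\in\mathscr{U}$, $w\in\mathscr{W}$ and all $v=a^{\top}U\ell_f(\varepsilon)+b(V)\ell_f(\varepsilon)+c(\varepsilon)\in\mathscr{V}$. An estimator $\hat\vartheta$ is efficient in the MAR model if $\hat\vartheta=\vartheta+\frac1n\sum_{j=1}^ng_*(X_j,\delta_jY_j,\delta_j)+o_P(n^{-1/2})$. Efficiency in the full model (all $Y_j$ observed). An estimator $\hat\vartheta_n=t_n(U_1,V_1,Y_1,\ldots,U_n,V_n,Y_n)$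 is efficient in the full model if, for all $\vartheta\in\mathbb{R}^m$, all twice continuously differentiable functions $\rho$, all error densities $f$ with mean zero, finite variance and finite Fisher information for location (the error $\varepsilon$ being independent of $(U,V)$), and all distributions $G$ of $(U,V)$ satisfying (G1) and (G2), $$\hat\vartheta_n=\vartheta+\frac1n\sum_{j=1}^n(J_fW_G)^{-1}(U_j-\mu_G(V_j))\ell_f(\varepsilon_j)+o_P(n^{-1/2}).$$ Its complete case version is $t_N(U_{i_1},V_{i_1},Y_{i_1},\ldots,U_{i_N},V_{i_N},Y_{i_N})$, where $N=\sum_{j=1}^n\delta_j$ and $i_1<\cdots<i_N$ are the indices with $\delta_i=1$ (and a fixed constant if $N=0$). *)

(* Defs.v *)
From HB Require Import structures.
From mathcomp Require Export all_boot all_order all_algebra.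
From mathcomp Require Export all_classical all_reals all_analysis.
Export Order.TTheory GRing.Theory Num.Theory.
Export numFieldNormedType.Exports.

Set Implicit Arguments.
Unset Strict Implicit.
Unset Printing Implicit Defensive.

Global Open Scope classical_set_scope.
Global Open Scope ring_scope.

(* The covariates are x = (u, v) : m.-tuple R * R and carry the product
   (Borel) sigma-algebra; column vectors are used for the linear algebra in
   R^m. *)
Definition ucol (R : realType) (m : nat) (u : m.-tuple R) : 'cV[R]_m :=
  \col_i tnth u i.

Definition dotv (R : realType) (m : nat) (a : 'cV[R]_m) (u : m.-tuple R) : R :=
  (a^T *m ucol u) 0 0.

Section probability_notions.
Context {R : realType}.

Definition is_density {d} {T : measurableType d}
    (mu : {measure set T -> \bar R}) (nu : set T -> \bar R) (p : T -> R) : Prop :=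
  [/\ measurable_fun setT p, forall x, 0 <= p x &
      forall A, measurable A -> nu A = (\int[mu]_(x in A) (p x)%:E)%E].

(* h(W) is a version of E_P[Z | W]. *)
Definition is_cond_expectation {d d'} {T : measurableType d}
    {T' : measurableType d'} (P : probability T R) (Z : T -> R) (W : T -> T')
    (h : T' -> R) : Prop :=
  [/\ measurable_fun setT h,
      P.-integrable setT (fun w => (h (W w))%:E) &
      forall B, measurable B ->
        (\int[P]_(w in W @^-1` B) (Z w)%:E =
         \int[P]_(w in W @^-1` B) (h (W w))%:E)%E].

Definition mutually_independent {d d'} {T : measurableType d}
    {T' : measurableType d'} (P : probability T R) (n : nat)
    (Z : 'I_n -> T -> T') : Prop :=
  forall A : 'I_n -> set T', (forall j, measurable (A j)) ->
    P [set w | forall j, A j (Z j w)] = (\prod_(j < n) P (Z j @^-1` A j))%E.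

(* On every compact interval, as is usual for functions on the line. *)
Definition absolutely_continuous (f : R -> R) : Prop :=
  forall a b e : R, 0 < e -> exists2 r : R, 0 < r &
    forall (n : nat) (x y : 'I_n -> R),
      (forall i, [/\ a <= x i, x i <= y i & y i <= b]) ->
      (forall i j, i != j -> y i <= x j \/ y j <= x i) ->
      \sum_(i < n) (y i - x i) < r ->
      \sum_(i < n) `|f (y i) - f (x i)| < e.

(* The functions rho are only evaluated on [0, 1]; functions that are C^2 on
   [0, 1] are the restrictions of functions that are C^2 on the line. *)
Definition twice_continuously_differentiable (rho : R -> R) : Prop :=
  exists rho1 rho2 : R -> R,
    [/\ forall x : R, is_derive x 1 rho (rho1 x),
        forall x : R, is_derive x 1 rho1 (rho2 x) &
        continuous rho2].

(* l_f = - f' / f; in the next definitions f' is any Borel version of the a.e.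
   derivative of f, and the value 0 where f = 0 is irrelevant under F. *)
Definition score (f f' : R -> R) (y : R) : R := - f' y / f y.

Definition fisher_information (f f' : R -> R) : R :=
  \int[@lebesgue_measure R]_y (score f f' y ^+ 2 * f y).

Definition finite_fisher_information (f f' : R -> R) : Prop :=
  [/\ absolutely_continuous f, measurable_fun setT f',
      {ae @lebesgue_measure R, forall y : R, is_derive y 1 f (f' y)} &
      (\int[@lebesgue_measure R]_y (score f f' y ^+ 2 * f y)%:E < +oo)%E].

Definition error_density (f f' : R -> R) : Prop :=
  [/\ [/\ measurable_fun setT f, forall y, 0 <= f y &
          (\int[@lebesgue_measure R]_y (f y)%:E = 1)%E],
      (\int[@lebesgue_measure R]_y (y ^+ 2 * f y)%:E < +oo)%E,
      (\int[@lebesgue_measure R]_y (y * f y)%:E = 0)%E &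
      finite_fisher_information f f'].

(* The integral of (n^(1/2) (dGn^(1/2) - dG^(1/2)) - u/2 dG^(1/2))^2 tends to 0;
   it is written with densities for a common dominating measure, on which its
   value does not depend. *)
Definition hellinger_tangent {d} {T : measurableType d} (G : probability T R)
    (Gn : nat -> probability T R) (u : T -> R) : Prop :=
  exists (mu : {sigma_finite_measure set T -> \bar R}) (p : T -> R)
      (pn : nat -> T -> R),
    [/\ is_density mu G p, forall n, is_density mu (Gn n) (pn n) &
        (\int[mu]_x ((Num.sqrt n%:R * (Num.sqrt (pn n x) - Num.sqrt (p x))
                      - 2^-1 * u x * Num.sqrt (p x)) ^+ 2)%:E)%E
          @[n --> \oo] --> 0%E].

End probability_notions.

Section covariates.
Context {R : realType} {m : nat}.
Local Notation X := (m.-tuple R * R)%type.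

(* A version of E_G[U | V = v]. *)
Definition mu_ (G : probability X R) (v : R) : 'cV[R]_m :=
  \col_i (get [set h : R -> R |
     is_cond_expectation G (fun x : X => tnth x.1 i) snd h]) v.

Definition W_ (G : probability X R) : 'M[R]_m :=
  \matrix_(i, j) \int[G]_x (((ucol x.1 - mu_ G x.2) *m
                             (ucol x.1 - mu_ G x.2)^T) i j).

Definition positive_definite (A : 'M[R]_m) : Prop :=
  A^T = A /\ forall a : 'cV[R]_m, a != 0 -> 0 < (a^T *m A *m a) 0 0.

(* The density vanishes off [0, 1] because V takes its values in [0, 1]. *)
Definition G1 (G : probability X R) : Prop :=
  exists (g : R -> R) (c C : R),
    [/\ is_density lebesgue_measure
          (fun A : set R => G (snd @^-1` A)) g,
        0 < c,
        forall v, v \in `[0, 1] -> c <= g v <= C &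
        forall v, v \notin `[0, 1] -> g v = 0].

Definition G2 (G : probability X R) : Prop :=
  (\int[G]_x (\sum_(i < m) (tnth x.1 i) ^+ 2)%:E < +oo)%E /\
  positive_definite (W_ G).

Definition propensity_assumptions (pi : X -> R) : Prop :=
  [/\ measurable_fun setT pi, forall x, 0 <= pi x <= 1 &
      exists2 c : R, 0 < c & forall x, c <= pi x].

Definition residual (theta : 'cV[R]_m) (rho : R -> R) (x : X) (y : R) : R :=
  y - dotv theta x.1 - rho x.2.

(* Y = theta^T U + rho(V) + eps, where (U, V) has distribution G, eps has
   density f, and eps is independent of (U, V). *)
Definition partially_linear {d} {Omega : measurableType d}
    (P : probability Omega R) (U : Omega -> m.-tuple R) (V Y : Omega -> R)
    (theta : 'cV[R]_m) (rho f : R -> R) (G : probability X R) : Prop :=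
  [/\ measurable_fun setT U, measurable_fun setT V, measurable_fun setT Y &
      forall (A : set X) (B : set R), measurable A -> measurable B ->
        P [set w | A (U w, V w) /\ B (residual theta rho (U w, V w) (Y w))] =
        (G A * \int[lebesgue_measure]_(y in B) (f y)%:E)%E].

(* P(delta = 1 | U, V, Y) = P(delta = 1 | U, V) = pi(U, V). *)
Definition missing_at_random {d} {Omega : measurableType d}
    (P : probability Omega R) (U : Omega -> m.-tuple R) (V Y : Omega -> R)
    (delta : Omega -> bool) (pi : X -> R) : Prop :=
  [/\ measurable_fun setT delta,
      is_cond_expectation P (fun w => (delta w)%:R)
        (fun w => (U w, V w, Y w)) (fun z : X * R => pi z.1) &
      is_cond_expectation P (fun w => (delta w)%:R) (fun w => (U w, V w)) pi].

(* n^(1/2) times the norm of the remainder in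
   T = theta + n^-1 sum_j psi_j + o_P(n^(-1/2)). *)
Definition scaled_remainder (n : nat) (theta T : 'cV[R]_m)
    (psi : 'I_n -> 'cV[R]_m) : R :=
  Num.sqrt n%:R * `|T - theta - n%:R^-1 *: \sum_(j < n) psi j|.

Definition full_estimator (t : forall n, n.-tuple (X * R) -> 'cV[R]_m) : Prop :=
  forall n i, measurable_fun setT (fun s : n.-tuple (X * R) => t n s i 0).

Definition full_influence (theta : 'cV[R]_m) (rho f f' : R -> R)
    (G : probability X R) (z : X * R) : 'cV[R]_m :=
  score f f' (residual theta rho z.1 z.2) *:
    (invmx (fisher_information f f' *: W_ G) *m (ucol z.1.1 - mu_ G z.1.2)).

(* o_P(n^(-1/2)) only depends on the law of the sample of size n; that sample
   is taken to be the coordinates of n.-tuple (X * R) under the n-fold product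
   Pn n of the distribution of (U, V, Y). *)
Definition efficient_full (t : forall n, n.-tuple (X * R) -> 'cV[R]_m) : Prop :=
  forall (theta : 'cV[R]_m) (rho f f' : R -> R) (G : probability X R)
      (Pn : forall n, probability (n.-tuple (X * R)) R),
    twice_continuously_differentiable rho ->
    error_density f f' ->
    G1 G -> G2 G ->
    (forall n (j : 'I_n), partially_linear (Pn n)
       (fun s => (tnth s j).1.1) (fun s => (tnth s j).1.2)
       (fun s => (tnth s j).2) theta rho f G) ->
    (forall n, mutually_independent (Pn n)
       (fun (j : 'I_n) (s : n.-tuple (X * R)) => tnth s j)) ->
    forall e : R, 0 < e ->
      Pn n [set s | e < scaled_remainder theta (t n s)
             (fun j => full_influence theta rho f f' G (tnth s j))]
        @[n --> \oo] --> 0%E.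

(* An observation (x, delta * y, delta) in the missing-data model. *)
Definition observe (x : X) (y : R) (delta : bool) : X * R * bool :=
  (x, delta%:R * y, delta).

Definition mar_estimator
    (T : forall n, n.-tuple (X * R * bool) -> 'cV[R]_m) : Prop :=
  forall n i, measurable_fun setT (fun s : n.-tuple (X * R * bool) => T n s i 0).

Definition complete_case (t : forall n, n.-tuple (X * R) -> 'cV[R]_m)
    (c : 'cV[R]_m) (n : nat) (o : n.-tuple (X * R * bool)) : 'cV[R]_m :=
  let s := [seq z.1 | z <- o & z.2] in
  if size s == 0%N then c else t (size s) (in_tuple s).

Definition tangent_G (G : probability X R) (u : X -> R) : Prop :=
  [/\ measurable_fun setT u, (\int[G]_x (u x)%:E = 0)%E,
      (\int[G]_x (u x ^+ 2)%:E < +oo)%E &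
      exists Gn : nat -> probability X R,
        (forall n, G1 (Gn n) /\ G2 (Gn n)) /\ hellinger_tangent G Gn u].

(* The space of tangents for the propensity; bernoulli_pmf p is the density of
   the Bernoulli distribution B_p with respect to counting measure on bool. *)
Definition tangent_pi (G : probability X R) (pi : X -> R) (w : X -> R) : Prop :=
  [/\ measurable_fun setT w,
      (\int[G]_x (w x ^+ 2 * (pi x * (1 - pi x)))%:E < +oo)%E &
      exists pin : nat -> X -> R,
        (forall n, propensity_assumptions (pin n)) /\
        (\int[G]_x (\sum_(b : bool)
            (Num.sqrt n%:R * (Num.sqrt (bernoulli_pmf (pin n x) b)
                              - Num.sqrt (bernoulli_pmf (pi x) b))
             - 2^-1 * (b%:R - pi x) * w x
               * Num.sqrt (bernoulli_pmf (pi x) b)) ^+ 2)%:E)%E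
          @[n --> \oo] --> 0%E].

(* The conditions on b and c for a^T U l_f(eps) + b(V) l_f(eps) + c(eps) to be
   a tangent for the conditional distribution Q. *)
Definition tangent_Q_coef (G : probability X R) (f : R -> R) (b c : R -> R) :
    Prop :=
  [/\ measurable_fun setT b /\ (\int[G]_x (b x.2 ^+ 2)%:E < +oo)%E,
      measurable_fun setT c /\
        (\int[@lebesgue_measure R]_y (c y ^+ 2 * f y)%:E < +oo)%E,
      (\int[@lebesgue_measure R]_y (c y * f y)%:E = 0)%E &
      (\int[@lebesgue_measure R]_y (y * c y * f y)%:E = 0)%E].

Definition tangent_Q (theta : 'cV[R]_m) (rho f f' : R -> R)
    (a : 'cV[R]_m) (b c : R -> R) (x : X) (y : R) : R :=
  let eps := residual theta rho x y in
  dotv a x.1 * score f f' eps + b x.2 * score f f' eps + c eps.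

Section canonical_gradient.
Context {d : measure_display} {Omega : measurableType d}.
Variables (P : probability Omega R) (U : Omega -> m.-tuple R).
Variables (V Y : Omega -> R) (delta : Omega -> bool).
Variables (theta : 'cV[R]_m) (rho f f' : R -> R) (pi : X -> R).
Variable G : probability X R.

Definition tangent (u w : X -> R) (a : 'cV[R]_m) (b c : R -> R)
    (om : Omega) : R :=
  u (U om, V om)
  + (delta om)%:R * tangent_Q theta rho f f' a b c (U om, V om) (Y om)
  + ((delta om)%:R - pi (U om, V om)) * w (U om, V om).

Definition canonical_gradient (g : X * R * bool -> 'cV[R]_m) : Prop :=
  [/\ forall i, measurable_fun setT (fun z => g z i 0),
      forall i, exists u w a b c,
        [/\ tangent_G G u, tangent_pi G pi w, tangent_Q_coef G f b c &
            {ae P, forall om,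
               g (observe (U om, V om) (Y om) (delta om)) i 0 =
               tangent u w a b c om}] &
      forall u w a b c,
        tangent_G G u -> tangent_pi G pi w -> tangent_Q_coef G f b c ->
        forall i, (\int[P]_om
          (g (observe (U om, V om) (Y om) (delta om)) i 0
           * tangent u w a b c om)%:E = (a i 0)%:E)%E].

End canonical_gradient.

Definition mar_influence (theta : 'cV[R]_m) (rho f f' : R -> R)
    (Gt : probability X R) (Edelta : R) (x : X) (y : R) (delta : bool) :
    'cV[R]_m :=
  (delta%:R / Edelta * score f f' (residual theta rho x y)) *:
    (invmx (fisher_information f f' *: W_ Gt) *m (ucol x.1 - mu_ Gt x.2)).

(* T_n = theta + n^-1 sum_(j < n) psi_j + o_P(n^(-1/2)), where T_n is computed
   from the first n observations and psi_j = psi (U_j, V_j) Y_j delta_j. *)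
Definition mar_expansion {d} {Omega : measurableType d}
    (P : probability Omega R) (U_ : nat -> Omega -> m.-tuple R)
    (V_ Y_ : nat -> Omega -> R) (delta_ : nat -> Omega -> bool)
    (theta : 'cV[R]_m)
    (T : forall n, n.-tuple (X * R * bool) -> 'cV[R]_m)
    (psi : X -> R -> bool -> 'cV[R]_m) : Prop :=
  forall e : R, 0 < e ->
    P [set om | e < scaled_remainder theta
         (T n [tuple observe (U_ j om, V_ j om) (Y_ j om) (delta_ j om) | j < n])
         (fun j : 'I_n => psi (U_ j om, V_ j om) (Y_ j om) (delta_ j om))]
      @[n --> \oo] --> 0%E.

(* (U, V, Y, delta) is the generic vector that determines the canonical
   gradient, (U_ j, V_ j, Y_ j, delta_ j) are its copies. *)
Definition efficient_mar {d} {Omega : measurableType d}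
    (P : probability Omega R) (U : Omega -> m.-tuple R) (V Y : Omega -> R)
    (delta : Omega -> bool) (U_ : nat -> Omega -> m.-tuple R)
    (V_ Y_ : nat -> Omega -> R) (delta_ : nat -> Omega -> bool)
    (theta : 'cV[R]_m) (rho f f' : R -> R) (pi : X -> R)
    (G : probability X R)
    (T : forall n, n.-tuple (X * R * bool) -> 'cV[R]_m) : Prop :=
  exists g : X * R * bool -> 'cV[R]_m,
    canonical_gradient P U V Y delta theta rho f f' pi G g /\
    mar_expansion P U_ V_ Y_ delta_ theta T
      (fun x y dl => g (observe x y dl)).

Definition independent_copies {d} {Omega : measurableType d}
    (P : probability Omega R) {d'} {T : measurableType d'}
    (Z : Omega -> T) (Z_ : nat -> Omega -> T) : Prop :=
  [/\ forall j, measurable_fun setT (Z_ j),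
      forall j A, measurable A -> P (Z_ j @^-1` A) = P (Z @^-1` A) &
      forall n, mutually_independent P (fun j : 'I_n => Z_ j)].

(* Gt is the conditional distribution of (U, V) given delta = 1. *)
Definition conditional_law {d} {Omega : measurableType d}
    (P : probability Omega R) (U : Omega -> m.-tuple R) (V : Omega -> R)
    (delta : Omega -> bool) (Gt : probability X R) : Prop :=
  forall A, measurable A ->
    Gt A = (fine (P [set w | A (U w, V w) /\ delta w])
            / fine (P [set w | delta w]))%:E.

End covariates.

(* Main.v *)
(* Given [delta = 1] the covariates have law [Gt], whose density with respect to [G] is
   [pi / E delta], and they remain independent of the error, since [delta] and [Y] are
   conditionally independent given [(U, V)]. The complete cases are thus a sample from
   the full model with [G] replaced by [Gt], and [Gt] inherits (G1) and (G2).

   The function [delta / E delta * (J W)^-1 (U - mu (V)) l_f (eps)], with [mu] and [W]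
   taken under [Gt], lies in the tangent space. Under [Gt] the variable [U - mu (V)] has
   mean zero and is orthogonal to the functions of [V], so the inner product with a
   tangent loses its terms in [b] and [c]; the terms in [u] and [w] vanish because the
   score has mean zero. What is left is [(J W)^-1 J W a = a]. Two canonical gradients
   agree almost surely, because their difference is a tangent orthogonal to the tangent
   space.

   Given the indicators, the [N] complete cases are independent with the law above, so
   the full-model expansion holds for them at sample size [N]; as [N / n] tends to
   [E delta] in probability, it is the MAR expansion at sample size [n]. *)
Require Import Defs.
From mathcomp Require Import measurable_realfun ring lra.

Set Implicit Arguments.
Unset Strict Implicit.
Unset Printing Implicit Defensive.

(** * Integrability and change of measure *)

Lemma measurable_preimageT d d' (T : measurableType d) (T' : measurableType d')
    (f : T -> T') (B : set T') :
  measurable_fun setT f -> measurable B -> measurable (f @^-1` B).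
Proof. by move=> mf mB; rewrite -[X in measurable X]setTI; exact: mf. Qed.

Section real_integrable.
Context {R : realType} {d : measure_display} {T : measurableType d}
  (mu : {measure set T -> \bar R}).
Implicit Types f g : T -> R.

Local Notation intg f := (mu.-integrable setT (fun x => (f x)%:E)).

Lemma intg_measurable f : intg f -> measurable_fun setT f.
Proof. by move=> /integrableP[+ _] => /measurable_EFinP. Qed.

Lemma intgD f g : intg f -> intg g -> intg (fun x => f x + g x).
Proof. by move=> f1 g1; exact: (integrableD measurableT f1 g1). Qed.

Lemma intgB f g : intg f -> intg g -> intg (fun x => f x - g x).
Proof. by move=> f1 g1; exact: (integrableB measurableT f1 g1). Qed.

Lemma intgZl (r : R) f : intg f -> intg (fun x => r * f x).
Proof. by move=> f1; exact: (integrableZl measurableT r f1). Qed.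

Lemma intg_norm f : intg f -> intg (fun x => `|f x|).
Proof. by move=> f1; exact: (integrable_abse f1). Qed.

Lemma intg_le f g : measurable_fun setT f -> intg g ->
  (forall x, `|f x| <= g x) -> intg f.
Proof.
move=> mf ig fg; apply: (le_integrable measurableT _ _ ig); first exact/measurable_EFinP.
by move=> x _; rewrite /= lee_fin; exact: le_trans (fg x) (ler_norm _).
Qed.

Lemma intg_sum (I : Type) (s : seq I) (F : I -> T -> R) : (forall i, intg (F i)) ->
  intg (fun x => \sum_(i <- s) F i x).
Proof.
move=> iF; under eq_fun do rewrite -sumEFin.
by apply: integrable_sum => // i _; exact: iF.
Qed.

Lemma Rintegral_sum (I : Type) (s : seq I) (F : I -> T -> R) : (forall i, intg (F i)) ->
  \int[mu]_x \sum_(i <- s) F i x = \sum_(i <- s) \int[mu]_x F i x.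
Proof.
move=> iF; elim: s => [|i s IH].
  under eq_Rintegral do rewrite big_nil.
  by rewrite big_nil Rintegral_cst// mul0r.
under eq_Rintegral do rewrite big_cons.
by rewrite big_cons RintegralD// ?IH//; [exact: iF|exact: intg_sum].
Qed.

Lemma intgM f g : measurable_fun setT f -> measurable_fun setT g ->
  intg (fun x => f x ^+ 2) -> intg (fun x => g x ^+ 2) ->
  intg (fun x => f x * g x).
Proof.
move=> mf mg f2 g2; apply: (intg_le _ (intgD f2 g2)).
  exact: measurable_funM.
move=> x; rewrite normrM; have := sqr_ge0 (`|f x| - `|g x|).
have := sqr_ge0 (`|f x| + `|g x|).
rewrite -[f x ^+ 2]real_normK ?num_real// -[g x ^+ 2]real_normK ?num_real//.
by nra.
Qed.

Lemma intg_sqrD f g : measurable_fun setT f -> measurable_fun setT g ->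
  intg (fun x => f x ^+ 2) -> intg (fun x => g x ^+ 2) ->
  intg (fun x => (f x + g x) ^+ 2).
Proof.
move=> mf mg f2 g2.
have H : intg (fun x => f x ^+ 2 + 2 * (f x * g x) + g x ^+ 2).
  by apply: intgD => //; apply: intgD => //; apply: intgZl; exact: intgM.
apply: (intg_le _ H); first by apply: measurable_funX; exact: measurable_funD.
by move=> x; rewrite ger0_norm ?sqr_ge0// sqrrD mulr_natl.
Qed.

Lemma intg_sqrZ (r : R) f : intg (fun x => f x ^+ 2) -> intg (fun x => (r * f x) ^+ 2).
Proof.
by move=> f2; under eq_fun do rewrite exprMn; exact: intgZl.
Qed.

Lemma intg_sqr_sum (I : Type) (s : seq I) (F : I -> T -> R) :
  (forall i, measurable_fun setT (F i)) -> (forall i, intg (fun x => F i x ^+ 2)) ->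
  intg (fun x => (\sum_(i <- s) F i x) ^+ 2).
Proof.
move=> mF iF; elim: s => [|i s IH].
  by under eq_fun do rewrite big_nil expr0n; exact: integrable0.
under eq_fun do rewrite big_cons.
by apply: intg_sqrD => //; exact: measurable_sum.
Qed.

Lemma ge0_intg f : measurable_fun setT f -> (forall x, 0 <= f x) ->
  (\int[mu]_x (f x)%:E < +oo)%E -> intg f.
Proof.
move=> mf f0 foo; apply/integrableP; split; first exact/measurable_EFinP.
by under eq_integral => x _ do rewrite /= ger0_norm//.
Qed.

Lemma intg_lty f : (forall x, 0 <= f x) -> intg f -> (\int[mu]_x (f x)%:E < +oo)%E.
Proof.
move=> f0 /integrableP[_].
by under eq_integral => x _ do rewrite /= ger0_norm//.
Qed.

Lemma EFin_Rintegral f : intg f -> (\int[mu]_x (f x)%:E = (\int[mu]_x f x)%:E)%E.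
Proof. by move=> f1; rewrite /Rintegral fineK//; exact: integrable_fin_num. Qed.

End real_integrable.

Lemma intg_cst {R : realType} {d} {T : measurableType d} (P : probability T R) (r : R) :
  P.-integrable setT (fun=> r%:E).
Proof. exact: finite_measure_integrable_cst. Qed.

Lemma sqr_intg {R : realType} {d} {T : measurableType d} (P : probability T R) (f : T -> R) :
  measurable_fun setT f -> P.-integrable setT (fun x => (f x ^+ 2)%:E) ->
  P.-integrable setT (fun x => (f x)%:E).
Proof.
move=> mf f2; apply: (intg_le mf (intgD f2 (intg_cst P 1))) => x.
have := sqr_ge0 (`|f x| - 1); rewrite -(real_normK (num_real (f x))).
by have := normr_ge0 (f x); set a := `|_|; nra.
Qed.

Section transfer.
Context {R : realType} {d d' : measure_display} {T : measurableType d}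
  {T' : measurableType d'} (mu : {measure set T -> \bar R}).
Variables (phi : T -> T') (p : T -> R).
Hypotheses (mphi : measurable_fun setT phi) (mp : measurable_fun setT p).
Hypothesis (p0 : forall x, 0 <= p x).

Import HBNNSimple.

Let mpE : measurable_fun setT (EFin \o p). Proof. exact/measurable_EFinP. Qed.

Lemma nnsfun_weighted_integral (h : {nnsfun T' >-> R}) :
  (\int[mu]_x ((p x)%:E * (h (phi x))%:E) =
   \sum_(y \in range h) (y%:E * \int[mu]_(x in phi @^-1` (h @^-1` [set y])) (p x)%:E))%E.
Proof.
have mI (y : R) : measurable (phi @^-1` (h @^-1` [set y])).
  by rewrite -[X in measurable X]setTI; apply: mphi => //.
transitivity (\int[mu]_x (\sum_(y \in range h)
    ((p x)%:E * (y * \1_(phi @^-1` (h @^-1` [set y])) x)%:E)))%E.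
  apply: eq_integral => x _; rewrite (fimfunE h) -fsumEFin//.
  rewrite ge0_mule_fsumr// => y.
  exact: (@nnfun_muleindic_ge0 _ _ _ h).
rewrite ge0_integral_fsum//; last 2 first.
  - move=> y; apply: emeasurable_funM => //; apply/measurable_EFinP.
    by apply: measurable_funM => //; exact: measurable_indic.
  - move=> y x _; apply: mule_ge0; first by rewrite lee_fin.
    exact: (@nnfun_muleindic_ge0 _ _ _ h).
apply: eq_fsbigr => y; rewrite inE => -[t _ <-].
have h0 : 0 <= h t by [].
rewrite -ge0_integralZl//; last first.
- by move=> x _; rewrite lee_fin.
- exact: measurable_funTS.
rewrite [RHS]integral_mkcond; apply: eq_integral => x _.
rewrite patchE indicE; case: ifPn => xA.
  by rewrite mulr1 muleC.
by rewrite mulr0 mule0.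
Qed.

Lemma weighted_integral_lim (k : T' -> \bar R) (mk : measurable_fun setT k)
    (k0 : (forall x, 0 <= k x)%E) :
  (\int[mu]_x ((p x)%:E * k (phi x)))%E =
  limn (fun n => \int[mu]_x ((p x)%:E * (nnsfun_approx measurableT mk n (phi x))%:E))%E.
Proof.
set h := nnsfun_approx measurableT mk.
have kE x : k (phi x) = limn (fun n => (h n (phi x))%:E).
  by apply/esym/cvg_lim => //; exact: (cvg_nnsfun_approx measurableT mk (fun x _ => k0 x)).
transitivity (\int[mu]_x (limn (fun n => (p x)%:E * (h n (phi x))%:E)))%E.
  apply: eq_integral => x _; apply/esym/cvg_lim => //; apply: cvgeZl => //.
  exact: (cvg_nnsfun_approx measurableT mk (fun x _ => k0 x)).
apply: monotone_convergence => //.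
- move=> n; apply: emeasurable_funM => //; apply/measurable_EFinP.
  exact: measurableT_comp.
- by move=> n x _; apply: mule_ge0; rewrite lee_fin.
- move=> x _ a b ab; apply: lee_wpmul2l; first by rewrite lee_fin.
  by rewrite lee_fin; exact/lefP/nd_nnsfun_approx.
Qed.

End transfer.

Section transfer2.
Context {R : realType} {d1 d2 d : measure_display} {T1 : measurableType d1}
  {T2 : measurableType d2} {T : measurableType d}
  (m1 : {measure set T1 -> \bar R}) (m2 : {measure set T2 -> \bar R}).
Import HBNNSimple.
Variables (phi1 : T1 -> T) (phi2 : T2 -> T) (p1 : T1 -> R) (p2 : T2 -> R).
Hypotheses (mphi1 : measurable_fun setT phi1) (mphi2 : measurable_fun setT phi2).
Hypotheses (mp1 : measurable_fun setT p1) (mp2 : measurable_fun setT p2).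
Hypotheses (p10 : forall x, 0 <= p1 x) (p20 : forall x, 0 <= p2 x).
Hypothesis transfer : forall B, measurable B ->
  (\int[m1]_(x in phi1 @^-1` B) (p1 x)%:E = \int[m2]_(x in phi2 @^-1` B) (p2 x)%:E)%E.

Lemma ge0_integral_transfer (k : T -> \bar R) :
  measurable_fun setT k -> (forall x, 0 <= k x)%E ->
  (\int[m1]_x ((p1 x)%:E * k (phi1 x)) = \int[m2]_x ((p2 x)%:E * k (phi2 x)))%E.
Proof.
move=> mk k0; rewrite (weighted_integral_lim m1 mphi1 mp1 p10 mk)//.
rewrite (weighted_integral_lim m2 mphi2 mp2 p20 mk)//.
congr (limn _); apply/funext => n.
rewrite !nnsfun_weighted_integral//; apply: eq_fsbigr => y _.
by rewrite transfer.
Qed.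

Lemma integrable_transfer (k : T -> R) : measurable_fun setT k ->
  m1.-integrable setT (fun x => (p1 x * k (phi1 x))%:E) ->
  m2.-integrable setT (fun x => (p2 x * k (phi2 x))%:E).
Proof.
move=> mk /integrableP[_ i1]; apply/integrableP; split.
  by apply/measurable_EFinP/measurable_funM => //; exact: measurableT_comp.
suff <- : (\int[m1]_x `|(p1 x * k (phi1 x))%:E| = \int[m2]_x `|(p2 x * k (phi2 x))%:E|)%E by [].
transitivity (\int[m1]_x ((p1 x)%:E * `|k (phi1 x)|%:E))%E.
  by apply: eq_integral => x _; rewrite -EFinM /= normrM ger0_norm.
rewrite (ge0_integral_transfer (k := fun t => `|k t|%:E))//; last
  exact/measurable_EFinP/measurableT_comp.
by apply: eq_integral => x _; rewrite -EFinM /= normrM ger0_norm.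
Qed.

Lemma integral_transfer (k : T -> R) : measurable_fun setT k ->
  (\int[m1]_x (p1 x * k (phi1 x))%:E = \int[m2]_x (p2 x * k (phi2 x))%:E)%E.
Proof.
move=> mk; rewrite integralE [RHS]integralE.
congr (_ - _)%E.
- have mk1 : measurable_fun setT (fun t => (Num.max (k t) 0)%:E).
    by apply/measurable_EFinP; exact: measurable_maxr.
  transitivity (\int[m1]_x ((p1 x)%:E * (Num.max (k (phi1 x)) 0)%:E))%E.
    by apply: eq_integral => x _; rewrite funeposE -EFin_max -EFinM maxr_pMr// mulr0.
  rewrite (ge0_integral_transfer mk1)//; last by move=> x; rewrite lee_fin le_max lexx orbT.
  by apply: eq_integral => x _; rewrite funeposE -EFin_max -EFinM maxr_pMr// mulr0.
- have mk1 : measurable_fun setT (fun t => (Num.max (- k t) 0)%:E).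
    by apply/measurable_EFinP; apply: measurable_maxr => //; exact: measurableT_comp.
  transitivity (\int[m1]_x ((p1 x)%:E * (Num.max (- k (phi1 x)) 0)%:E))%E.
    by apply: eq_integral => x _; rewrite funenegE -EFinN -EFin_max -EFinM maxr_pMr// mulr0 mulrN.
  rewrite (ge0_integral_transfer mk1)//; last by move=> x; rewrite lee_fin le_max lexx orbT.
  by apply: eq_integral => x _; rewrite funenegE -EFinN -EFin_max -EFinM maxr_pMr// mulr0 mulrN.
Qed.

End transfer2.

Section same_law.
Context {R : realType} {d1 d2 d : measure_display} {T1 : measurableType d1}
  {T2 : measurableType d2} {T : measurableType d}
  (m1 : {measure set T1 -> \bar R}) (m2 : {measure set T2 -> \bar R}).
Variables (phi1 : T1 -> T) (phi2 : T2 -> T).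
Hypotheses (mphi1 : measurable_fun setT phi1) (mphi2 : measurable_fun setT phi2).
Hypothesis same_law : forall B, measurable B -> m1 (phi1 @^-1` B) = m2 (phi2 @^-1` B).

Let same_law1 B : measurable B ->
  (\int[m1]_(x in phi1 @^-1` B) 1%:E = \int[m2]_(x in phi2 @^-1` B) 1%:E)%E.
Proof.
move=> mB; rewrite !integral_cst ?mul1e ?same_law//.
  by rewrite -[X in measurable X]setTI; exact: mphi2.
by rewrite -[X in measurable X]setTI; exact: mphi1.
Qed.

Let mc1 : measurable_fun [set: T1] (cst (1 : R)). Proof. exact: measurable_cst. Qed.
Let mc2 : measurable_fun [set: T2] (cst (1 : R)). Proof. exact: measurable_cst. Qed.

Lemma ge0_integral_same_law (k : T -> \bar R) :
  measurable_fun setT k -> (forall x, 0 <= k x)%E ->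
  (\int[m1]_x k (phi1 x) = \int[m2]_x k (phi2 x))%E.
Proof.
move=> mk k0; have := ge0_integral_transfer mphi1 mphi2 mc1 mc2
  (fun=> ler01) (fun=> ler01) same_law1 mk k0.
by under eq_integral do rewrite mul1e; under [in RHS]eq_integral do rewrite mul1e.
Qed.

Lemma integrable_same_law (k : T -> R) : measurable_fun setT k ->
  m1.-integrable setT (fun x => (k (phi1 x))%:E) ->
  m2.-integrable setT (fun x => (k (phi2 x))%:E).
Proof.
move=> mk ik.
have := integrable_transfer mphi1 mphi2 mc1 mc2 (fun=> ler01) (fun=> ler01) same_law1 mk.
have -> : (fun x => (cst 1 x * k (phi1 x))%:E) = (fun x => (k (phi1 x))%:E).
  by apply/funext => x; rewrite mul1r.
by move/(_ ik); congr integrable; apply/funext => x; rewrite mul1r.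
Qed.

Lemma Rintegral_same_law (k : T -> R) : measurable_fun setT k ->
  \int[m1]_x k (phi1 x) = \int[m2]_x k (phi2 x).
Proof.
move=> mk; have := integral_transfer mphi1 mphi2 mc1 mc2
  (fun=> ler01) (fun=> ler01) same_law1 mk.
under eq_integral do rewrite mul1r.
by under [in RHS]eq_integral do rewrite mul1r; rewrite /Rintegral => ->.
Qed.

End same_law.

Section independent_product.
Context {R : realType} {d d1 d2 : measure_display} {T : measurableType d}
  {T1 : measurableType d1} {T2 : measurableType d2} (P : probability T R).
Variables (Z1 : T -> T1) (Z2 : T -> T2).
Hypotheses (mZ1 : measurable_fun setT Z1) (mZ2 : measurable_fun setT Z2).
Hypothesis indep : forall A B, measurable A -> measurable B ->
  P (Z1 @^-1` A `&` Z2 @^-1` B) = (P (Z1 @^-1` A) * P (Z2 @^-1` B))%E.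

Let mpre1 A : measurable A -> measurable (Z1 @^-1` A).
Proof. by move=> mA; rewrite -[X in measurable X]setTI; exact: mZ1. Qed.

Let mpre2 A : measurable A -> measurable (Z2 @^-1` A).
Proof. by move=> mA; rewrite -[X in measurable X]setTI; exact: mZ2. Qed.

Let indicator_product A B : measurable A -> measurable B ->
  (\int[P]_(x in Z1 @^-1` A) (\1_(Z2 @^-1` B) x)%:E =
   \int[P]_(x in Z1 @^-1` A) (fine (P (Z2 @^-1` B)))%:E)%E.
Proof.
move=> mA mB; rewrite integral_indic//; [|exact: mpre1|exact: mpre2].
rewrite integral_cst; last exact: mpre1.
rewrite setIC; transitivity (P (Z1 @^-1` A) * P (Z2 @^-1` B))%E; first exact: indep.
by rewrite muleC fineK// fin_num_measure//; exact: mpre2.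
Qed.

Let nonneg_product (k : T1 -> R) : measurable_fun setT k -> (forall x, 0 <= k x) ->
  P.-integrable setT (fun x => (k (Z1 x))%:E) ->
  forall B, measurable B ->
  (\int[P]_(x in Z2 @^-1` B) (k (Z1 x))%:E =
   \int[P]_(x in Z2 @^-1` B) (\int[P]_x k (Z1 x))%:E)%E.
Proof.
move=> mk k0 ik B mB.
have m1B : measurable_fun [set: T] (\1_(Z2 @^-1` B) : T -> R).
  by apply: measurable_indic; exact: mpre2.
have mcB : measurable_fun [set: T] (cst (fine (P (Z2 @^-1` B)))).
  exact: measurable_cst.
have i0 (x : T) : 0 <= \1_(Z2 @^-1` B) x :> R by rewrite indicE.
have H := ge0_integral_transfer mZ1 mZ1 m1B mcB i0
  (fun=> fine_ge0 (measure_ge0 _ _)) (fun A mA => indicator_product mA mB)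
  (k := fun x => (k x)%:E).
rewrite integral_cst; last exact: mpre2.
transitivity (\int[P]_x ((\1_(Z2 @^-1` B) x)%:E * (k (Z1 x))%:E))%E.
  rewrite [LHS]integral_mkcond; apply: eq_integral => x _.
  by rewrite patchE indicE; case: ifPn; rewrite ?mul1e ?mul0e.
rewrite H//=; last exact/measurable_EFinP.
rewrite ge0_integralZl//; last 3 first.
- by apply/measurable_EFinP; exact: measurableT_comp.
- by move=> x _; rewrite lee_fin.
- by rewrite lee_fin fine_ge0.
rewrite fineK; last by rewrite fin_num_measure//; exact: mpre2.
by rewrite muleC /Rintegral fineK//; exact: integrable_fin_num.
Qed.

Let nonneg_signed (k : T1 -> R) (q : T2 -> R) :
  measurable_fun setT k -> measurable_fun setT q -> (forall x, 0 <= k x) ->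
  P.-integrable setT (fun x => (k (Z1 x))%:E) ->
  P.-integrable setT (fun x => (q (Z2 x))%:E) ->
  P.-integrable setT (fun x => (k (Z1 x) * q (Z2 x))%:E) /\
  \int[P]_x (k (Z1 x) * q (Z2 x)) = \int[P]_x k (Z1 x) * \int[P]_x q (Z2 x).
Proof.
move=> mk mq k0 ik iq.
have mkZ : measurable_fun setT (k \o Z1) by exact: measurableT_comp.
have H := nonneg_product mk k0 ik.
have E0 : 0 <= \int[P]_x k (Z1 x) by exact: Rintegral_ge0.
have mcst (r : R) : measurable_fun [set: T] (cst r) by exact: measurable_cst.
split.
  apply: (integrable_transfer mZ2 mZ2 (mcst _) mkZ (fun=> E0) _
    (fun B mB => esym (H B mB)) mq) => //.
  by move=> x; exact: k0.
  exact: intgZl.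
rewrite -RintegralZl// /Rintegral; congr fine.
exact: (integral_transfer mZ2 mZ2 mkZ (mcst _) (fun x => k0 (Z1 x)) (fun=> E0) H mq).
Qed.

Lemma indep_integrableM (k : T1 -> R) (q : T2 -> R) :
  measurable_fun setT k -> measurable_fun setT q ->
  P.-integrable setT (fun x => (k (Z1 x))%:E) ->
  P.-integrable setT (fun x => (q (Z2 x))%:E) ->
  P.-integrable setT (fun x => (k (Z1 x) * q (Z2 x))%:E).
Proof.
move=> mk mq ik iq.
have [] := @nonneg_signed (fun x => `|k x|) q _ mq _ _ iq.
- exact: measurableT_comp.
- by [].
- exact: (integrable_abse ik).
move=> + _; apply: le_integrable => //.
- apply/measurable_EFinP; apply: measurable_funM; exact: measurableT_comp.
- by move=> x _; rewrite /= lee_fin !normrM normr_id.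
Qed.

Lemma indep_RintegralM (k : T1 -> R) (q : T2 -> R) :
  measurable_fun setT k -> measurable_fun setT q ->
  P.-integrable setT (fun x => (k (Z1 x))%:E) ->
  P.-integrable setT (fun x => (q (Z2 x))%:E) ->
  \int[P]_x (k (Z1 x) * q (Z2 x)) = \int[P]_x k (Z1 x) * \int[P]_x q (Z2 x).
Proof.
move=> mk mq ik iq.
have ak : P.-integrable setT (fun x => `|k (Z1 x)|%:E) by exact: (integrable_abse ik).
have mak : measurable_fun setT (fun x => `|k x|) by exact: measurableT_comp.
have [ia Ea] := nonneg_signed mak mq (fun=> normr_ge0 _) ak iq.
have [] := @nonneg_signed (fun x => k x + `|k x|) q _ mq _ _ iq.
- exact: measurable_funD.
- by move=> x; rewrite -lerBlDl sub0r ler_normr lexx orbT.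
- exact: intgD.
move=> ib Eb.
transitivity (\int[P]_x ((k (Z1 x) + `|k (Z1 x)|) * q (Z2 x) - `|k (Z1 x)| * q (Z2 x))).
  by apply: eq_Rintegral => x _; rewrite mulrDl addrK.
by rewrite RintegralB// Ea Eb RintegralD// mulrDl addrK.
Qed.

End independent_product.

(** * Conditional expectation *)

Section conditional_expectation.
Context {R : realType} {d d' : measure_display} {T : measurableType d}
  {T' : measurableType d'} (P : probability T R).

Lemma cond_expectation_exists (Z : T -> R) (W : T -> T') :
  measurable_fun setT W -> P.-integrable setT (fun x => (Z x)%:E) ->
  exists h, is_cond_expectation P Z W h.
Proof.
move=> mW iZ.
pose X : {mfun T >-> T'} := mfun_Sub (mem_set mW).
pose mu := distribution P X.
pose nu := @measure_function_pushforward__canonical__charge_Charge _ _ _ _ W R (induced_charge iZ) mW.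
have mZ := intg_measurable iZ.
have numu : nu `<< mu.
  apply/null_content_dominatesP => A mA muA.
  have mWA := measurable_preimageT mW mA.
  apply: null_set_integral => //.
  by apply/measurable_EFinP; exact: measurable_funTS.
set r := Radon_Nikodym nu mu.
have ir : mu.-integrable setT r := Radon_Nikodym_integrable numu.
have rE x : (fine (r x))%:E = r x by rewrite fineK// Radon_Nikodym_fin_num.
exists (fine \o r).
have mr : measurable_fun setT (fine \o r) by apply: measurableT_comp => //; exact: (measurable_int mu).
have irW : P.-integrable setT (fun w => (fine (r (W w)))%:E).
  apply: (@integrable_same_law _ _ _ _ _ _ _ mu P id W _ _ _ (fine \o r)) => //.
  by rewrite (_ : (fun x => _) = r)//; apply/funext => x; exact: rE.
split => // B mB.
have -> : (\int[P]_(w in W @^-1` B) (Z w)%:E)%E = nu B by [].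
rewrite (Radon_Nikodym_integral numu)//.
transitivity (\int[pushforward P W]_(x in B) r x)%E => //.
rewrite integral_pushforward//.
- by apply: eq_integral => x _; rewrite /= rE.
- exact: measurable_int ir.
- apply: (integrableS measurableT) => //; first exact: measurable_preimageT.
  by rewrite (_ : _ \o _ = (fun w => (fine (r (W w)))%:E))//; apply/funext => x /=; rewrite rE.
Qed.

Section tower.
Variables (Z : T -> R) (W : T -> T') (h : T' -> R).
Hypotheses (mW : measurable_fun setT W) (iZ : P.-integrable setT (fun x => (Z x)%:E)).
Hypothesis hZ : is_cond_expectation P Z W h.

Let mZ := intg_measurable iZ.

Let mh : measurable_fun setT h. Proof. by case: hZ. Qed.

Let mhW : measurable_fun setT (h \o W). Proof. exact: measurableT_comp. Qed.

Lemma cond_expectation_integrable : P.-integrable setT (fun x => (h (W x))%:E).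
Proof. by case: hZ. Qed.

Let p1 x := Num.max (Z x) 0 + Num.max (- h (W x)) 0.
Let p2 x := Num.max (- Z x) 0 + Num.max (h (W x)) 0.

Let pE x : p1 x - p2 x = Z x - h (W x).
Proof.
rewrite /p1 /p2 opprD addrACA [Num.max _ _ + - Num.max (h (W x)) 0]addrC.
have H (a : R) : Num.max a 0 - Num.max (- a) 0 = a.
  by rewrite !maxEle; do 2 case: lerP => ?; lra.
by rewrite H; congr (_ + _); rewrite -[RHS](congr1 -%R (H _)) opprB addrC.
Qed.

Let max_ge0 (a : R) : 0 <= Num.max a 0. Proof. by rewrite le_max lexx orbT. Qed.

Let p10 x : 0 <= p1 x. Proof. by rewrite addr_ge0. Qed.
Let p20 x : 0 <= p2 x. Proof. by rewrite addr_ge0. Qed.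

Let intg_max (f : T -> R) : P.-integrable setT (fun x => (f x)%:E) ->
  P.-integrable setT (fun x => (Num.max (f x) 0)%:E).
Proof.
move=> fi; apply: (intg_le _ (intg_norm fi)).
  by apply: measurable_maxr => //; exact: intg_measurable fi.
by move=> x; rewrite ger0_norm// ge_max ler_norm normr_ge0.
Qed.

Let intgN (f : T -> R) : P.-integrable setT (fun x => (f x)%:E) ->
  P.-integrable setT (fun x => (- f x)%:E).
Proof. by move=> fi; under eq_fun do rewrite -mulN1r; exact: intgZl. Qed.

Let ip1 : P.-integrable setT (fun x => (p1 x)%:E).
Proof.
by apply: intgD; apply: intg_max => //; apply: intgN; exact: cond_expectation_integrable.
Qed.

Let ip2 : P.-integrable setT (fun x => (p2 x)%:E).
Proof.
by apply: intgD; apply: intg_max => //; [exact: intgN|exact: cond_expectation_integrable].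
Qed.

Let p12 B : measurable B ->
  (\int[P]_(x in W @^-1` B) (p1 x)%:E = \int[P]_(x in W @^-1` B) (p2 x)%:E)%E.
Proof.
move=> mB; have mWB := measurable_preimageT mW mB.
have [_ _ /(_ B mB) hB] := hZ.
have iB (f : T -> R) : P.-integrable setT (fun x => (f x)%:E) ->
    P.-integrable (W @^-1` B) (fun x => (f x)%:E).
  by apply: integrableS.
have F (f : T -> R) (fi : P.-integrable setT (fun x => (f x)%:E)) :
    (\int[P]_(x in W @^-1` B) (f x)%:E = (\int[P]_(x in W @^-1` B) f x)%:E)%E.
  by rewrite /Rintegral fineK//; apply: integrable_fin_num => //; exact: iB.
rewrite !F//; congr EFin; apply/eqP; rewrite -subr_eq0 -RintegralB//; try exact: iB.
under eq_Rintegral do rewrite pE.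
rewrite RintegralB//; try exact: iB; last exact/iB/cond_expectation_integrable.
by rewrite subr_eq0 /Rintegral hB.
Qed.

Let kpE (k : T -> R) x : `|k x * p1 x| <= `|k x * Z x| + `|k x * h (W x)| /\
  `|k x * p2 x| <= `|k x * Z x| + `|k x * h (W x)|.
Proof.
rewrite !normrM -!mulrDr; split; apply: ler_wpM2l => //; rewrite ger0_norm//;
  apply: lerD; rewrite ge_max normr_ge0 andbT ?ler_norm//.
- by rewrite -normrN ler_norm.
- by rewrite -normrN ler_norm.
Qed.

Lemma cond_expectation_tower (k : T' -> R) : measurable_fun setT k ->
  P.-integrable setT (fun x => (k (W x) * Z x)%:E) ->
  P.-integrable setT (fun x => (k (W x) * h (W x))%:E) ->
  \int[P]_x (k (W x) * Z x) = \int[P]_x (k (W x) * h (W x)).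
Proof.
move=> mk kZ kh.
have mkW : measurable_fun setT (k \o W) by exact: measurableT_comp.
have i1 : P.-integrable setT (fun x => (k (W x) * p1 x)%:E).
  apply: (intg_le _ (intgD (intg_norm kZ) (intg_norm kh))) => [|x].
    by apply: measurable_funM => //; exact: intg_measurable ip1.
  by have [] := kpE (k \o W) x.
have i2 : P.-integrable setT (fun x => (k (W x) * p2 x)%:E).
  apply: (intg_le _ (intgD (intg_norm kZ) (intg_norm kh))) => [|x].
    by apply: measurable_funM => //; exact: intg_measurable ip2.
  by have [] := kpE (k \o W) x.
apply/eqP; rewrite -subr_eq0 -RintegralB//.
under eq_Rintegral do rewrite -mulrBr -pE mulrBr.
rewrite RintegralB// subr_eq0; apply/eqP.
have := integral_transfer mW mW (intg_measurable ip1) (intg_measurable ip2) p10 p20 p12 mk.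
rewrite /Rintegral; under eq_integral do rewrite mulrC.
by under [in RHS]eq_integral do rewrite mulrC; move=> ->.
Qed.

Hypothesis iZ2 : P.-integrable setT (fun x => (Z x ^+ 2)%:E).

Lemma cond_expectation_sqr_integrable : P.-integrable setT (fun x => (h (W x) ^+ 2)%:E).
Proof.
pose A (n : nat) := [set y : T' | `|h y| <= n%:R].
have mA n : measurable (A n).
  rewrite (_ : A n = (fun y => `|h y|) @^-1` `]-oo, n%:R]%classic); last first.
    by apply/seteqP; split => y /=; rewrite in_itv.
  by apply: measurable_preimageT => //; exact: measurableT_comp.
pose k n y := h y * \1_(A n) y.
have mk n : measurable_fun setT (k n).
  by apply: measurable_funM => //; exact: measurable_indic.
have kn n y : `|k n y| <= n%:R.
  rewrite /k normrM indicE; have [yA|yA] := boolP (y \in A n).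
    by rewrite normr1 mulr1; move: yA; rewrite inE.
  by rewrite normr0 mulr0.
have bnd n (f : T -> R) : P.-integrable setT (fun x => (f x)%:E) ->
    P.-integrable setT (fun x => (k n (W x) * f x)%:E).
  move=> fi; apply: (intg_le _ (intgZl n%:R (intg_norm fi))) => [|x].
    apply: measurable_funM; last exact: intg_measurable fi.
    exact: (measurableT_comp (mk n)).
  by rewrite normrM ler_wpM2r.
have kk n x : k n (W x) * h (W x) = k n (W x) ^+ 2.
  by rewrite /k indicE; case: (_ \in _); rewrite /= ?mulr1 ?expr2 ?mulr0 ?mul0r.
have ik2 n : P.-integrable setT (fun x => (k n (W x) ^+ 2)%:E).
  by under eq_fun do rewrite -kk; exact/bnd/cond_expectation_integrable.
have le2 n : (\int[P]_x (k n (W x) ^+ 2)%:E <= (\int[P]_x Z x ^+ 2)%:E)%E.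
  rewrite EFin_Rintegral// lee_fin.
  have := cond_expectation_tower (mk n) (bnd n _ iZ) (bnd n _ cond_expectation_integrable).
  under [X in _ = X -> _]eq_Rintegral do rewrite kk.
  move=> E.
  have : \int[P]_x (2 * (k n (W x) * Z x)) <= \int[P]_x (k n (W x) ^+ 2 + Z x ^+ 2).
    apply: le_Rintegral => //; [exact/intgZl/bnd|exact: intgD|].
    by move=> x _; have := sqr_ge0 (k n (W x) - Z x); nra.
  rewrite (RintegralD measurableT (ik2 n) iZ2) (RintegralZl 2 measurableT (bnd n _ iZ)).
  by rewrite E; lra.
apply: ge0_intg => [|x|]; [|exact: sqr_ge0|].
  by apply: measurable_funX.
rewrite (_ : (fun x => _) = (fun x => limn (fun n => (k n (W x) ^+ 2)%:E))); last first.
  apply/funext => x; apply/esym/cvg_lim => //.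
  apply: cvg_near_cst.
  near=> n; congr EFin; rewrite /k indicE mem_set ?mulr1//= /A/=.
  by near: n; exact: nbhs_infty_ger.
have nd x : {homo (fun n => (k n (W x) ^+ 2)%:E) : a b / (a <= b)%N >-> (a <= b)%E}.
  move=> a b ab; rewrite lee_fin /k !indicE.
  have [xA|_] := boolP (W x \in A a); last by rewrite mulr0 expr0n/= sqr_ge0.
  rewrite (_ : W x \in A b)//; move: xA; rewrite !inE /A/= => /le_trans; apply.
  by rewrite ler_nat.
have mk2 n : measurable_fun setT (fun x => (k n (W x) ^+ 2)%:E).
  by apply/measurable_EFinP; exact: intg_measurable (ik2 n).
rewrite (monotone_convergence P)//; last first.
  by move=> n x _; rewrite lee_fin sqr_ge0.
apply: le_lt_trans (ltry (\int[P]_x Z x ^+ 2)).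
apply: lime_le => //; last by apply: nearW.
apply: ereal_nondecreasing_is_cvgn => a b ab; apply: ge0_le_integral => //;
  by move=> x _; first [exact: nd | rewrite lee_fin sqr_ge0].
Unshelve. all: by end_near. Qed.

Lemma cond_expectation_orthogonal (k : T' -> R) : measurable_fun setT k ->
  P.-integrable setT (fun x => (k (W x) ^+ 2)%:E) ->
  \int[P]_x (k (W x) * (Z x - h (W x))) = 0.
Proof.
move=> mk ik2.
have mkW : measurable_fun setT (k \o W) by exact: measurableT_comp.
have i1 : P.-integrable setT (fun x => (k (W x) * Z x)%:E).
  exact: (intgM mkW mZ).
have i2 : P.-integrable setT (fun x => (k (W x) * h (W x))%:E).
  exact: (intgM mkW mhW ik2 cond_expectation_sqr_integrable).
under eq_Rintegral do rewrite mulrBr.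
by rewrite RintegralB// cond_expectation_tower// subrr.
Qed.

Lemma cond_expectation_best (k : T' -> R) : measurable_fun setT k ->
  P.-integrable setT (fun x => (k (W x) ^+ 2)%:E) ->
  \int[P]_x ((Z x - h (W x)) ^+ 2) <= \int[P]_x ((Z x - k (W x)) ^+ 2).
Proof.
move=> mk ik2.
have mkW : measurable_fun setT (k \o W) by exact: measurableT_comp.
have ih2 := cond_expectation_sqr_integrable.
have intgNsqr (f : T -> R) : P.-integrable setT (fun x => (f x ^+ 2)%:E) ->
  P.-integrable setT (fun x => ((- f x) ^+ 2)%:E) by under [in X in _ -> X]eq_fun do rewrite sqrrN.
have iZh : P.-integrable setT (fun x => ((Z x - h (W x)) ^+ 2)%:E).
  by apply: intg_sqrD => //; [exact: measurableT_comp|exact: intgNsqr].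
have ihk : P.-integrable setT (fun x => ((h (W x) - k (W x)) ^+ 2)%:E).
  by apply: (intg_sqrD mhW) => //; [exact: measurableT_comp|exact: intgNsqr].
have mhk : measurable_fun setT (fun y => h y - k y) by exact: measurable_funB.
have orth := cond_expectation_orthogonal mhk ihk.
have iM : P.-integrable setT (fun x => ((h (W x) - k (W x)) * (Z x - h (W x)))%:E).
  apply: intgM => //; first exact: measurable_funB.
  exact: measurable_funB.
have -> : \int[P]_x ((Z x - k (W x)) ^+ 2) = \int[P]_x ((Z x - h (W x)) ^+ 2) +
    (2 * \int[P]_x ((h (W x) - k (W x)) * (Z x - h (W x))) +
     \int[P]_x ((h (W x) - k (W x)) ^+ 2)).
  rewrite -(RintegralZl 2 measurableT iM) -(RintegralD measurableT (intgZl 2 iM) ihk).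
  rewrite -(RintegralD measurableT iZh (intgD (intgZl 2 iM) ihk)).
  by apply: eq_Rintegral => x _; ring.
rewrite orth mulr0 add0r lerDl; apply: Rintegral_ge0 => x _; exact: sqr_ge0.
Qed.

End tower.
End conditional_expectation.

(** * Absolutely continuous densities and their score *)

Section absolutely_continuous_functions.
Context {R : realType}.
Local Notation mu := (@lebesgue_measure R).

Lemma is_derive_increment (h : R -> R) (c l e : R) : is_derive c 1 h l -> 0 < e ->
  exists2 r : R, 0 < r & forall y, `|y - c| < r ->
    `|h y - h c - l * (y - c)| <= e * `|y - c|.
Proof.
move=> [dh dl] e0.
have : (t^-1 *: ((h \o shift c) (t *: 1) - h c)) @[t --> 0^'] --> l.
  by rewrite -dl; exact: dh.
move=> /cvgrPdist_le/(_ e e0).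
rewrite /dnbhs near_withinE => /nbhs_ballP[r /= r0 H].
exists r => // y yr; have [->|yc] := eqVneq y c.
  by rewrite !subrr mulr0 subrr normr0 mulr0.
have := H (y - c); rewrite /ball/= sub0r normrN => /(_ yr).
rewrite subr_eq0 => /(_ yc).
rewrite /= /GRing.scale/= mulr1 subrK => H1.
have yc0 : y - c != 0 by rewrite subr_eq0.
rewrite (_ : h y - h c - l * (y - c) = - (y - c) * (l - (y - c)^-1 * (h y - h c))).
  by rewrite normrM normrN mulrC; apply: ler_wpM2r.
by field.
Qed.

(* Where [f] vanishes the score is [- f' / 0 = 0]; this lemma gives [- f' = l_f f] there
   as well. *)
Lemma is_derive_ge0_zero (f : R -> R) (c l : R) : (forall x, 0 <= f x) ->
  is_derive c 1 f l -> f c = 0 -> l = 0.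
Proof.
move=> f0 fl fc; apply/eqP; case: (ltgtP l 0) => // l0.
- have l20 : 0 < - l / 2 by lra.
  have [r r0 /(_ (c + r / 2))] := is_derive_increment fl l20.
  have -> : c + r / 2 - c = r / 2 by ring.
  rewrite ger0_norm; last lra.
  have H : r / 2 < r by lra.
  move=> /(_ H); rewrite fc ler_norml => /andP[_].
  by have := f0 (c + r / 2); nra.
- have l20 : 0 < l / 2 by lra.
  have [r r0 /(_ (c - r / 2))] := is_derive_increment fl l20.
  have -> : c - r / 2 - c = - (r / 2) by ring.
  rewrite normrN ger0_norm; last lra.
  have H : r / 2 < r by lra.
  move=> /(_ H); rewrite fc ler_norml => /andP[_].
  by have := f0 (c - r / 2); nra.
Qed.

(* [O] is to be an open set of small measure containing the points where [h' = 0] fails.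
   The interval [[a, b]] is cut into pieces that either lie in [O], where absolute
   continuity bounds the increments of [h], or have an increment of [h] of at most [e]
   times their length; [good x] records the pieces of the first kind up to [x]. *)
Section cousin.
Variables (h : R -> R) (a b e : R) (O : set R).
Hypotheses (ab : a <= b) (e0 : 0 < e) (oO : open O).
Hypothesis derO : forall x, ~ O x -> is_derive x 1 h 0.

Let mO : measurable O. Proof. exact: open_measurable. Qed.

Let local c : exists2 r : R, 0 < r & forall x y, c - r < x -> x <= c -> c <= y -> y < c + r ->
  `|h y - h x| <= e * (y - x) \/ `]x, y]%classic `<=` O.
Proof.
have [Oc|nOc] := pselect (O c).
  have /nbhs_ballP[r /= r0 rO] : nbhs c O by exact: open_nbhs_nbhs.
  exists r => // x y cx xc cy yc; right => z /=; rewrite in_itv/= => /andP[xz zy].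
  by apply: rO; rewrite /ball/= ltr_norml; apply/andP; split; lra.
have [r r0 H] := is_derive_increment (derO nOc) e0.
exists r => // x y cx xc cy yc; left.
have := H x; have := H y; rewrite !mul0r !subr0 => Hy Hx.
have {}Hy := Hy ltac:(rewrite ltr_norml; apply/andP; split; lra).
have {}Hx := Hx ltac:(rewrite ltr_norml; apply/andP; split; lra).
rewrite (ger0_norm (_ : 0 <= y - c)) ?subr_ge0// in Hy.
rewrite (ler0_norm (_ : x - c <= 0)) ?subr_le0// in Hx.
have -> : h y - h x = (h y - h c) - (h x - h c) by ring.
by apply: le_trans (ler_normB _ _) _; lra.
Qed.

Let good x := exists s : seq (R * R),
  [/\ all (fun p => [&& a <= p.1, p.1 <= p.2 & p.2 <= x]) s,
      pairwise (fun p q => p.2 <= q.1) s,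
      ((\sum_(p <- s) (p.2 - p.1))%:E <= mu (O `&` `]a, x]%classic))%E &
      `|h x - h a| <= e * (x - a) + \sum_(p <- s) `|h p.2 - h p.1|].

Let good_extend x y : a <= x -> x <= y -> y <= b -> good x ->
  `|h y - h x| <= e * (y - x) \/ `]x, y]%classic `<=` O -> good y.
Proof.
move=> ax xy yb [s [sx sp sm sh]] [hxy|xyO].
  exists s; split => //.
  - apply: sub_all sx => p /and3P[-> -> px] /=; exact: le_trans px xy.
  - apply: le_trans sm _; apply: le_measure; rewrite ?inE; try exact: measurableI.
    by apply: setIS; apply: subset_itvl; rewrite bnd_simp.
  - have -> : h y - h a = (h y - h x) + (h x - h a) by ring.
    by apply: le_trans (ler_normD _ _) _; lra.
exists (rcons s (x, y)); split.
- rewrite all_rcons/= ax xy lexx/=; apply: sub_all sx => p /and3P[-> -> px] /=.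
  exact: le_trans px xy.
- rewrite pairwise_rcons sp andbT; apply/allP => p ps /=.
  by move/allP : sx => /(_ p ps)/and3P[].
- rewrite -cats1 big_cat big_seq1/= EFinD.
  have -> : O `&` `]a, y]%classic = (O `&` `]a, x]%classic) `|` `]x, y]%classic.
    apply/seteqP; split => z /=; rewrite !in_itv/=.
      move=> [Oz /andP[az zy]]; have [zx|xz] := leP z x; [left|right].
        by rewrite az.
      by rewrite zy.
    move=> [[Oz /andP[az zx]]|/andP[xz zy]]; split => //.
    - by rewrite az (le_trans zx).
    - by apply: xyO; rewrite /= in_itv/= xz.
    - by rewrite zy (le_lt_trans ax).
  have -> : mu ((O `&` `]a, x]%classic) `|` `]x, y]%classic) =
      (mu (O `&` `]a, x]%classic) + mu `]x, y]%classic)%E.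
    apply: measureU => //; first exact: measurableI.
    apply/seteqP; split => z //=; rewrite !in_itv/= => -[[_ /andP[_ zx]] /andP[xz _]].
    by move: xz; rewrite ltNge zx.
  apply: leeD => //; rewrite lebesgue_measure_itv/= lte_fin.
  by case: ltP => // yx; rewrite lee_fin subr_le0.
- rewrite -cats1 big_cat big_seq1/=.
  have -> : h y - h a = (h y - h x) + (h x - h a) by ring.
  apply: le_trans (ler_normD _ _) _.
  have : 0 <= e * (y - x) by rewrite mulr_ge0 ?subr_ge0// ltW.
  by lra.
Qed.

Lemma cousin_partition : good b.
Proof.
pose S := [set x | [/\ a <= x, x <= b & good x]].
have Sa : S a.
  split => //; exists [::]; split => //.
  - by rewrite big_nil.
  - by rewrite big_nil !subrr normr0 mulr0 addr0.
have ubS : ubound S b by move=> x [].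
have hS : has_sup S by split; [exists a|exists b].
pose c := sup S.
have ac : a <= c by apply: sup_upper_bound.
have cb : c <= b by apply: ge_sup => //; exists a.
have [r r0 H] := local c.
have [x [ax xb gx] cx] := sup_adherent r0 hS.
have xc : x <= c by apply: sup_upper_bound.
pose y := Num.min b (c + r / 2).
have cy : c <= y by rewrite le_min cb/= lerDl divr_ge0// ltW.
have yc : y < c + r by rewrite gt_min; apply/orP; right; lra.
have yb : y <= b by rewrite ge_min lexx.
have gy : good y.
  apply: good_extend gx _ => //; first exact: le_trans xc cy.
  exact: H.
have Sy : S y by split => //; exact: le_trans ac cy.
have yc' : y <= c by apply: sup_upper_bound.
move: yc' gy; rewrite /y minEle; case: ifP => // _; lra.
Qed.

End cousin.

Lemma ac_derive0_increment (h : R -> R) (a b : R) : absolutely_continuous h ->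
  {ae mu, forall x : R, is_derive x 1 h 0} -> a <= b -> h a = h b.
Proof.
move=> ach [N [mN N0 sN]] ab.
suff H e : 0 < e -> `|h b - h a| <= e.
  apply/esym/eqP; rewrite -subr_eq0 -normr_le0; apply/ler_addgt0Pr => e e0.
  by rewrite add0r; exact: H.
move=> e0.
have e20 : 0 < e / 2 by rewrite divr_gt0.
have [r r0 acr] := ach a b (e / 2) e20.
have [|O [oO NO muO]] := lebesgue_regularity_outer mN _ r0; first by rewrite [X in (X < _)%E]N0.
have {}muO : (mu O < r%:E)%E.
  apply: le_lt_trans muO; rewrite -[in X in (X <= _)%E](setDKU NO).
  by apply: le_trans (measureU2 _ _ _) _ => //; [apply: measurableD => //; exact: open_measurable|];
    rewrite [X in (_ + X)%E]N0 adde0.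
pose e1 := e / 2 / (b - a + 1).
have ba1 : 0 < b - a + 1 by lra.
have e10 : 0 < e1 by rewrite divr_gt0.
have derO x : ~ O x -> is_derive x 1 h 0.
  by move=> nO; apply: contrapT => nd; apply: nO; apply: NO; apply: sN.
have [s [sx sp sm sh]] := cousin_partition ab e10 oO derO.
apply: le_trans sh _.
have H1 : e1 * (b - a) <= e / 2.
  rewrite /e1 mulrAC ler_pdivrMr// ler_wpM2l//; lra.
suff : \sum_(p <- s) `|h p.2 - h p.1| < e / 2 by lra.
rewrite big_tnth.
pose x i := (tnth (in_tuple s) i).1; pose y i := (tnth (in_tuple s) i).2.
have sx' i : [&& a <= x i, x i <= y i & y i <= b].
  by move/allP : sx => /(_ (tnth (in_tuple s) i) (mem_tnth i (in_tuple s))).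
apply: (acr _ x y).
- by move=> i; have /and3P[] := sx' i.
- move=> i j ij.
  have ltH (k l : 'I_(size s)) : (k < l)%N -> y k <= x l.
    move=> kl; rewrite /x /y !(tnth_nth (0, 0)).
    by move/(pairwiseP (0, 0)) : sp; apply => //; rewrite inE.
  by have := ij; rewrite -val_eqE neq_ltn => /orP[/ltH|/ltH]; [left|right].
- rewrite -lte_fin; apply: le_lt_trans muO.
  move: sm; rewrite big_tnth => /le_trans; apply; apply: le_measure; rewrite ?inE.
  + by apply: measurableI => //; exact: open_measurable.
  + exact: open_measurable.
  + exact: subIsetl.
Qed.

Section primitive.
Variable g : R -> R.
Hypothesis ig : mu.-integrable setT (fun x => (g x)%:E).

Let igA (A : set R) : measurable A -> mu.-integrable A (fun x => (g x)%:E).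
Proof. by move=> mA; exact: integrableS ig. Qed.

Let iagA (A : set R) : measurable A -> mu.-integrable A (fun x => `|g x|%:E).
Proof. by move=> mA; exact: integrableS (intg_norm ig). Qed.

Let EA (A : set R) : measurable A ->
  (\int[mu]_(x in A) `|g x|%:E = (\int[mu]_(x in A) `|g x|)%:E)%E.
Proof.
by move=> mA; rewrite /Rintegral fineK//; apply: integrable_fin_num => //; exact: iagA.
Qed.

Let subA (A B : set R) : measurable A -> measurable B -> A `<=` B ->
  \int[mu]_(x in A) `|g x| <= \int[mu]_(x in B) `|g x|.
Proof.
move=> mA mB AB; rewrite -lee_fin -!EA//; apply: ge0_subset_integral => //.
exact: (measurable_int mu (iagA mB)).
Qed.

Local Notation F := (fun x : R => \int[mu]_(t in `]-oo, x]) g t).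

Let F_increment x y : x <= y -> `|F y - F x| <= \int[mu]_(t in `]x, y]) `|g t|.
Proof.
move=> xy; rewrite Rintegral_itvB//=; last exact: igA.
by apply: le_normr_Rintegral => //; exact: igA.
Qed.

Lemma primitive_ac : absolutely_continuous F.
Proof.
move=> a b e e0; have [r [r0 H]] := integral_normr_continuous ig e0.
exists r => // n x y xy ndis sr.
pose A i := `]x i, y i]%classic.
have mA i : measurable (A i) by exact: measurable_itv.
have tA : trivIset [set` index_enum 'I_n] A.
  apply/trivIsetP => i j _ _ ij; apply/seteqP; split => z //=.
  rewrite /A/= !in_itv/= => -[/andP[xi yi] /andP[xj yj]].
  by have [|] := ndis i j ij; lra.
have un : uniq (index_enum 'I_n) by rewrite index_enum_uniq.
set D := \big[setU/set0]_(i <- index_enum 'I_n) A i.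
have mD : measurable D by apply: bigsetU_measurable => i _.
have intD (k : R -> \bar R) : measurable_fun setT k -> (forall t, (0 <= k t)%E) ->
    (\int[mu]_(t in D) k t = \sum_(i < n) \int[mu]_(t in A i) k t)%E.
  by move=> mk k0; apply: ge0_integral_bigsetU => //; exact: measurable_funTS.
apply: (@le_lt_trans _ _ (\int[mu]_(t in D) `|g t|)).
  rewrite -lee_fin -EA// intD//; last first.
    by apply/measurable_EFinP/measurableT_comp => //; exact: intg_measurable ig.
  rewrite -sumEFin; apply: lee_sum => i _; rewrite EA// lee_fin.
  by apply: F_increment; have [] := xy i.
apply: H => //.
have := intD (fun=> 1%:E) (measurable_cst _) (fun=> lee01).
rewrite integral_cst// mul1e => ->.
apply: (@le_lt_trans _ _ (\sum_(i < n) (y i - x i))%:E); last by rewrite lte_fin.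
rewrite -sumEFin; apply: lee_sum => i _.
rewrite [X in (X <= _)%E](_ : _ = mu (A i)); last first.
  by rewrite integral_cst//; [exact: mul1e|exact: mA].
rewrite lebesgue_measure_itv/= lte_fin; case: ifP => // _.
by rewrite lee_fin subr_ge0; have [] := xy i.
Qed.

Let tail (N : R) := [set t : R | N <= `|t|].

Let mtail N : measurable (tail N).
Proof.
rewrite (_ : tail N = (fun t : R => `|t|) @^-1` `[N, +oo[%classic); last first.
  by apply/seteqP; split => t /=; rewrite in_itv/= andbT.
by apply: measurable_preimageT => //; exact: measurableT_comp.
Qed.

Lemma integrable_tail (e : R) : 0 < e -> exists2 N : R, 0 <= N & \int[mu]_(t in tail N) `|g t| <= e.
Proof.
move=> e0.
have mg : measurable_fun setT (fun t => `|g t|).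
  by apply: measurableT_comp => //; exact: intg_measurable ig.
have mk (n : nat) : measurable_fun setT (fun t : R => `|g t| * \1_(tail n%:R) t).
  by apply: measurable_funM => //; apply: measurable_indic; exact: mtail.
have H : (fun n : nat => \int[mu]_t (`|g t| * \1_(tail n%:R) t)%:E)%E @ \oo -->
    (\int[mu]_t (cst 0 t))%E.
  apply: (dominated_cvg _ _ _ _ (intg_norm ig)) => //.
  - by move=> n; apply/measurable_EFinP; exact: mk.
  - move=> t _; apply: cvg_near_cst; near=> n; rewrite indicE memNset ?mulr0//=.
    apply/negP; rewrite -ltNge; near: n; exact: nbhs_infty_gtr.
  - move=> n t _; rewrite /= lee_fin normrM normr_id ler_piMr// indicE.
    by case: (_ \in _); rewrite ?normr1 ?normr0.
move: H; rewrite integral0 => /fine_cvgP[_ /cvgrPdist_le/(_ e e0)] [n _ /(_ n (leqnn n))].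
rewrite /= sub0r normrN => H.
exists n%:R => //; apply: le_trans H; apply: le_trans (ler_norm _).
rewrite le_eqVlt; apply/orP; left; apply/eqP; congr fine.
rewrite integral_mkcond; apply: eq_integral => t _; rewrite patchE indicE.
by case: ifPn; rewrite ?mulr1 ?mulr0.
Unshelve. all: by end_near. Qed.

Lemma primitive_tail (N x : R) : N <= `|x| -> 0 <= N ->
  (x <= 0 -> `|F x| <= \int[mu]_(t in tail N) `|g t|) /\
  (0 <= x -> `|\int[mu]_t g t - F x| <= \int[mu]_(t in tail N) `|g t|).
Proof.
move=> Nx N0; split=> x0.
  apply: le_trans (le_normr_Rintegral _ _) _ => //; first exact: igA.
  apply: subA => // t /=; rewrite in_itv/= => tx; apply: le_trans Nx _.
  by rewrite !ler0_norm ?lerN2// (le_trans tx).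
have -> : \int[mu]_t g t - F x = \int[mu]_(t in `]x, +oo[) g t.
  have := @Rintegral_itvB _ g -oo%O +oo%O x; rewrite set_itvNyy => <- //.
apply: le_trans (le_normr_Rintegral _ _) _ => //; first exact: igA.
apply: subA => // t /=; rewrite in_itv/= andbT => tx; apply: le_trans Nx _.
by rewrite !ger0_norm// ltW// (le_lt_trans x0).
Qed.

Lemma primitive_derive : {ae mu, forall x, is_derive (x : R) (1 : R) F (g x)}.
Proof.
have := @FTC1Ny R g (fun y => igA (measurable_itv _))
  (open_integrable_locally openT ig).
apply: filterS; first exact: (ae_filter_ringOfSetsType mu).
move=> x [dF Fx]; rewrite -Fx derive1E; exact: derivableP.
Qed.

End primitive.

Lemma absolutely_continuousB (f g : R -> R) : absolutely_continuous f ->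
  absolutely_continuous g -> absolutely_continuous (f - g).
Proof.
move=> acf acg a b e e0.
have e20 : 0 < e / 2 by rewrite divr_gt0.
have [r r0 Hf] := acf a b _ e20; have [s s0 Hg] := acg a b _ e20.
exists (Num.min r s); first by rewrite lt_min r0.
move=> n x y xy ndis; rewrite lt_min => /andP[/(Hf n x y xy ndis) H1 /(Hg n x y xy ndis) H2].
apply: (@le_lt_trans _ _ (\sum_(i < n) (`|f (y i) - f (x i)| + `|g (y i) - g (x i)|))).
  apply: ler_sum => i _; have fg z : (f - g) z = f z - g z by [].
  rewrite !fg (_ : f (y i) - g (y i) - (f (x i) - g (x i)) =
    (f (y i) - f (x i)) - (g (y i) - g (x i))); last by ring.
  exact: ler_normB.
by rewrite big_split/=; lra.
Qed.

Lemma integrable_lty_measure (f : R -> R) (A : set R) (c : R) :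
  mu.-integrable setT (fun x => (f x)%:E) -> 0 < c -> measurable A ->
  (forall x, A x -> c <= `|f x|) -> (mu A < +oo)%E.
Proof.
move=> /integrableP[mf foo] c0 mA cA.
have : (c%:E * mu A < +oo)%E.
  apply: le_lt_trans foo; rewrite -integral_cst//.
  apply: (@le_trans _ _ (\int[mu]_(x in A) `|(f x)%:E|)%E).
    apply: ge0_le_integral => //.
      by move=> x _; rewrite lee_fin ltW.
    by apply: measurable_funTS; apply: measurableT_comp.
  by apply: ge0_subset_integral => //; apply: measurableT_comp.
by apply: contraTT; rewrite -leNgt leye_eq => /eqP ->; rewrite gt0_muley ?lte_fin.
Qed.

Section ac_integrable.
Variables f g : R -> R.
Hypotheses (acf : absolutely_continuous f)
  (fi : mu.-integrable setT (fun x => (f x)%:E))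
  (ig : mu.-integrable setT (fun x => (g x)%:E))
  (dfg : {ae mu, forall x : R, is_derive x 1 f (g x)}).

Let ac_primitiveE : exists C, forall x, f x = C + \int[mu]_(t in `]-oo, x]) g t.
Proof.
pose F (x : R) := \int[mu]_(t in `]-oo, x]) g t.
have ach : absolutely_continuous (f - F) := absolutely_continuousB acf (primitive_ac ig).
have dh : {ae mu, forall x : R, is_derive x 1 (f - F) 0}.
  apply: (filterS2 (ae_filter_ringOfSetsType mu)) dfg (primitive_derive ig) => x d1 d2.
  rewrite -(subrr (g x)); exact: is_deriveB.
exists ((f - F) 0) => x; suff <- : (f - F) x = (f - F) 0
  by have -> : (f - F) x = f x - F x by []; rewrite subrK.
by have [x0|/ltW x0] := leP x 0; [|apply/esym]; exact: ac_derive0_increment.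
Qed.

(* [f] differs from the primitive by a constant; as [f] is integrable, its limits at
   infinity are zero. *)
Lemma ac_integrable_primitive x : f x = \int[mu]_(t in `]-oo, x]) g t.
Proof.
have [C CE] := ac_primitiveE; suff C0 : C = 0 by rewrite CE C0 add0r.
apply/eqP/negPn/negP => C0.
have c0 : 0 < `|C| / 2 by rewrite divr_gt0// normr_gt0.
have [N N0 HN] := integrable_tail ig c0.
have := @integrable_lty_measure f `]-oo, - N]%classic _ fi c0 (measurable_itv _).
rewrite lebesgue_measure_itv/= ltNyr ltxx => H; suff : false by [].
apply: H => y; rewrite in_itv/= => yN.
have y0 : y <= 0 by rewrite (le_trans yN)// oppr_le0.
have Ny : N <= `|y| by rewrite ler0_norm// lerNr.
have [/(_ y0) + _] := primitive_tail ig Ny N0.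
rewrite CE; set I := Rintegral _ _ _ => HI.
have := lerB_normD C I; lra.
Qed.

Lemma ac_integrable_derivative : \int[mu]_t g t = 0.
Proof.
apply/eqP/negPn/negP; set C := Rintegral _ _ _ => C0.
have c0 : 0 < `|C| / 2 by rewrite divr_gt0// normr_gt0.
have [N N0 HN] := integrable_tail ig c0.
have := @integrable_lty_measure f `[N, +oo[%classic _ fi c0 (measurable_itv _).
rewrite lebesgue_measure_itv/= ltry ltxx => H; suff : false by [].
apply: H => y; rewrite in_itv/= andbT => Ny0.
have y0 : 0 <= y by rewrite (le_trans N0).
have Ny : N <= `|y| by rewrite ger0_norm.
have [_ /(_ y0)] := primitive_tail ig Ny N0.
rewrite ac_integrable_primitive -/C; set I := (X in C - X) => HI.
have := lerB_normD C (I - C); rewrite [C + (I - C)]addrC subrK distrC; lra.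
Qed.

End ac_integrable.
End absolutely_continuous_functions.

Section score.
Context {R : realType}.
Local Notation mu := (@lebesgue_measure R).
Variables f f' : R -> R.
Hypothesis hf : error_density f f'.

Lemma error_density_measurable : measurable_fun setT f.
Proof. by case: hf => [[]]. Qed.

Lemma error_density_ge0 y : 0 <= f y.
Proof. by case: hf => [[]]. Qed.

Lemma score_measurable : measurable_fun setT (score f f').
Proof.
have [_ _ _ [_ mf' _ _]] := hf.
apply: measurable_funM; first exact: measurableT_comp.
rewrite (_ : (fun x => _) = (fun x => f x `^ (-1))).
  by apply: (@measurableT_comp _ _ _ _ _ _ (@powR R ^~ (-1)) setT f);
    [exact: measurable_powR|exact: error_density_measurable].
by apply/funext => x; rewrite powR_inv1// error_density_ge0.
Qed.

Lemma error_density_intg : mu.-integrable setT (fun y : R => (f y)%:E).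
Proof.
apply: ge0_intg; [exact: error_density_measurable|exact: error_density_ge0|].
by have [[_ _ ->] _ _ _] := hf; rewrite ltry.
Qed.

Lemma score2_intg : mu.-integrable setT (fun y : R => (score f f' y ^+ 2 * f y)%:E).
Proof.
apply: ge0_intg.
- exact: measurable_funM (measurable_funX 2 score_measurable) error_density_measurable.
- by move=> y; rewrite mulr_ge0 ?sqr_ge0 ?error_density_ge0.
- by have [_ _ _ []] := hf.
Qed.

Lemma score_intg : mu.-integrable setT (fun y : R => (score f f' y * f y)%:E).
Proof.
apply: (intg_le _ (intgD score2_intg error_density_intg)).
  exact: measurable_funM score_measurable error_density_measurable.
move=> y; have f0 := error_density_ge0 y.
rewrite normrM (ger0_norm f0).
rewrite -(real_normK (num_real (score f f' y))).
set a := `|_|; have a0 : 0 <= a by exact: normr_ge0.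
by have := mulr_ge0 (sqr_ge0 (a - 1)) f0; have := mulr_ge0 a0 f0; nra.
Qed.

Let dfg : {ae mu, forall x : R, is_derive x 1 f (- (score f f' x * f x))}.
Proof.
have [_ _ _ [_ _ df _]] := hf.
apply: filterS df; first exact: (ae_filter_ringOfSetsType mu).
move=> x dfx; suff <- : f' x = - (score f f' x * f x) by [].
have [fx0|fx0] := eqVneq (f x) 0.
  by rewrite fx0 mulr0 oppr0 (is_derive_ge0_zero error_density_ge0 dfx fx0).
by rewrite /score divfK// opprK.
Qed.

Let ig : mu.-integrable setT (fun y : R => (- (score f f' y * f y))%:E).
Proof. by under eq_fun do rewrite -mulN1r; exact/intgZl/score_intg. Qed.

Let acf : absolutely_continuous f.
Proof. by have [_ _ _ []] := hf. Qed.

Lemma score_mean0 : \int[mu]_y (score f f' y * f y) = 0.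
Proof.
have := ac_integrable_derivative acf error_density_intg ig dfg.
under eq_Rintegral do rewrite -mulN1r.
by rewrite (RintegralZl (-1) measurableT score_intg) mulN1r => /eqP; rewrite oppr_eq0 => /eqP.
Qed.

(* If [J_f = 0] then [f' = 0] almost everywhere, and [f], the primitive of [f'], vanishes. *)
Lemma fisher_information_gt0 : 0 < fisher_information f f'.
Proof.
have J0 : 0 <= fisher_information f f'.
  by apply: Rintegral_ge0 => y _; rewrite mulr_ge0 ?sqr_ge0 ?error_density_ge0.
rewrite lt_neqAle J0 andbT; apply/eqP => JE.
have H : ae_eq mu setT (fun y => (score f f' y ^+ 2 * f y)%:E) (cst 0%E).
  apply/(ae_eq_integral_abs mu measurableT).
    by case/integrableP : score2_intg.
  transitivity (\int[mu]_y (score f f' y ^+ 2 * f y)%:E)%E.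
    apply: eq_integral => y _; rewrite gee0_abs// lee_fin mulr_ge0 ?sqr_ge0//.
    exact: error_density_ge0.
  by rewrite (EFin_Rintegral score2_intg) -/(fisher_information f f') -JE.
have H1 (x : R) : f x = 0.
  rewrite (ac_integrable_primitive acf error_density_intg ig dfg).
  rewrite /Rintegral (ae_eq_integral (cst 0%E)) ?integral0//.
  - by apply/measurable_EFinP; apply: measurable_funTS; exact: intg_measurable ig.
  - apply: (@filterS _ _ (ae_filter_ringOfSetsType mu) _ _ _ H) => y /(_ I) /= [] /eqP.
    rewrite mulf_eq0 expf_eq0/= => /orP[]/eqP yE _; congr EFin.
    + by rewrite yE mul0r oppr0.
    + by rewrite yE mulr0 oppr0.
have [[_ _]] := hf; under eq_integral do rewrite H1.
by rewrite integral0 => /esym/eqP; rewrite onee_eq0.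
Qed.

End score.

(** * Independent copies and random subsamples *)

Lemma ler_mx_norm_sum {R : realType} (p q : nat) (v : 'M[R]_(p, q)) :
  `|v| <= \sum_ij `|v ij.1 ij.2|.
Proof.
rewrite [leLHS]mx_normrE; apply/bigmax_leP; split => [|i _].
  by apply: sumr_ge0 => i _.
by rewrite (bigD1 i)//= lerDl; apply: sumr_ge0 => j _.
Qed.

Lemma measurable_mx_norm {R : realType} {d} {T : measurableType d} (p q : nat)
    (v : T -> 'M[R]_(p, q)) : (forall i j, measurable_fun setT (fun x => v x i j)) ->
  measurable_fun setT (fun x => `|v x|).
Proof.
move=> mv; rewrite (_ : (fun x => _) =
    (fun x => \big[Num.max/0]_ij `|v x ij.1 ij.2|)); last first.
  by apply/funext => x; exact: mx_normrE.
elim: (index_enum _) => [|ij s IH].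
  by under eq_fun do rewrite big_nil; exact: measurable_cst.
under eq_fun do rewrite big_cons; apply: measurable_maxr => //.
by apply: measurableT_comp => //; exact: mv.
Qed.

Lemma markov_ineq {R : realType} {d} {T : measurableType d} (P : probability T R)
    (X : T -> R) (c : R) : P.-integrable setT (fun x => (X x)%:E) ->
  (forall x, 0 <= X x) -> 0 < c ->
  (P [set x | c < X x]%R <= (c^-1 * \int[P]_x X x)%:E)%E.
Proof.
move=> iX X0 c0; set A := [set x | _].
have mX := intg_measurable iX.
have mA : measurable A.
  rewrite (_ : A = X @^-1` `]c, +oo[%classic); first exact: measurable_preimageT.
  by apply/seteqP; split => x /=; rewrite in_itv/= andbT.
have -> : P A = (c^-1%:E * (c%:E * P A))%E by rewrite muleA -EFinM mulVf ?gt_eqF// mul1e.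
rewrite EFinM; apply: lee_wpmul2l; first by rewrite lee_fin invr_ge0 ltW.
rewrite -EFin_Rintegral// -integral_cst//.
apply: (@le_trans _ _ (\int[P]_(x in A) (X x)%:E)%E).
  apply: ge0_le_integral => //.
  - by move=> x _; rewrite lee_fin ltW.
  - by apply: measurable_funTS; exact/measurable_EFinP.
  - by move=> x /ltW; rewrite lee_fin.
apply: ge0_subset_integral => //; first exact/measurable_EFinP.
by move=> x _; rewrite lee_fin.
Qed.

Section finite_partition.
Context {d} {T : measurableType d} {I : finType} (F : I -> set T).
Hypotheses (mF : forall i, measurable (F i)) (covF : forall x, exists i, F i x).

Lemma measurable_fin_bigcup (J : pred I) (E : I -> set T) : (forall i, measurable (E i)) ->
  measurable [set x | exists2 i, J i & E i x].
Proof.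
move=> mE; rewrite (_ : [set x | _] = \big[setU/set0]_(i | J i) E i).
  by apply: bigsetU_measurable => i _.
apply/seteqP; split => x /=.
  by move=> [i Ji Ei]; rewrite (bigD1 i)//=; left.
elim/big_ind: _ => // [A B HA HB [/HA|/HB]|i Ji Ei] //.
by exists i.
Qed.

Lemma measurable_forall (E : I -> set T) : (forall i, measurable (E i)) ->
  measurable [set x | forall i, E i x].
Proof.
move=> mE; rewrite (_ : [set x | _] = ~` [set x | exists2 i, xpredT i & (~` E i) x]).
  by apply: measurableC; apply: measurable_fin_bigcup => i; exact: measurableC.
apply/seteqP; split => x /=; first by move=> H [i _]; exact.
by move=> H i; apply: contrapT => nE; apply: H; exists i.
Qed.

Lemma measurable_fun_piecewise {d'} {T' : measurableType d'} (h : T -> T') (g : I -> T -> T') :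
  (forall i, measurable_fun setT (g i)) -> (forall i x, F i x -> h x = g i x) ->
  measurable_fun setT h.
Proof.
move=> mg hg _ B mB; rewrite setTI.
rewrite (_ : h @^-1` B = [set x | exists2 i, xpredT i & (F i `&` g i @^-1` B) x]).
  by apply: measurable_fin_bigcup => i; apply: measurableI => //; exact: measurable_preimageT.
apply/seteqP; split => x /=.
  by move=> Bh; have [i Fi] := covF x; exists i => //; split => //=; rewrite -hg.
by move=> [i _ [Fi]] /=; rewrite -hg.
Qed.

Context {R : realType} (P : probability T R).
Hypothesis disF : forall i j x, F i x -> F j x -> i = j.

Lemma partition_bound (J : pred I) (E : I -> set T) (a : I -> R) (e : R) :
  0 <= e -> (forall i, measurable (E i)) ->
  (forall i, J i -> P (F i `&` E i) = (P (F i) * (a i)%:E)%E) ->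
  (forall i, J i -> a i <= e) ->
  (P [set x | exists2 i, J i & (F i `&` E i) x] <= e%:E)%E.
Proof.
move=> e0 mE PE ae.
have sumI (A : I -> set T) : (forall i, measurable (A i)) -> (forall i, A i `<=` F i) ->
    P (\big[setU/set0]_(i <- index_enum I) A i) = (\sum_i P (A i))%E.
  move=> mA AF.
  have tA : trivIset [set` index_enum I] A.
    apply/trivIsetP => i j _ _ ij; apply/seteqP; split => z //= -[/AF Fi /AF Fj].
    by move: ij; rewrite (disF Fi Fj) eqxx.
  have := @ge0_integral_bigsetU _ _ R P I A (fun=> 1%:E) (index_enum I) mA
    (index_enum_uniq _) tA (measurable_cst _) (fun _ _ => lee01).
  rewrite integral_cst ?mul1e => [->|]; last by apply: bigsetU_measurable => i _.
  by apply: eq_bigr => i _; rewrite integral_cst ?mul1e.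
pose A i := if J i then F i `&` E i else set0.
have mA i : measurable (A i) by rewrite /A; case: ifP => // _; exact: measurableI.
have AF i : A i `<=` F i by rewrite /A; case: ifP => // _ x [].
have -> : [set x | exists2 i, J i & (F i `&` E i) x] =
    \big[setU/set0]_(i <- index_enum I) A i.
  apply/seteqP; split => x /=.
    by move=> [i Ji Ei]; rewrite (bigD1 i)//=; left; rewrite /A Ji.
  elim/big_ind: _ => // [B C HB HC [/HB|/HC]|i _] //.
  by rewrite /A; case: ifP => // Ji FE; exists i.
rewrite sumI//.
apply: (@le_trans _ _ (\sum_i (P (F i) * e%:E))%E).
  apply: lee_sum => i _; rewrite /A; case: ifPn => Ji.
    by rewrite PE//; apply: lee_wpmul2l => //; rewrite lee_fin ae.
  by rewrite measure0 mule_ge0.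
rewrite -ge0_sume_distrl//.
have /= <- := sumI F mF (fun i => @subset_refl _ (F i)).
apply: (@le_trans _ _ (1 * e%:E)%E); last by rewrite mul1e.
apply: lee_wpmul2r; first by rewrite lee_fin.
by apply: probability_le1; apply: bigsetU_measurable => i _.
Qed.

End finite_partition.

Lemma tuple_measure_unique {R : realType} {d} {T : measurableType d} (n : nat)
    (m1 m2 : {measure set (n.-tuple T) -> \bar R}) :
  (m1 setT < +oo)%E ->
  (forall A : 'I_n -> set T, (forall j, measurable (A j)) ->
     m1 [set s | forall j, A j (tnth s j)] = m2 [set s | forall j, A j (tnth s j)]) ->
  forall B, measurable B -> m1 B = m2 B.
Proof.
move=> m1T m12.
pose G := [set B : set (n.-tuple T) | exists2 A : 'I_n -> set T, (forall j, measurable (A j)) &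
  B = [set s | forall j, A j (tnth s j)]].
have mG B : G B -> measurable B.
  move=> [A mA ->]; rewrite (_ : [set s | _] = \big[setI/setT]_(j < n) ((@tnth n T ^~ j) @^-1` A j)).
    apply: bigsetI_measurable => j _; apply: measurable_preimageT => //.
    exact: measurable_tnth.
  apply/seteqP; split => s /=.
    by move=> As; apply: (big_ind (fun D : set (n.-tuple T) => D s)) => [//|C C' ? ?|i _ /=];
      [split|exact: As].
  by move=> + j; rewrite (bigD1 j)//= => -[].
apply: (@measure_unique _ R _ G (fun=> setT)) => //.
- apply/seteqP; split => B.
    apply: smallest_sub; first exact: smallest_sigma_algebra.
    move=> C; rewrite -bigcup_seq/= => -[j _ [A mA <-]]; rewrite setTI.
    apply: sub_sigma_algebra; exists (fun i => if i == j then A else setT).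
      by move=> i; case: ifP.
    apply/seteqP; split => s /=; first by move=> As i; case: eqP => // ->.
    by move=> /(_ j); rewrite eqxx.
  by apply: smallest_sub; [exact: sigma_algebra_measurable|exact: mG].
- move=> B C [A mA ->] [A' mA' ->]; exists (fun j => A j `&` A' j).
    by move=> j; exact: measurableI.
  apply/seteqP; split => s /=; first by move=> [H H'] j; split.
  by move=> H; split=> j; have [] := H j.
- by move=> _; exists (fun=> setT) => //; apply/seteqP; split.
- by rewrite bigcup_const//; exists 0%N.
- by move=> B [A mA ->]; exact: m12.
Qed.

Section iid_moments.
Context {R : realType} {d d'} {T : measurableType d} {T' : measurableType d'}
  (P : probability T R) (Z : T -> T') (Z_ : nat -> T -> T').
Hypotheses (mZ : measurable_fun setT Z) (hZ : independent_copies P Z Z_).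

Let mZ_ j : measurable_fun setT (Z_ j). Proof. by case: hZ. Qed.

Lemma copies_pairwise_indep (i j : nat) (A B : set T') : i != j ->
  measurable A -> measurable B ->
  P (Z_ i @^-1` A `&` Z_ j @^-1` B) = (P (Z_ i @^-1` A) * P (Z_ j @^-1` B))%E.
Proof.
move=> ij mA mB; have [_ _ ind] := hZ.
pose n := (maxn i j).+1.
have ni : (i < n)%N by rewrite ltnS leq_maxl.
have nj : (j < n)%N by rewrite ltnS leq_maxr.
pose C (k : 'I_n) := if k == i :> nat then A else if k == j :> nat then B else setT.
have mC k : measurable (C k) by rewrite /C; do 2 case: ifP => //.
have := ind n C mC.
have -> : [set w | forall k : 'I_n, C k (Z_ k w)] = Z_ i @^-1` A `&` Z_ j @^-1` B.
  apply/seteqP; split => w /=.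
    move=> H; split; first by have := H (Ordinal ni); rewrite /C/= eqxx.
    by have := H (Ordinal nj); rewrite /C/= eqxx eq_sym (negPf ij).
  by move=> [Ai Bj] k; rewrite /C; case: eqP => [->//|_]; case: eqP => [->//|].
move=> ->; rewrite (bigD1 (Ordinal ni))//= (bigD1 (Ordinal nj))/=; last first.
  by rewrite -val_eqE/= eq_sym.
rewrite big1 ?mule1; last first.
  move=> k /andP[ki kj]; rewrite /C; move: ki kj; rewrite -!val_eqE/= => /negPf -> /negPf ->.
  by rewrite preimage_setT probability_setT.
by rewrite /C/= eqxx eqxx eq_sym (negPf ij).
Qed.

Variable k : T' -> R.
Hypotheses (mk : measurable_fun setT k) (k2 : P.-integrable setT (fun x => (k (Z x) ^+ 2)%:E)).

Let mkZ : measurable_fun setT (k \o Z). Proof. exact: measurableT_comp. Qed.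

Let same_law j B : measurable B -> P (Z @^-1` B) = P (Z_ j @^-1` B).
Proof. by move=> mB; have [_ H _] := hZ; rewrite H. Qed.

Let k1 : P.-integrable setT (fun x => (k (Z x))%:E).
Proof.
exact: (sqr_intg mkZ).
Qed.

Lemma copies_intg j : P.-integrable setT (fun x => (k (Z_ j x))%:E).
Proof. exact: (integrable_same_law mZ (mZ_ j) (same_law j) mk k1). Qed.

Lemma copies_intg_sqr j : P.-integrable setT (fun x => (k (Z_ j x) ^+ 2)%:E).
Proof.
exact: (integrable_same_law mZ (mZ_ j) (same_law j) (measurable_funX 2 mk) k2).
Qed.

Let kk i j : P.-integrable setT (fun x => (k (Z_ i x) * k (Z_ j x))%:E).
Proof.
by apply: intgM; [exact: measurableT_comp|exact: measurableT_comp|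
  exact: copies_intg_sqr|exact: copies_intg_sqr].
Qed.

Lemma copies_sum_sqr_intg (n : nat) :
  P.-integrable setT (fun x => ((\sum_(j < n) k (Z_ j x)) ^+ 2)%:E).
Proof.
under eq_fun do rewrite expr2 big_distrlr/=.
by apply: intg_sum => i; apply: intg_sum => j.
Qed.

Lemma copies_sum_sqr (n : nat) : \int[P]_x k (Z x) = 0 ->
  \int[P]_x ((\sum_(j < n) k (Z_ j x)) ^+ 2) = n%:R * \int[P]_x (k (Z x) ^+ 2).
Proof.
move=> k0; under eq_Rintegral do rewrite expr2 big_distrlr/=.
rewrite Rintegral_sum; last by move=> i; exact: intg_sum.
rewrite (eq_bigr (fun=> \int[P]_x (k (Z x) ^+ 2))).
  by rewrite sumr_const card_ord mulr_natl.
move=> i _; rewrite Rintegral_sum// (bigD1 i)//= big1 ?addr0.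
  have := Rintegral_same_law mZ (mZ_ i) (same_law i) (measurable_funX 2 mk).
  by move=> ->; apply: eq_Rintegral => x _; rewrite expr2.
move=> j ji; rewrite (@indep_RintegralM _ _ _ _ _ _ _ P (Z_ i) (Z_ j))//.
- have <- := Rintegral_same_law mZ (mZ_ i) (same_law i) mk.
  by rewrite k0 mul0r.
- by move=> A B mA mB; apply: copies_pairwise_indep => //; rewrite eq_sym.
- exact: copies_intg.
- exact: copies_intg.
Qed.

End iid_moments.

Section conditioning.
Context {R : realType} {d d'} {T : measurableType d} {T' : measurableType d'}
  (P : probability T R).

Definition conditional_probability (E : set T) (mE : measurable E) : probability T R :=
  mnormalize (mrestr P mE) P.

Lemma conditional_probabilityE (E : set T) (mE : measurable E) (A : set T) :
  P E != 0%E -> conditional_probability mE A = (P (A `&` E) * (fine (P E))^-1%:E)%E.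
Proof.
move=> PE; rewrite /conditional_probability/= /mnormalize/= /mrestr setTI (negPf PE)/=.
rewrite ifN//; apply/eqP => H.
by have := probability_le1 P mE; rewrite H.
Qed.

Definition law_of (Q : probability T R) (f : T -> T') (mf : measurable_fun setT f) :
    probability T' R := distribution Q (mfun_Sub (mem_set mf)).

Lemma law_ofE (Q : probability T R) (f : T -> T') (mf : measurable_fun setT f) B :
  law_of Q mf B = Q (f @^-1` B).
Proof. by []. Qed.

End conditioning.

Section complete_case_law.
Context {R : realType} {d dS} {Omega : measurableType d} {S : measurableType dS}.
Variables (P : probability Omega R) (D : Omega -> S) (delta : Omega -> bool).
Variables (D_ : nat -> Omega -> S) (delta_ : nat -> Omega -> bool).
Hypothesis (mD : measurable_fun setT D) (mdelta : measurable_fun setT delta).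
Hypothesis copies :
  independent_copies P (fun w => (D w, delta w)) (fun j w => (D_ j w, delta_ j w)).
Hypothesis delta_gt0 : P [set w | delta w] != 0%E.

Local Notation pr A := (fine (P A)).

Let prE A : measurable A -> P A = (pr A)%:E.
Proof. by move=> mA; rewrite fineK// fin_num_measure. Qed.

Let mZ : measurable_fun setT (fun w => (D w, delta w)).
Proof. exact: measurable_fun_pair. Qed.

Let mZ_ j : measurable_fun setT (fun w => (D_ j w, delta_ j w)).
Proof. by case: copies. Qed.

Lemma copies_measurable_data j : measurable_fun setT (D_ j).
Proof. exact: (measurableT_comp measurable_fst (mZ_ j)). Qed.

Lemma copies_measurable_indicator j : measurable_fun setT (delta_ j).
Proof. exact: (measurableT_comp measurable_snd (mZ_ j)). Qed.

Let mbool (b : bool) (f : Omega -> bool) : measurable_fun setT f ->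
  measurable [set w | f w = b].
Proof. by move=> mf; apply: (measurable_preimageT (B := [set b]) mf). Qed.

Let indep_pr n (C : 'I_n -> set (S * bool)) : (forall j, measurable (C j)) ->
  pr [set w | forall j, C j (D_ j w, delta_ j w)] =
  \prod_(j < n) pr [set w | C j (D w, delta w)].
Proof.
move=> mC; have [_ same ind] := copies; rewrite (ind n C mC).
have -> : (\prod_(j < n) P ((fun w => (D_ j w, delta_ j w)) @^-1` C j))%E =
    (\prod_(j < n) (pr [set w | C j (D w, delta w)])%:E)%E.
  apply: eq_bigr => j _; rewrite same// -prE//; exact: measurable_preimageT.
by rewrite prodEFin.
Qed.

Let pd : pr [set w | delta w] != 0.
Proof.
have mdl : measurable [set w | delta w] by exact: mbool.
by move: delta_gt0; rewrite prE// eqe.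
Qed.

Section pattern.
Variables (n k : nat) (i_ : 'I_k -> 'I_n).
Hypothesis i_inj : injective i_.

Definition pattern : set Omega :=
  [set w | forall l : 'I_n, delta_ l w = (l \in i_ @: 'I_k)].

Definition selected (w : Omega) : k.-tuple S := [tuple D_ (i_ j) w | j < k].

Lemma pattern_measurable : measurable pattern.
Proof. by apply: measurable_forall => l; apply: mbool; exact: copies_measurable_indicator. Qed.

Lemma selected_measurable : measurable_fun setT selected.
Proof.
apply/measurable_fun_tnthP => j.
rewrite (_ : _ \o _ = D_ (i_ j)); first exact: copies_measurable_data.
by apply/funext => w /=; rewrite tnth_mktuple.
Qed.

Let pattern_rect (A : 'I_k -> set S) : (forall j, measurable (A j)) ->
  pr ([set w | forall j, A j (D_ (i_ j) w)] `&` pattern) =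
  \prod_(j < k) pr [set w | A j (D w) /\ delta w] *
  \prod_(l < n | l \notin i_ @: 'I_k) pr [set w | delta w = false].
Proof.
move=> mA.
pose AC (l : 'I_n) := if [pick j | i_ j == l] is Some j then A j else setT.
have ACE j : AC (i_ j) = A j.
  rewrite /AC; case: pickP => [j' /eqP/i_inj -> //|/(_ j)]; by rewrite eqxx.
have ACn l : l \notin i_ @: 'I_k -> AC l = setT.
  rewrite /AC; case: pickP => // j /eqP <-; by rewrite imset_f.
pose C l := AC l `*` [set (l \in i_ @: 'I_k)].
have mC l : measurable (C l).
  by apply: measurableX => //; rewrite /AC; case: pickP.
have -> : [set w | forall j, A j (D_ (i_ j) w)] `&` pattern =
    [set w | forall l, C l (D_ l w, delta_ l w)].
  apply/seteqP; split => w /=.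
    move=> [Aw pw] l; split; last exact: pw.
    have [/imsetP[j _ ->]|lN] := boolP (l \in i_ @: 'I_k); last by rewrite /= ACn.
    by rewrite /= ACE.
  move=> H; split => [j|l]; last by have [] := H l.
  by have [] := H (i_ j); rewrite /= ACE.
rewrite indep_pr// (bigID (mem (i_ @: 'I_k)))/= big_imset/=; last by move=> x y _ _; exact: i_inj.
congr (_ * _).
  by apply: eq_bigr => j _; congr (fine (P _)); rewrite /C ACE imset_f.
apply: eq_bigr => l lN; congr (fine (P _)); rewrite /C ACn// (negPf lN).
by apply/seteqP; split => w //= [].
Qed.

Lemma pattern_pr : pr pattern = \prod_(j < k) pr [set w | delta w] *
  \prod_(l < n | l \notin i_ @: 'I_k) pr [set w | delta w = false].
Proof.
have := @pattern_rect (fun=> setT) (fun=> measurableT).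
rewrite (_ : [set w | _] = setT) ?setTI; last by apply/seteqP; split.
move=> ->; congr (_ * _); apply: eq_bigr => j _; congr (fine (P _)).
by apply/seteqP; split => w //= [].
Qed.

Lemma selected_law_rect (A : 'I_k -> set S) : (forall j, measurable (A j)) ->
  P pattern != 0%E ->
  law_of (conditional_probability P pattern_measurable) selected_measurable
    [set s | forall j, A j (tnth s j)] =
  (\prod_(j < k) (pr [set w | A j (D w) /\ delta w] / pr [set w | delta w]))%:E.
Proof.
move=> mA Pp; rewrite law_ofE conditional_probabilityE//.
have -> : selected @^-1` [set s | forall j, A j (tnth s j)] =
    [set w | forall j, A j (D_ (i_ j) w)].
  by apply/seteqP; split => w /= H j; have := H j; rewrite tnth_mktuple.
rewrite prE; last first.
  apply: measurableI; last exact: pattern_measurable.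
  by apply: measurable_forall => j; apply: (measurable_preimageT (copies_measurable_data _)).
rewrite -EFinM pattern_rect// pattern_pr; congr EFin.
have : pr pattern != 0 by move: Pp; rewrite prE ?eqe//; exact: pattern_measurable.
rewrite pattern_pr mulf_eq0 negb_or => /andP[p0 r0].
by rewrite -mulf_div mulfV// mulr1 prodf_div.
Qed.

End pattern.

(* The law of the data given that the first [n] indicators are all 1; by [pattern_law] it
   is also the law of the complete cases given any pattern with [n] ones. *)
Definition complete_sample n : probability (n.-tuple S) R :=
  law_of (conditional_probability P (pattern_measurable (@id 'I_n)))
    (selected_measurable (@id 'I_n)).

Let id_pattern n : P (pattern (@id 'I_n)) != 0%E.
Proof.
have mp := pattern_measurable (@id 'I_n).
rewrite prE// eqe pattern_pr; last by [].
apply: mulf_neq0.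
  by apply/prodf_neq0 => j _; exact: pd.
by apply/prodf_neq0 => l; rewrite imset_f.
Qed.

Lemma complete_sample_rect n (A : 'I_n -> set S) : (forall j, measurable (A j)) ->
  complete_sample n [set s | forall j, A j (tnth s j)] =
  (\prod_(j < n) (pr [set w | A j (D w) /\ delta w] / pr [set w | delta w]))%:E.
Proof. by move=> mA; rewrite selected_law_rect. Qed.

Lemma complete_sample_marginal n (j : 'I_n) (A : set S) : measurable A ->
  complete_sample n [set s | A (tnth s j)] =
  (pr [set w | A (D w) /\ delta w] / pr [set w | delta w])%:E.
Proof.
move=> mA; pose C i := if i == j then A else setT.
have := @complete_sample_rect n C.
have -> : [set s : n.-tuple S | forall i, C i (tnth s i)] = [set s | A (tnth s j)].
  apply/seteqP; split => s /=; first by move=> /(_ j); rewrite /C eqxx.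
  by move=> As i; rewrite /C; case: eqP => // ->.
move=> ->; last by move=> i; rewrite /C; case: eqP.
congr EFin; rewrite (bigD1 j)//= /C eqxx big1 ?mulr1// => i /negPf ->.
rewrite (_ : [set w | _] = [set w | delta w]) ?divff//.
by apply/seteqP; split => w //= [].
Qed.

Lemma complete_sample_independent n : mutually_independent (complete_sample n)
  (fun (j : 'I_n) (s : n.-tuple S) => tnth s j).
Proof.
move=> A mA; rewrite complete_sample_rect// -prodEFin; apply: eq_bigr => j _.
by apply/esym; exact: complete_sample_marginal.
Qed.

Lemma pattern_law n k (i_ : 'I_k -> 'I_n) (B : set (k.-tuple S)) : injective i_ ->
  measurable B ->
  P (pattern i_ `&` selected i_ @^-1` B) = (P (pattern i_) * complete_sample k B)%E.
Proof.
move=> i_inj mB; pose mp := pattern_measurable i_.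
have msB : measurable (selected i_ @^-1` B).
  by apply: measurable_preimageT => //; exact: selected_measurable.
have [p0|p0] := eqVneq (P (pattern i_)) 0%E.
  rewrite p0 mul0e; apply/eqP; rewrite eq_le measure_ge0 andbT -p0.
  by apply: le_measure; rewrite ?inE//; exact: measurableI.
have -> : complete_sample k B =
    law_of (conditional_probability P mp) (selected_measurable i_) B.
  apply: (@tuple_measure_unique R _ S k) => //.
    by apply: (le_lt_trans (probability_le1 (complete_sample k) measurableT)); rewrite ltry.
  by move=> A mA; exact: etrans (complete_sample_rect mA) (esym (selected_law_rect i_inj mA p0)).
rewrite law_ofE conditional_probabilityE// [P (pattern i_)]prE// setIC.
rewrite muleCA -EFinM mulfV ?mule1//.
by move: p0; rewrite prE// eqe.
Qed.

End complete_case_law.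

(** * The partially linear model with missing responses *)

Lemma dotvE {R : realType} (m : nat) (a : 'cV[R]_m) (u : m.-tuple R) :
  dotv a u = \sum_i a i 0 * tnth u i.
Proof. by rewrite /dotv mxE; apply: eq_bigr => i _; rewrite !mxE. Qed.

Lemma positive_definite_unitmx {R : realType} (m : nat) (A : 'M[R]_m) :
  positive_definite A -> A \in unitmx.
Proof.
move=> [_ A0]; rewrite -row_free_unit -kermx_eq0; apply/negPn/negP => kA.
move/rowV0Pn: kA => [v /sub_kermxP vA v0].
have : v^T != 0 by apply: contra v0 => /eqP v0; rewrite -[v]trmxK v0 trmx0.
by move=> /A0; rewrite trmxK vA mul0mx mxE ltxx.
Qed.

Section model.
Context {R : realType} {m : nat}.
Local Notation X := (m.-tuple R * R)%type.

Section measurability.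
Variables (theta : 'cV[R]_m) (rho : R -> R).
Hypothesis hrho : twice_continuously_differentiable rho.

Lemma regression_measurable : measurable_fun setT rho.
Proof.
have [rho1 [rho2 [drho _ _]]] := hrho.
apply: continuous_measurable_fun => x.
by apply: differentiable_continuous; apply/derivable1_diffP; exact: ex_derive.
Qed.

Lemma dotv_measurable (a : 'cV[R]_m) : measurable_fun setT (fun x : X => dotv a x.1).
Proof.
under eq_fun do rewrite dotvE.
apply: measurable_sum => i; apply: measurable_funM => //.
exact: (measurableT_comp (measurable_tnth i) measurable_fst).
Qed.

Lemma residual_measurable :
  measurable_fun setT (fun z : X * R => residual theta rho z.1 z.2).
Proof.
apply: measurable_funB; last first.
  exact: (measurableT_comp regression_measurable (measurableT_comp measurable_snd measurable_fst)).
apply: measurable_funB => //.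
exact: (measurableT_comp (dotv_measurable theta) measurable_fst).
Qed.

End measurability.

Section covariate_moments.
Variable Q : probability X R.
Hypothesis Q2 : (\int[Q]_x (\sum_(i < m) (tnth x.1 i) ^+ 2)%:E < +oo)%E.

Lemma coordinate_measurable (i : 'I_m) : measurable_fun setT (fun x : X => tnth x.1 i).
Proof. exact: (measurableT_comp (measurable_tnth i) measurable_fst). Qed.

Lemma coordinate_sqr_intg (i : 'I_m) : Q.-integrable setT (fun x : X => (tnth x.1 i ^+ 2)%:E).
Proof.
have mS : measurable_fun setT (fun x : X => \sum_(i < m) (tnth x.1 i) ^+ 2).
  by apply: measurable_sum => j; apply: measurable_funX; exact: coordinate_measurable.
have S0 (x : X) : 0 <= \sum_(i < m) (tnth x.1 i) ^+ 2.
  by apply: sumr_ge0 => j _; exact: sqr_ge0.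
apply: (intg_le _ (ge0_intg mS S0 Q2)).
  by apply: measurable_funX; exact: coordinate_measurable.
move=> x; rewrite ger0_norm ?sqr_ge0// (bigD1 i)//= lerDl.
by apply: sumr_ge0 => j _; exact: sqr_ge0.
Qed.

Let coordinate_intg i : Q.-integrable setT (fun x : X => (tnth x.1 i)%:E).
Proof. by apply: sqr_intg; [exact: coordinate_measurable|exact: coordinate_sqr_intg]. Qed.

Lemma mu_cond_expectation (i : 'I_m) :
  is_cond_expectation Q (fun x : X => tnth x.1 i) snd (fun v => mu_ Q v i 0).
Proof.
have [h hh] := cond_expectation_exists measurable_snd (coordinate_intg i).
rewrite (_ : (fun v => mu_ Q v i 0) = get [set h : R -> R |
     is_cond_expectation Q (fun x : X => tnth x.1 i) snd h]); last first.
  by apply/funext => v; rewrite mxE.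
exact: (getI hh).
Qed.

Definition centered (i : 'I_m) (x : X) : R := tnth x.1 i - mu_ Q x.2 i 0.

Lemma mu_measurable i : measurable_fun setT (fun v => mu_ Q v i 0).
Proof. by case: (mu_cond_expectation i). Qed.

Lemma centered_measurable i : measurable_fun setT (centered i).
Proof.
apply: measurable_funB; first exact: coordinate_measurable.
exact: (measurableT_comp (mu_measurable i) measurable_snd).
Qed.

Lemma mu_sqr_intg i : Q.-integrable setT (fun x : X => (mu_ Q x.2 i 0 ^+ 2)%:E).
Proof.
exact: (cond_expectation_sqr_integrable measurable_snd (coordinate_intg i)
  (mu_cond_expectation i) (coordinate_sqr_intg i)).
Qed.

Lemma centered_sqr_intg i : Q.-integrable setT (fun x : X => (centered i x ^+ 2)%:E).
Proof.
apply: intg_sqrD.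
- exact: coordinate_measurable.
- by apply: measurableT_comp => //; exact: (measurableT_comp (mu_measurable i) measurable_snd).
- exact: coordinate_sqr_intg.
- by under eq_fun do rewrite sqrrN; exact: mu_sqr_intg.
Qed.

Lemma centered_orthogonal i (b : R -> R) : measurable_fun setT b ->
  Q.-integrable setT (fun x : X => (b x.2 ^+ 2)%:E) ->
  \int[Q]_x (centered i x * b x.2) = 0.
Proof.
move=> mb b2.
rewrite -(cond_expectation_orthogonal measurable_snd (coordinate_intg i)
  (mu_cond_expectation i) (coordinate_sqr_intg i) mb b2).
by apply: eq_Rintegral => x _; rewrite mulrC.
Qed.

Lemma centered_mean i : \int[Q]_x centered i x = 0.
Proof.
have := @centered_orthogonal i (cst 1) (measurable_cst _).
under eq_Rintegral do rewrite mulr1; apply.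
by under eq_fun do rewrite expr1n; exact: intg_cst.
Qed.

Lemma W_E i j : W_ Q i j = \int[Q]_x (centered i x * centered j x).
Proof.
by rewrite mxE; apply: eq_Rintegral => x _; rewrite mxE big_ord1 /centered !mxE.
Qed.

Lemma centered_coordinate i j : \int[Q]_x (centered i x * tnth x.1 j) = W_ Q i j.
Proof.
have mc := centered_measurable i; have c2 := centered_sqr_intg i.
have mmu : measurable_fun setT (fun x : X => mu_ Q x.2 j 0).
  exact: (measurableT_comp (mu_measurable j) measurable_snd).
have := RintegralD measurableT (intgM mc (centered_measurable j) c2 (centered_sqr_intg j))
  (intgM mc mmu c2 (mu_sqr_intg j)).
rewrite (centered_orthogonal i (mu_measurable j) (mu_sqr_intg j)) addr0 -W_E => <-.
by apply: eq_Rintegral => x _; rewrite -mulrDr subrK.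
Qed.

Lemma W_form (a : 'cV[R]_m) :
  (a^T *m W_ Q *m a) 0 0 = \int[Q]_x ((\sum_i a i 0 * centered i x) ^+ 2).
Proof.
have cc i j : Q.-integrable setT (fun x => (a i 0 * centered i x * (a j 0 * centered j x))%:E).
  under eq_fun do rewrite mulrACA.
  by apply: intgZl; apply: intgM; [exact: centered_measurable|exact: centered_measurable|
    exact: centered_sqr_intg|exact: centered_sqr_intg].
under eq_Rintegral do rewrite expr2 big_distrlr/=.
rewrite Rintegral_sum; last by move=> i; exact: intg_sum.
rewrite -mulmxA mxE; apply: eq_bigr => i _; rewrite Rintegral_sum// !mxE big_distrr/=.
apply: eq_bigr => j _.
transitivity (a i 0 * a j 0 * \int[Q]_x (centered i x * centered j x)).
  by rewrite W_E; ring.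
rewrite -RintegralZl//; last first.
  by apply: intgM; [exact: centered_measurable|exact: centered_measurable|
    exact: centered_sqr_intg|exact: centered_sqr_intg].
by apply: eq_Rintegral => x _; rewrite mulrACA.
Qed.

Lemma W_sym : (W_ Q)^T = W_ Q.
Proof.
apply/matrixP => i j; rewrite mxE !W_E.
by apply: eq_Rintegral => x _; rewrite mulrC.
Qed.

Lemma W_form_le (a : 'cV[R]_m) (b : R -> R) : measurable_fun setT b ->
  Q.-integrable setT (fun x : X => (b x.2 ^+ 2)%:E) ->
  (a^T *m W_ Q *m a) 0 0 <= \int[Q]_x ((dotv a x.1 - b x.2) ^+ 2).
Proof.
move=> mb b2; rewrite W_form.
pose C (x : X) := \sum_i a i 0 * centered i x.
pose e v := \sum_i a i 0 * mu_ Q v i 0 - b v.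
have mC : measurable_fun setT C.
  by apply: measurable_sum => i; apply: measurable_funM => //; exact: centered_measurable.
have C2 : Q.-integrable setT (fun x => (C x ^+ 2)%:E).
  apply: intg_sqr_sum => i; last exact/intg_sqrZ/centered_sqr_intg.
  by apply: measurable_funM => //; exact: centered_measurable.
have mmu : measurable_fun setT (fun v => \sum_i a i 0 * mu_ Q v i 0).
  by apply: measurable_sum => i; apply: measurable_funM => //; exact: mu_measurable.
have me : measurable_fun setT e by exact: measurable_funB.
have e2 : Q.-integrable setT (fun x : X => (e x.2 ^+ 2)%:E).
  apply: intg_sqrD.
  - exact: (measurableT_comp mmu measurable_snd).
  - by apply: measurableT_comp => //; exact: (measurableT_comp mb measurable_snd).
  - apply: intg_sqr_sum => i; last exact/intg_sqrZ/mu_sqr_intg.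
    apply: measurable_funM => //.
    exact: (measurableT_comp (mu_measurable i) measurable_snd).
  - by under eq_fun do rewrite sqrrN.
have meS : measurable_fun setT (fun x : X => e x.2) := measurableT_comp me measurable_snd.
have Ce : \int[Q]_x (C x * e x.2) = 0.
  under eq_Rintegral do rewrite mulr_suml.
  rewrite Rintegral_sum; last first.
    move=> i; under eq_fun do rewrite -mulrA.
    by apply/intgZl/intgM => //; [exact: centered_measurable|exact: centered_sqr_intg].
  apply: big1 => i _; under eq_Rintegral do rewrite -mulrA.
  rewrite RintegralZl//; last first.
    by apply: intgM => //; [exact: centered_measurable|exact: centered_sqr_intg].
  by rewrite centered_orthogonal// mulr0.
have iCe := intgM mC meS C2 e2.
have -> : \int[Q]_x ((dotv a x.1 - b x.2) ^+ 2) =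
    \int[Q]_x (C x ^+ 2) + (2 * \int[Q]_x (C x * e x.2) + \int[Q]_x (e x.2 ^+ 2)).
  rewrite -(RintegralZl 2 measurableT iCe) -(RintegralD measurableT (intgZl 2 iCe) e2).
  rewrite -(RintegralD measurableT C2 (intgD (intgZl 2 iCe) e2)).
  apply: eq_Rintegral => x _; have -> : dotv a x.1 - b x.2 = C x + e x.2; last by ring.
  rewrite dotvE /C /e addrA -big_split/=; congr (_ - _); apply: eq_bigr => i _.
  by rewrite -mulrDr subrK.
rewrite Ce mulr0 add0r lerDl; apply: Rintegral_ge0 => x _; exact: sqr_ge0.
Qed.

End covariate_moments.
End model.

Lemma sqr_Rintegral_eq0 {R : realType} {d} {T : measurableType d}
    (mu : {measure set T -> \bar R}) (f : T -> R) :
  mu.-integrable setT (fun x => (f x ^+ 2)%:E) -> \int[mu]_x (f x ^+ 2) = 0 ->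
  {ae mu, forall x, f x = 0}.
Proof.
move=> f2 E; have H : ae_eq mu setT (fun x => (f x ^+ 2)%:E) (cst 0%E).
  apply/(ae_eq_integral_abs mu measurableT); first by case/integrableP : f2.
  transitivity (\int[mu]_x (f x ^+ 2)%:E)%E.
    by apply: eq_integral => x _; rewrite gee0_abs// lee_fin sqr_ge0.
  by rewrite EFin_Rintegral// E.
apply: (@filterS _ _ (ae_filter_ringOfSetsType mu) _ _ _ H) => x /(_ I) /= [] /eqP.
by rewrite expf_eq0/= => /eqP.
Qed.

Section mar_model.
Context {R : realType} {m : nat}.
Local Notation X := (m.-tuple R * R)%type.
Variables (theta : 'cV[R]_m) (rho f f' : R -> R) (pi : X -> R) (G Gt : probability X R).
Context {d : measure_display} {Omega : measurableType d}.
Variables (P : probability Omega R) (U : Omega -> m.-tuple R) (V Y : Omega -> R)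
  (delta : Omega -> bool).
Hypotheses (hrho : twice_continuously_differentiable rho) (hf : error_density f f')
  (hG1 : G1 G) (hG2 : G2 G) (hpi : propensity_assumptions pi)
  (hY : partially_linear P U V Y theta rho f G)
  (hdelta : missing_at_random P U V Y delta pi) (hGt : conditional_law P U V delta Gt).

Local Notation lam := (@lebesgue_measure R).
Local Notation Xw w := (U w, V w).
Local Notation eps w := (residual theta rho (U w, V w) (Y w)).
Local Notation dl w := ((delta w)%:R : R).

Lemma propensity_measurable : measurable_fun setT pi. Proof. by case: hpi. Qed.

Lemma propensity_ge0 x : 0 <= pi x.
Proof. by have [_ /(_ x)/andP[]] := hpi. Qed.

Lemma propensity_le1 x : pi x <= 1.
Proof. by have [_ /(_ x)/andP[]] := hpi. Qed.

Lemma covariate_measurable : measurable_fun setT (fun w => Xw w).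
Proof. by have [mU mV _ _] := hY; exact: measurable_fun_pair. Qed.

Lemma observation_measurable : measurable_fun setT (fun w => (Xw w, Y w)).
Proof.
by have [_ _ mY _] := hY; apply: measurable_fun_pair => //; exact: covariate_measurable.
Qed.

Lemma error_measurable : measurable_fun setT (fun w => eps w).
Proof.
exact: (measurableT_comp (residual_measurable theta hrho) observation_measurable).
Qed.

Lemma indicator_measurable : measurable_fun setT (fun w => dl w).
Proof.
have [md _ _] := hdelta.
rewrite (_ : (fun w => dl w) = (fun w => if delta w then 1 else 0)).
  exact: measurable_fun_ifT.
by apply/funext => w; case: (delta w).
Qed.

Lemma error_density_total : (\int[lam]_y (f y)%:E = 1)%E.
Proof. by have [[_ _ ->]] := hf. Qed.

Lemma covariate_law B : measurable B -> P ((fun w => Xw w) @^-1` B) = G B.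
Proof.
move=> mB; have [_ _ _ H] := hY; have := H B setT mB measurableT.
rewrite error_density_total mule1 => <-; congr (P _).
by apply/seteqP; split => w //= [].
Qed.

Lemma error_law B : measurable B -> P ((fun w => eps w) @^-1` B) = (\int[lam]_(y in B) (f y)%:E)%E.
Proof.
move=> mB; have [_ _ _ H] := hY; have := H setT B measurableT mB.
rewrite probability_setT mul1e => <-; congr (P _).
by apply/seteqP; split => w //= [].
Qed.

Lemma covariate_error_indep A B : measurable A -> measurable B ->
  P ((fun w => Xw w) @^-1` A `&` (fun w => eps w) @^-1` B) =
  (P ((fun w => Xw w) @^-1` A) * P ((fun w => eps w) @^-1` B))%E.
Proof. by move=> mA mB; have [_ _ _ H] := hY; rewrite covariate_law// error_law// -H. Qed.

Lemma error_transfer B : measurable B ->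
  (\int[P]_(x in (fun w => eps w) @^-1` B) 1%:E = \int[lam]_(y in id @^-1` B) (f y)%:E)%E.
Proof.
move=> mB; rewrite preimage_id -error_law// integral_cst ?mul1e//.
by apply: measurable_preimageT => //; exact: error_measurable.
Qed.

Lemma error_intg (q : R -> R) : measurable_fun setT q ->
  lam.-integrable setT (fun y : R => (q y * f y)%:E) ->
  P.-integrable setT (fun w => (q (eps w))%:E).
Proof.
move=> mq iq.
have := integrable_transfer (m1 := lam) (m2 := P) (phi1 := id) (phi2 := fun w => eps w)
  (p1 := f) (p2 := cst 1) (@measurable_id _ _ _) error_measurable
  (error_density_measurable hf) (measurable_cst _)
  (error_density_ge0 hf) (fun=> ler01) (fun B mB => esym (error_transfer mB)) mq.
move=> H; apply: (eq_integrable measurableT _ _ _ (H _)) => [w _|].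
  by rewrite mul1r.
by under eq_fun do rewrite mulrC.
Qed.

Lemma error_Rintegral (q : R -> R) : measurable_fun setT q ->
  \int[P]_w q (eps w) = \int[lam]_y (q y * f y).
Proof.
move=> mq.
have := integral_transfer (m1 := lam) (m2 := P) (phi1 := id) (phi2 := fun w => eps w)
  (p1 := f) (p2 := cst 1) (@measurable_id _ _ _) error_measurable
  (error_density_measurable hf) (measurable_cst _)
  (error_density_ge0 hf) (fun=> ler01) (fun B mB => esym (error_transfer mB)) mq.
move=> H; rewrite /Rintegral; congr fine.
transitivity (\int[P]_x (cst 1 x * q (eps x))%:E)%E.
  by apply: eq_integral => w _; rewrite mul1r.
by rewrite -H; apply: eq_integral => y _; rewrite mulrC.
Qed.

Lemma covariate_intg (k : X -> R) : measurable_fun setT k ->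
  G.-integrable setT (fun x => (k x)%:E) -> P.-integrable setT (fun w => (k (Xw w))%:E).
Proof.
by apply: integrable_same_law => //; [exact: covariate_measurable|move=> B /covariate_law].
Qed.

Lemma covariate_Rintegral (k : X -> R) : measurable_fun setT k ->
  \int[P]_w k (Xw w) = \int[G]_x k x.
Proof.
by apply: (@Rintegral_same_law _ _ _ _ _ _ _ P G (fun w => Xw w) id) => //;
  [exact: covariate_measurable|exact: covariate_law].
Qed.

Let mar_transfer B : measurable B ->
  (\int[P]_(w in (fun w => (Xw w, Y w)) @^-1` B) (pi (Xw w))%:E =
   \int[P]_(w in (fun w => (Xw w, Y w)) @^-1` B) (dl w)%:E)%E.
Proof. by move=> mB; have [_ [_ _ H] _] := hdelta; rewrite H. Qed.

Let mpiX : measurable_fun setT (fun w => pi (Xw w)).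
Proof. exact: (measurableT_comp propensity_measurable covariate_measurable). Qed.

Let dl_ge0 w : 0 <= dl w. Proof. exact: ler0n. Qed.

Lemma mar_intg (k : X * R -> R) : measurable_fun setT k ->
  P.-integrable setT (fun w => (pi (Xw w) * k (Xw w, Y w))%:E) ->
  P.-integrable setT (fun w => (dl w * k (Xw w, Y w))%:E).
Proof.
by apply: (integrable_transfer observation_measurable observation_measurable
  mpiX indicator_measurable (fun w => propensity_ge0 _) dl_ge0 mar_transfer).
Qed.

Lemma mar_Rintegral (k : X * R -> R) : measurable_fun setT k ->
  \int[P]_w (dl w * k (Xw w, Y w)) = \int[P]_w (pi (Xw w) * k (Xw w, Y w)).
Proof.
move=> mk; rewrite /Rintegral; congr fine; apply/esym.
exact: (integral_transfer observation_measurable observation_measurable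
  mpiX indicator_measurable (fun w => propensity_ge0 _) dl_ge0 mar_transfer mk).
Qed.

Section split.
Variables (k : X -> R) (q : R -> R).
Hypotheses (mk : measurable_fun setT k) (mq : measurable_fun setT q).
Hypotheses (ik : G.-integrable setT (fun x => (pi x * k x)%:E))
  (iq : lam.-integrable setT (fun y : R => (q y * f y)%:E)).

Let mpk : measurable_fun setT (fun x => pi x * k x).
Proof. exact: measurable_funM propensity_measurable mk. Qed.

Let mkq : measurable_fun setT (fun z : X * R => k z.1 * q (residual theta rho z.1 z.2)).
Proof.
apply: measurable_funM; first exact: (measurableT_comp mk measurable_fst).
exact: (measurableT_comp mq (residual_measurable theta hrho)).
Qed.

Lemma complete_case_intg : P.-integrable setT (fun w => (dl w * (k (Xw w) * q (eps w)))%:E).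
Proof.
apply: (mar_intg mkq) => /=; under eq_fun do rewrite mulrA.
apply: (indep_integrableM covariate_measurable error_measurable covariate_error_indep mpk mq).
- exact: (covariate_intg mpk).
- exact: error_intg.
Qed.

Lemma complete_case_Rintegral :
  \int[P]_w (dl w * (k (Xw w) * q (eps w))) =
  \int[G]_x (pi x * k x) * \int[lam]_y (q y * f y).
Proof.
rewrite (mar_Rintegral mkq) /=; under eq_Rintegral do rewrite mulrA.
rewrite (indep_RintegralM covariate_measurable error_measurable covariate_error_indep mpk mq).
- by rewrite (covariate_Rintegral mpk) error_Rintegral.
- exact: (covariate_intg mpk).
- exact: error_intg.
Qed.

End split.

Notation p := (\int[P]_w (delta w)%:R).

Let intg1f : lam.-integrable setT (fun y : R => (cst 1 y * f y)%:E).
Proof. by under eq_fun do rewrite mul1r; exact: error_density_intg hf. Qed.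

Let int1f : \int[lam]_y (cst 1 y * f y) = 1.
Proof.
by under eq_Rintegral do rewrite mul1r; rewrite /Rintegral error_density_total.
Qed.

Lemma propensity_intg : G.-integrable setT (fun x => (pi x)%:E).
Proof.
apply: (intg_le propensity_measurable (intg_cst G 1)) => x.
by rewrite ger0_norm ?propensity_ge0// propensity_le1.
Qed.

Lemma response_rateE : p = \int[G]_x pi x.
Proof.
have m1 : measurable_fun setT (cst 1 : X -> R) by exact: measurable_cst.
have m1' : measurable_fun setT (cst 1 : R -> R) by exact: measurable_cst.
have := complete_case_Rintegral m1 m1' _ intg1f.
under eq_fun do rewrite mulr1.
rewrite int1f mulr1 => /(_ propensity_intg).
under eq_Rintegral do rewrite /= !mulr1.
by under [in RHS]eq_Rintegral do rewrite /= !mulr1.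
Qed.

Lemma response_rate_gt0 : 0 < p.
Proof.
have [_ _ [c c0 cpi]] := hpi; rewrite response_rateE.
apply: (lt_le_trans c0); have := le_Rintegral measurableT (intg_cst G c) propensity_intg.
rewrite Rintegral_cst// [X in fine X](_ : _ = 1%E); last exact: probability_setT.
by rewrite mulr1; apply => x _; exact: cpi.
Qed.

Lemma response_rate_prob : P [set w | delta w] = p%:E.
Proof.
have md : measurable [set w | delta w].
  by have [md _ _] := hdelta; apply: (measurable_preimageT (B := [set true]) md).
have -> : p = fine (P [set w | delta w]); last by rewrite fineK// fin_num_measure.
rewrite /Rintegral -[X in P X]setIT -integral_indic//; congr fine.
apply: eq_integral => w _; rewrite indicE; case: (boolP (delta w)) => dw.
  by rewrite mem_set.
by rewrite memNset//=; apply/negP.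
Qed.

Lemma complete_case_lawE A : measurable A ->
  Gt A = (\int[G]_(x in A) (pi x / p)%:E)%E.
Proof.
move=> mA; have p0 := response_rate_gt0; rewrite hGt// response_rate_prob/=.
have [md _ Hpi] := hdelta; have [_ _ /(_ A mA) HA] := Hpi.
have mXA : measurable ((fun w => Xw w) @^-1` A).
  by apply: measurable_preimageT => //; exact: covariate_measurable.
have mdl : measurable [set w | delta w].
  by apply: (measurable_preimageT (B := [set true]) md).
have -> : P [set w | A (Xw w) /\ delta w] = (\int[P]_(w in (fun w => Xw w) @^-1` A) (dl w)%:E)%E.
  rewrite (_ : [set w | _] = [set w | delta w] `&` (fun w => Xw w) @^-1` A); last first.
    by apply/seteqP; split => w [].
  rewrite -integral_indic//; apply: eq_integral => w _; rewrite indicE.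
  case: (boolP (delta w)) => dw; first by rewrite mem_set.
  by rewrite memNset//=; apply/negP.
rewrite HA.
have -> : (\int[P]_(w in (fun w => Xw w) @^-1` A) (pi (Xw w))%:E)%E =
    (\int[G]_(x in A) (pi x)%:E)%E.
  transitivity (\int[P]_w (pi (Xw w) * \1_A (Xw w))%:E)%E.
    rewrite integral_mkcond; apply: eq_integral => w _; rewrite patchE indicE.
    by have [wA|wA] := pselect (A (Xw w)); [rewrite !mem_set ?mulr1|rewrite !memNset ?mulr0].
  transitivity (\int[G]_x (pi x * \1_A x)%:E)%E.
    apply: (@ge0_integral_same_law _ _ _ _ _ _ _ P G (fun w => Xw w) id _ _ _
      (fun x => (pi x * \1_A x)%:E)) => //.
    - exact: covariate_measurable.
    - exact: covariate_law.
    - apply/measurable_EFinP; apply: measurable_funM; first exact: propensity_measurable.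
      exact: measurable_indic.
    - by move=> x; rewrite lee_fin mulr_ge0 ?propensity_ge0.
  rewrite [RHS]integral_mkcond; apply: eq_integral => x _.
  by rewrite patchE indicE; case: ifPn; rewrite ?mulr1 ?mulr0.
have ipA : G.-integrable A (fun x => (pi x)%:E) by exact: integrableS propensity_intg.
rewrite mulrC EFinM fineK; last exact: integrable_fin_num.
by rewrite -integralZl//; apply: eq_integral => x _; rewrite -EFinM mulrC.
Qed.

Let weight_ge0 x : 0 <= pi x / p.
Proof. by rewrite divr_ge0 ?propensity_ge0// ltW// response_rate_gt0. Qed.

Let mweight : measurable_fun setT (fun x => pi x / p).
Proof. by apply: measurable_funM => //; exact: propensity_measurable. Qed.

Let mcst1 : measurable_fun [set: X] (cst (1 : R)).
Proof. exact: measurable_cst. Qed.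

Let mid : measurable_fun [set: X] (@id X). Proof. exact: measurable_id. Qed.

Let weight_transfer A : measurable A ->
  (\int[G]_(x in id @^-1` A) (pi x / p)%:E = \int[Gt]_(x in id @^-1` A) 1%:E)%E.
Proof.
move=> mA; rewrite preimage_id -complete_case_lawE// integral_cst//.
by rewrite mul1e.
Qed.

Lemma complete_case_integrable (k : X -> R) : measurable_fun setT k ->
  G.-integrable setT (fun x => (pi x * k x)%:E) <-> Gt.-integrable setT (fun x => (k x)%:E).
Proof.
move=> mk; have p0 := response_rate_gt0; split=> ik.
  have := integrable_transfer mid mid mweight mcst1 weight_ge0
    (fun=> ler01) weight_transfer mk.
  move=> H; apply: (eq_integrable measurableT _ _ _ (H _)) => [x _|]; first by rewrite mul1r.
  by under eq_fun do rewrite mulrAC mulrC; exact: intgZl.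
have := integrable_transfer mid mid mcst1 mweight
  (fun=> ler01) weight_ge0 (fun B mB => esym (weight_transfer mB)) mk.
under eq_fun do rewrite mul1r.
move=> /(_ ik) /(intgZl p); apply: eq_integrable => // x _.
by congr EFin; rewrite /=; field; rewrite gt_eqF.
Qed.

Lemma complete_case_integral (k : X -> R) : measurable_fun setT k ->
  Gt.-integrable setT (fun x => (k x)%:E) ->
  \int[G]_x (pi x * k x) = p * \int[Gt]_x k x.
Proof.
move=> mk ik; have p0 := response_rate_gt0.
have pn0 : p != 0 by rewrite gt_eqF.
have iw : G.-integrable setT (fun x => (pi x / p * k x)%:E).
  under eq_fun do rewrite mulrAC mulrC; apply: intgZl.
  exact/(complete_case_integrable mk).
have E : \int[G]_x (pi x / p * k x) = \int[Gt]_x k x.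
  have := integral_transfer mid mid mweight mcst1 weight_ge0 (fun=> ler01) weight_transfer mk.
  rewrite /Rintegral /= => ->; congr fine.
  by apply: eq_integral => x _; rewrite mul1r.
rewrite -E -RintegralZl//; apply: eq_Rintegral => x _.
by field.
Qed.

Lemma complete_case_le_intg (k : X -> R) : measurable_fun setT k ->
  G.-integrable setT (fun x => (k x)%:E) <-> Gt.-integrable setT (fun x => (k x)%:E).
Proof.
move=> mk; rewrite -(complete_case_integrable mk).
have mpk := measurable_funM propensity_measurable mk.
have [_ _ [c c0 cpi]] := hpi; split=> ik.
  apply: (intg_le mpk (intg_norm ik)) => x.
  rewrite normrM ger0_norm ?propensity_ge0// ler_piMl//; exact: propensity_le1.
apply: (intg_le mk (intgZl c^-1 (intg_norm ik))) => x.
rewrite normrM (ger0_norm (propensity_ge0 _)) mulrA ler_peMl// mulrC.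
by rewrite ler_pdivlMr// mul1r.
Qed.

Lemma complete_case_moments :
  (\int[Gt]_x (\sum_(i < m) (tnth x.1 i) ^+ 2)%:E < +oo)%E.
Proof.
have [G2a _] := hG2.
have mS : measurable_fun setT (fun x : X => \sum_(i < m) (tnth x.1 i) ^+ 2).
  by apply: measurable_sum => j; apply: measurable_funX; exact: coordinate_measurable.
have S0 (x : X) : 0 <= \sum_(i < m) (tnth x.1 i) ^+ 2.
  by apply: sumr_ge0 => j _; exact: sqr_ge0.
apply: (intg_lty S0); apply/(complete_case_le_intg mS).
exact: ge0_intg.
Qed.

(* The quadratic form of [W_ G] is the least mean square error of a prediction of [a^T U]
   from [V] under [G]; the errors under [Gt] are at least [c / E delta] times those
   under [G] when [pi >= c]. *)
Lemma complete_case_positive_definite : positive_definite (W_ Gt).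
Proof.
have Gt2 := complete_case_moments; have [G2a [_ WG]] := hG2.
split; first exact: W_sym.
move=> a a0; have [_ _ [c c0 cpi]] := hpi; have p0 := response_rate_gt0.
pose b v := \sum_i a i 0 * mu_ Gt v i 0.
have mb : measurable_fun setT b.
  by apply: measurable_sum => i; apply: measurable_funM => //; exact: mu_measurable.
have mbs : measurable_fun setT (fun x : X => b x.2) := measurableT_comp mb measurable_snd.
have b2t : Gt.-integrable setT (fun x : X => (b x.2 ^+ 2)%:E).
  apply: intg_sqr_sum => i; last exact/intg_sqrZ/mu_sqr_intg.
  apply: measurable_funM => //.
  exact: (measurableT_comp (mu_measurable Gt2 i) measurable_snd).
have b2 : G.-integrable setT (fun x : X => (b x.2 ^+ 2)%:E).
  by apply/(complete_case_le_intg (measurable_funX 2 mbs)).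
have := W_form_le G2a a mb b2.
have cE x : \sum_i a i 0 * centered Gt i x = dotv a x.1 - b x.2.
  rewrite dotvE /b -sumrB; apply: eq_bigr => i _; by rewrite -mulrBr.
have mC : measurable_fun setT (fun x : X => (dotv a x.1 - b x.2) ^+ 2).
  by apply: measurable_funX; apply: measurable_funB => //; exact: dotv_measurable.
have iCt : Gt.-integrable setT (fun x : X => ((dotv a x.1 - b x.2) ^+ 2)%:E).
  under eq_fun do rewrite -cE; apply: intg_sqr_sum => i; last exact/intg_sqrZ/centered_sqr_intg.
  by apply: measurable_funM => //; exact: centered_measurable.
have iC := (complete_case_le_intg mC).2 iCt.
move=> /(lt_le_trans (WG a a0)) H.
rewrite W_form//; under eq_Rintegral do rewrite cE.
rewrite -(pmulr_rgt0 _ p0) -complete_case_integral//.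
apply: (@lt_le_trans _ _ (c * \int[G]_x ((dotv a x.1 - b x.2) ^+ 2))).
  by rewrite mulr_gt0.
rewrite -RintegralZl//; apply: le_Rintegral => //.
- exact: intgZl.
- exact/(complete_case_integrable mC).
- by move=> x _; rewrite ler_wpM2r ?sqr_ge0.
Qed.

Lemma complete_case_G2 : G2 Gt.
Proof. split; [exact: complete_case_moments|exact: complete_case_positive_definite]. Qed.

Lemma complete_case_G1 : G1 Gt.
Proof.
have [g [cg [Cg [[mg g0 Hg] cg0 Hgc gout]]]] := hG1.
have [_ pi01 [c c0 cpi]] := hpi; have p0 := response_rate_gt0.
have c1 : c <= 1 := le_trans (cpi point) (propensity_le1 point).
have ms : measurable_fun [set: X] snd := measurable_snd.
have [q hq] := cond_expectation_exists ms propensity_intg.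
have mq : measurable_fun setT q by case: hq.
pose q' v := Num.max c (Num.min (q v) 1).
have mq' : measurable_fun setT q'.
  by apply: measurable_maxr => //; exact: measurable_minr.
have q'c v : c <= q' v by rewrite le_max lexx.
have q'1 v : q' v <= 1 by rewrite ge_max c1 ge_min lexx orbT.
have mqs : measurable_fun setT (fun x : X => q x.2) := measurableT_comp mq ms.
have mq's : measurable_fun setT (fun x : X => q' x.2) := measurableT_comp mq' ms.
have pi2 : G.-integrable setT (fun x => (pi x ^+ 2)%:E).
  apply: (intg_le _ (intg_cst G 1)) => [|x].
    by apply: measurable_funX; exact: propensity_measurable.
  by rewrite ger0_norm ?sqr_ge0// expr_le1// ?propensity_le1// propensity_ge0.
have q2 := cond_expectation_sqr_integrable ms propensity_intg hq pi2.
have q'2 : G.-integrable setT (fun x : X => (q' x.2 ^+ 2)%:E).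
  apply: (intg_le _ (intg_cst G 1)) => [|x]; first exact: measurable_funX.
  by rewrite ger0_norm ?sqr_ge0// expr_le1// (le_trans (ltW c0)).
have intgBsqr (u v : X -> R) : measurable_fun setT u -> measurable_fun setT v ->
    G.-integrable setT (fun x => (u x ^+ 2)%:E) -> G.-integrable setT (fun x => (v x ^+ 2)%:E) ->
    G.-integrable setT (fun x => ((u x - v x) ^+ 2)%:E).
  move=> mu mv u2 v2; apply: intg_sqrD => //; first exact: measurableT_comp.
  by under eq_fun do rewrite sqrrN.
have ipq := intgBsqr _ _ propensity_measurable mqs pi2 q2.
have ipq' := intgBsqr _ _ propensity_measurable mq's pi2 q'2.
have iqq' := intgBsqr _ _ mqs mq's q2 q'2.
have best := cond_expectation_best ms propensity_intg hq pi2 mq' q'2.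
have qq' : {ae G, forall x : X, q x.2 - q' x.2 = 0}.
  apply: (sqr_Rintegral_eq0 iqq'); apply/eqP; rewrite eq_le.
  rewrite [X in _ && X]Rintegral_ge0 ?andbT; last by move=> x _; exact: sqr_ge0.
  have : \int[G]_x ((q x.2 - q' x.2) ^+ 2) <=
      \int[G]_x ((pi x - q x.2) ^+ 2 - (pi x - q' x.2) ^+ 2).
    apply: le_Rintegral => //; first exact: intgB.
    move=> x _; rewrite -subr_ge0.
    have -> : (pi x - q x.2) ^+ 2 - (pi x - q' x.2) ^+ 2 - (q x.2 - q' x.2) ^+ 2 =
        2 * ((q' x.2 - q x.2) * (pi x - q' x.2)) by ring.
    apply: mulr_ge0 => //; have ? := cpi x; have ? := propensity_le1 x.
    have [q1|q1] := leP (q x.2) 1; have [qc|qc] := leP c (q x.2);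
      (have -> : q' x.2 = Num.max c (Num.min (q x.2) 1) by []).
    - by rewrite (min_idPl q1) (max_idPr qc) subrr mul0r.
    - by rewrite (min_idPl q1) (max_idPl (ltW qc)) mulr_ge0// subr_ge0// ltW.
    - by rewrite (min_idPr (ltW q1)) (max_idPr c1) mulr_le0// subr_le0// ltW.
    - by exfalso; lra.
  by rewrite RintegralB//; lra.
pose h v := q' v * g v / p.
have mh : measurable_fun setT h.
  by apply: measurable_funM => //; exact: measurable_funM.
have q'0 v : 0 <= q' v by rewrite (le_trans (ltW c0)).
have h0 v : 0 <= h v by rewrite divr_ge0 ?mulr_ge0// ltW.
exists h, (c * cg / p), (Cg / p); split.
- split=> // A mA.
  have mA' : measurable (snd @^-1` A : set X) by exact: measurable_preimageT.
  rewrite [LHS](complete_case_lawE mA').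
  transitivity (p^-1%:E * \int[G]_(x in snd @^-1` A) (pi x)%:E)%E.
    rewrite -integralZl//; last exact: integrableS propensity_intg.
    by apply: eq_integral => x _; rewrite -EFinM mulrC.
  have [_ _ /(_ A mA) ->] := hq.
  have -> : (\int[G]_(x in snd @^-1` A) (q x.2)%:E =
      \int[G]_(x in snd @^-1` A) (q' x.2)%:E)%E.
    apply: ae_eq_integral => //.
    - by apply/measurable_EFinP; exact: measurable_funTS.
    - by apply/measurable_EFinP; exact: measurable_funTS.
    - apply: (@filterS _ _ (ae_filter_ringOfSetsType G) _ _ _ qq') => x /eqP.
      by rewrite subr_eq0 => /eqP -> _.
  have -> : (\int[G]_(x in snd @^-1` A) (q' x.2)%:E =
      \int[lam]_v ((g v)%:E * (q' v * \1_A v)%:E))%E.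
    transitivity (\int[G]_x (1%:E * (q' x.2 * \1_A x.2)%:E))%E.
      rewrite integral_mkcond; apply: eq_integral => x _; rewrite patchE indicE mul1e.
      by have [xA|xA] := pselect (A x.2); [rewrite !mem_set ?mulr1|rewrite !memNset ?mulr0].
    have mid' : measurable_fun [set: R] (@id R) by exact: measurable_id.
    apply: (@ge0_integral_transfer _ _ _ _ _ _ _ G lam snd id (cst 1) g ms mid' mcst1 mg
      (fun=> ler01) g0 _ (fun v => (q' v * \1_A v)%:E)).
    + move=> B mB; rewrite preimage_id -Hg//.
      transitivity (\int[G]_(x in snd @^-1` B) 1%:E)%E => //.
      by rewrite integral_cst ?mul1e//; exact: measurable_preimageT.
    + by apply/measurable_EFinP; apply: measurable_funM => //; exact: measurable_indic.
    + by move=> v; rewrite lee_fin mulr_ge0// indicE.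
  rewrite -ge0_integralZl//; last 3 first.
  + apply: emeasurable_funM; first exact/measurable_EFinP.
    by apply/measurable_EFinP; apply: measurable_funM => //; exact: measurable_indic.
  + by move=> v _; rewrite mule_ge0// lee_fin// mulr_ge0// indicE.
  + by rewrite lee_fin invr_ge0 ltW.
  rewrite [RHS]integral_mkcond; apply: eq_integral => v _; rewrite patchE indicE /h.
  by case: ifPn => _; rewrite -!EFinM; congr EFin; rewrite /=; ring.
- by rewrite divr_gt0// mulr_gt0.
- move=> v v01; have /andP[cgv gCv] := Hgc v v01; rewrite /h.
  rewrite !ler_pM2r ?invr_gt0//; apply/andP; split.
    by apply: ler_pM => //; exact: ltW.
  by apply: le_trans gCv; rewrite ler_piMl.
- by move=> v v01; rewrite /h gout// mulr0 mul0r.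
Qed.

End mar_model.

(** * The canonical gradient *)

Section efficient_influence.
Context {R : realType} {m : nat}.
Local Notation X := (m.-tuple R * R)%type.
Variables (theta : 'cV[R]_m) (rho f f' : R -> R) (pi : X -> R) (G Gt : probability X R).
Context {d : measure_display} {Omega : measurableType d}.
Variables (P : probability Omega R) (U : Omega -> m.-tuple R) (V Y : Omega -> R)
  (delta : Omega -> bool).
Hypotheses (hrho : twice_continuously_differentiable rho) (hf : error_density f f')
  (hG1 : G1 G) (hG2 : G2 G) (hpi : propensity_assumptions pi)
  (hY : partially_linear P U V Y theta rho f G)
  (hdelta : missing_at_random P U V Y delta pi) (hGt : conditional_law P U V delta Gt).

Local Notation lam := (@lebesgue_measure R).
Local Notation Xw w := (U w, V w).
Local Notation eps w := (residual theta rho (U w, V w) (Y w)).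
Local Notation dl w := ((delta w)%:R : R).
Local Notation p := (\int[P]_w (delta w)%:R).
Local Notation J := (fisher_information f f').
Local Notation s := (score f f').
Local Notation K := (invmx (fisher_information f f' *: W_ Gt)).

Let p0 : 0 < p := response_rate_gt0 hrho hf hpi hY hdelta.
Let Gt2 := complete_case_moments hrho hf hG2 hpi hY hdelta hGt.
Let intGt (k : X -> R) := @complete_case_le_intg R m theta rho f f' pi G Gt d Omega P U V Y
  delta hrho hf hpi hY hdelta hGt k.
Let intpi (k : X -> R) := @complete_case_integrable R m theta rho f f' pi G Gt d Omega P U V Y
  delta hrho hf hpi hY hdelta hGt k.

Let ms : measurable_fun setT s := score_measurable hf.

Lemma information_unit : J *: W_ Gt \in unitmx.
Proof.
rewrite unitmxZ; first
  exact/positive_definite_unitmx/(complete_case_positive_definite hrho hf hG2 hpi hY hdelta hGt).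
by rewrite unitfE gt_eqF// (fisher_information_gt0 hf).
Qed.

Definition influence_coef (i : 'I_m) (x : X) : R := p^-1 * \sum_j K i j * centered Gt j x.

Lemma influence_coef_measurable i : measurable_fun setT (influence_coef i).
Proof.
apply: measurable_funM => //; apply: measurable_sum => j; apply: measurable_funM => //.
exact: centered_measurable.
Qed.

Lemma influence_coef_sqr_intg i : Gt.-integrable setT (fun x => (influence_coef i x ^+ 2)%:E).
Proof.
apply: intg_sqrZ; apply: intg_sqr_sum => j; last exact/intg_sqrZ/centered_sqr_intg.
by apply: measurable_funM => //; exact: centered_measurable.
Qed.

Let coef2 i : G.-integrable setT (fun x => (influence_coef i x ^+ 2)%:E).
Proof.
by apply/(intGt (measurable_funX 2 (influence_coef_measurable i)))/influence_coef_sqr_intg.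
Qed.

Lemma mar_influenceE i x y b : mar_influence theta rho f f' Gt p x y b i 0 =
  b%:R * (influence_coef i x * s (residual theta rho x y)).
Proof.
rewrite /mar_influence mxE [X in _ * X]mxE /influence_coef.
rewrite (eq_bigr (fun j => K i j * centered Gt j x)); last first.
  by move=> j _; rewrite /centered !mxE.
set S := \sum_j _; set t := s _; set q := p^-1; set e := b%:R.
by move: (S) (t) (q) (e) => *; ring.
Qed.

Definition mar_gradient (z : X * R * bool) : 'cV[R]_m :=
  mar_influence theta rho f f' Gt p z.1.1 z.1.2 z.2.

Lemma mar_gradient_observe x y b : mar_gradient (observe x y b) =
  mar_influence theta rho f f' Gt p x y b.
Proof.
apply/colP => i; rewrite /mar_gradient /observe/= !mar_influenceE.
by case: b; rewrite ?mul1r// !mul0r.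
Qed.

Lemma mar_gradient_measurable i : measurable_fun setT (fun z => mar_gradient z i 0).
Proof.
rewrite (_ : (fun z => _) = (fun z : X * R * bool => if z.2 then
    influence_coef i z.1.1 * s (residual theta rho z.1.1 z.1.2) else 0)); last first.
  by apply/funext => z; rewrite /mar_gradient mar_influenceE; case: z.2; rewrite ?mul1r ?mul0r.
apply: measurable_fun_ifT => //; apply: measurable_funM.
  apply: (measurableT_comp (influence_coef_measurable i)).
  exact: (measurableT_comp measurable_fst measurable_fst).
apply: (measurableT_comp ms).
exact: (measurableT_comp (residual_measurable theta hrho) measurable_fst).
Qed.

Lemma tangent_G0 : tangent_G G (fun=> 0).
Proof.
have q0 : (fun _ : X => ((0 : R) ^+ 2)%:E) = cst 0%E.
  by apply/funext => x; rewrite expr0n.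
split.
- exact: measurable_cst.
- exact: integral0.
- by rewrite q0 integral0 ltry.
- exists (fun=> G); split => //; exists G, (cst 1), (fun=> cst 1).
  have dG : is_density G G (cst 1).
    by split => // A mA; rewrite /cst integral_cst// mul1e.
  split => //; apply: cvg_near_cst; apply: nearW => n.
  rewrite (_ : (fun x => _) = cst 0%E) ?integral0//.
  by apply/funext => x; rewrite /= subrr !mulr0 mul0r subr0 expr0n.
Qed.

Lemma tangent_pi0 : tangent_pi G pi (fun=> 0).
Proof.
have q0 : (fun x : X => ((0 : R) ^+ 2 * (pi x * (1 - pi x)))%:E) = cst 0%E.
  by apply/funext => x; rewrite expr0n mul0r.
split.
- exact: measurable_cst.
- by rewrite q0 integral0 ltry.
- exists (fun=> pi); split => //; apply: cvg_near_cst; apply: nearW => n.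
  rewrite (_ : (fun x => _) = cst 0%E) ?integral0//.
  apply/funext => x; rewrite /= big1// => b _.
  by rewrite subrr !mulr0 mul0r subr0 expr0n.
Qed.

Lemma mar_gradient_tangent i : exists a b,
  tangent_Q_coef G f b (fun=> 0) /\
  forall om, mar_gradient (observe (Xw om) (Y om) (delta om)) i 0 =
    tangent U V Y delta theta rho f f' pi (fun=> 0) (fun=> 0) a b (fun=> 0) om.
Proof.
pose b v := - (p^-1 * \sum_j K i j * mu_ Gt v j 0).
have mb : measurable_fun setT b.
  apply: measurableT_comp => //; apply: measurable_funM => //; apply: measurable_sum => j.
  by apply: measurable_funM => //; exact: mu_measurable.
exists (\col_j (p^-1 * K i j)), b; split.
  have z1 : (fun y : R => ((0 : R) ^+ 2 * f y)%:E) = cst 0%E.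
    by apply/funext => y; rewrite expr0n mul0r.
  have z2 : (fun y : R => ((0 : R) * f y)%:E) = cst 0%E.
    by apply/funext => y; rewrite mul0r.
  have z3 : (fun y : R => (y * 0 * f y)%:E) = cst 0%E.
    by apply/funext => y; rewrite mulr0 mul0r.
  split.
  - split=> //; apply: intg_lty => [x|]; first exact: sqr_ge0.
    have mbs : measurable_fun setT (fun x : X => b x.2) := measurableT_comp mb measurable_snd.
    apply/(intGt (measurable_funX 2 mbs)); under eq_fun do rewrite sqrrN.
    apply: intg_sqrZ; apply: intg_sqr_sum => j; last exact/intg_sqrZ/mu_sqr_intg.
    apply: measurable_funM => //.
    exact: (measurableT_comp (mu_measurable Gt2 j) measurable_snd).
  - by split; [exact: measurable_cst|rewrite z1 integral0 ltry].
  - by rewrite z2 integral0.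
  - by rewrite z3 integral0.
move=> om; rewrite mar_gradient_observe mar_influenceE /tangent /tangent_Q.
rewrite mulr0 add0r !addr0 -mulrDl; congr (_ * (_ * _)).
rewrite dotvE /b /influence_coef !big_distrr/= -sumrB; apply: eq_bigr => j _.
by rewrite /centered !mxE/=; ring.
Qed.

Section inner_product.
Variables (u w : X -> R) (a : 'cV[R]_m) (b c : R -> R).
Hypotheses (hu : tangent_G G u) (hw : tangent_pi G pi w) (hbc : tangent_Q_coef G f b c).

Let mu' : measurable_fun setT u. Proof. by case: hu. Qed.
Let mw : measurable_fun setT w. Proof. by case: hw. Qed.
Let mb : measurable_fun setT b. Proof. by case: hbc => [[]]. Qed.
Let mc : measurable_fun setT c. Proof. by case: hbc => [_ []]. Qed.
Let mbs : measurable_fun setT (fun x : X => b x.2) := measurableT_comp mb measurable_snd.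

Lemma tangent_measurable :
  measurable_fun setT (tangent U V Y delta theta rho f f' pi u w a b c).
Proof.
have mX := covariate_measurable hY.
have meps := error_measurable hrho hY.
have mdl := indicator_measurable hdelta.
apply: measurable_funD; [apply: measurable_funD|].
- exact: (measurableT_comp mu' mX).
- apply: measurable_funM => //; apply: measurable_funD; last exact: (measurableT_comp mc meps).
  apply: measurable_funD; apply: measurable_funM; try exact: (measurableT_comp ms meps).
    exact: (measurableT_comp (dotv_measurable a) mX).
  exact: (measurableT_comp mbs mX).
- apply: measurable_funM; last exact: (measurableT_comp mw mX).
  apply: measurable_funB => //; exact: (measurableT_comp (propensity_measurable hpi) mX).
Qed.

Let u2 : G.-integrable setT (fun x => (u x ^+ 2)%:E).
Proof.
have [_ _ ulty _] := hu; apply: ge0_intg => //; first exact: measurable_funX.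
by move=> x; exact: sqr_ge0.
Qed.

Let b2 : G.-integrable setT (fun x : X => (b x.2 ^+ 2)%:E).
Proof.
have [[_ blty] _ _ _] := hbc; apply: ge0_intg => //; first exact: measurable_funX.
by move=> x; exact: sqr_ge0.
Qed.

Let w2 : G.-integrable setT (fun x => (((1 - pi x) * w x) ^+ 2)%:E).
Proof.
have mpi := propensity_measurable hpi.
have mw1 : measurable_fun setT (fun x => ((1 - pi x) * w x) ^+ 2).
  by apply: measurable_funX; apply: measurable_funM => //; exact: measurable_funB.
have [_ wlty _] := hw; have [_ pi01 [e e0 epi]] := hpi.
have iw : G.-integrable setT (fun x => (w x ^+ 2 * (pi x * (1 - pi x)))%:E).
  apply: ge0_intg => //.
  - apply: measurable_funM; first exact: measurable_funX.
    by apply: measurable_funM => //; exact: measurable_funB.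
  - move=> x; have /andP[? ?] := pi01 x.
    by rewrite mulr_ge0 ?sqr_ge0// mulr_ge0// subr_ge0.
apply: (intg_le mw1 (intgZl e^-1 iw)) => x.
have /andP[x0 x1] := pi01 x; rewrite ger0_norm ?sqr_ge0// ler_pdivlMl//.
rewrite exprMn [_ * (w x) ^+ 2]mulrC mulrCA ler_wpM2l ?sqr_ge0//.
rewrite expr2 mulrA ler_wpM2r ?subr_ge0//; apply: le_trans (epi x).
by rewrite ler_piMr ?(ltW e0)// gerBl.
Qed.

Let c2 : lam.-integrable setT (fun y : R => (c y ^+ 2 * f y)%:E).
Proof.
have [_ [_ clty] _ _] := hbc; apply: ge0_intg => //.
- exact: measurable_funM (measurable_funX 2 mc) (error_density_measurable hf).
- by move=> y; rewrite mulr_ge0 ?sqr_ge0 ?(error_density_ge0 hf).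
Qed.

Let isc : lam.-integrable setT (fun y : R => (s y * c y * f y)%:E).
Proof.
apply: (intg_le _ (intgD (score2_intg hf) c2)).
  exact: measurable_funM (measurable_funM ms mc) (error_density_measurable hf).
move=> y; have f0 := error_density_ge0 hf y.
rewrite -mulrDl normrM (ger0_norm f0) ler_wpM2r//.
have := sqr_ge0 (s y + c y); have := sqr_ge0 (s y - c y).
by rewrite ler_norml => ? ?; apply/andP; split; nra.
Qed.

Variable i : 'I_m.
Local Notation k := (influence_coef i).

Let mk : measurable_fun setT k := influence_coef_measurable i.
Let mdot : measurable_fun setT (fun x : X => dotv a x.1) := dotv_measurable a.

Let dot2 : G.-integrable setT (fun x : X => (dotv a x.1 ^+ 2)%:E).
Proof.
have [G2a _] := hG2; under eq_fun do rewrite dotvE.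
apply: intg_sqr_sum => j; last exact/intg_sqrZ/coordinate_sqr_intg.
by apply: measurable_funM => //; exact: coordinate_measurable.
Qed.

Let mkt2 : measurable_fun setT (fun x : X => k x * (dotv a x.1 + b x.2)).
Proof. by apply: measurable_funM => //; exact: measurable_funD. Qed.

Let ikt2 : G.-integrable setT (fun x : X => (k x * (dotv a x.1 + b x.2))%:E).
Proof.
apply: intgM => //; first exact: measurable_funD.
exact: intg_sqrD.
Qed.

Let mkw : measurable_fun setT (fun x : X => (1 - pi x) * w x).
Proof.
by apply: measurable_funM => //; apply: measurable_funB => //; exact: propensity_measurable.
Qed.

Let pik (h : X -> R) : measurable_fun setT h -> G.-integrable setT (fun x => (h x)%:E) ->
  G.-integrable setT (fun x => (pi x * h x)%:E).
Proof. by move=> mh ih; apply/(intpi mh)/(intGt mh). Qed.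

Let k1 : G.-integrable setT (fun x => (k x)%:E).
Proof. exact: sqr_intg. Qed.

Let decompose om : mar_gradient (observe (Xw om) (Y om) (delta om)) i 0 *
    tangent U V Y delta theta rho f f' pi u w a b c om =
  (dl om * (k (Xw om) * u (Xw om) * s (eps om)) +
   dl om * (k (Xw om) * (dotv a (U om) + b (V om)) * s (eps om) ^+ 2)) +
  (dl om * (k (Xw om) * (s (eps om) * c (eps om))) +
   dl om * (k (Xw om) * ((1 - pi (Xw om)) * w (Xw om)) * s (eps om))).
Proof.
rewrite mar_gradient_observe mar_influenceE /tangent /tangent_Q/=.
by case: (delta om) => /=; ring.
Qed.

Let msc : measurable_fun setT (fun y => s y * c y). Proof. exact: measurable_funM. Qed.
Let ms2 : measurable_fun setT (fun y => s y ^+ 2). Proof. exact: measurable_funX. Qed.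
Let mku : measurable_fun setT (fun x => k x * u x). Proof. exact: measurable_funM. Qed.
Let mkw' : measurable_fun setT (fun x => k x * ((1 - pi x) * w x)).
Proof. exact: measurable_funM. Qed.

Let i1 := complete_case_intg hrho hf hpi hY hdelta mku ms
  (pik mku (intgM mk mu' (coef2 i) u2)) (score_intg hf).
Let i2 := complete_case_intg hrho hf hpi hY hdelta mkt2 ms2 (pik mkt2 ikt2) (score2_intg hf).
Let i3 := complete_case_intg hrho hf hpi hY hdelta mk msc (pik mk k1) isc.
Let i4 := complete_case_intg hrho hf hpi hY hdelta mkw' ms
  (pik mkw' (intgM mk mkw (coef2 i) w2)) (score_intg hf).

Lemma mar_gradient_tangent_intg : P.-integrable setT (fun om =>
  (mar_gradient (observe (Xw om) (Y om) (delta om)) i 0 *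
   tangent U V Y delta theta rho f f' pi u w a b c om)%:E).
Proof.
under eq_fun do rewrite decompose.
by apply: intgD; apply: intgD; [exact: i1|exact: i2|exact: i3|exact: i4].
Qed.

Let kmean : \int[Gt]_x k x = 0.
Proof.
have ic j : Gt.-integrable setT (fun x => (centered Gt j x)%:E).
  by apply: sqr_intg; [exact: centered_measurable|exact: centered_sqr_intg].
rewrite RintegralZl//; last by apply: intg_sum => j; exact: intgZl.
rewrite Rintegral_sum; last by move=> j; exact: intgZl.
rewrite big1 ?mulr0// => j _.
by rewrite (RintegralZl (K i j) measurableT (ic j)) (centered_mean Gt2 j) mulr0.
Qed.

Let kdot : J * \int[Gt]_x (k x * (dotv a x.1 + b x.2)) = p^-1 * a i 0.
Proof.
have ik2 := influence_coef_sqr_intg i.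
have b2t : Gt.-integrable setT (fun x : X => (b x.2 ^+ 2)%:E).
  by apply/(intGt (measurable_funX 2 mbs)).
have cU j l : Gt.-integrable setT (fun x : X => (centered Gt j x * tnth x.1 l)%:E).
  by apply: intgM; [exact: centered_measurable|exact: coordinate_measurable|
    exact: centered_sqr_intg|exact: coordinate_sqr_intg].
have cb j : Gt.-integrable setT (fun x : X => (centered Gt j x * b x.2)%:E).
  by apply: intgM => //; [exact: centered_measurable|exact: centered_sqr_intg].
have E x : k x * (dotv a x.1 + b x.2) = \sum_j ((p^-1 * K i j) *
    (\sum_l a l 0 * (centered Gt j x * tnth x.1 l) + centered Gt j x * b x.2)).
  rewrite /influence_coef -mulrA mulr_suml big_distrr/=; apply: eq_bigr => j _.
  rewrite dotvE -!mulrA; congr (_ * (_ * _)); rewrite mulrDr; congr (_ + _).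
  by rewrite big_distrr/=; apply: eq_bigr => l _; ring.
under eq_Rintegral do rewrite E.
have isum j : Gt.-integrable setT (fun x : X => (\sum_l a l 0 *
    (centered Gt j x * tnth x.1 l))%:E).
  by apply: intg_sum => l; exact: intgZl.
rewrite Rintegral_sum; last by move=> j; apply: intgZl; exact: intgD.
have -> : a i 0 = (K *m (J *: W_ Gt) *m a) i 0 by rewrite mulVmx ?mul1mx// information_unit.
rewrite -mulmxA [in RHS]mxE !big_distrr/=; apply: eq_bigr => j _.
rewrite (RintegralZl (p^-1 * K i j) measurableT (intgD (isum j) (cb j))).
rewrite (RintegralD measurableT (isum j) (cb j)) (centered_orthogonal Gt2 j mb b2t) addr0.
rewrite Rintegral_sum; last first.
  by move=> l; exact: intgZl.
rewrite -scalemxAl [in RHS]mxE [in RHS]mxE.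
rewrite (eq_bigr (fun l => W_ Gt j l * a l 0)); last first.
  by move=> l _; rewrite (RintegralZl (a l 0) measurableT (cU j l)) centered_coordinate// mulrC.
by ring.
Qed.

Lemma mar_gradient_inner : \int[P]_om
  (mar_gradient (observe (Xw om) (Y om) (delta om)) i 0 *
   tangent U V Y delta theta rho f f' pi u w a b c om) = a i 0.
Proof.
under eq_Rintegral do rewrite decompose.
rewrite (RintegralD measurableT (intgD i1 i2) (intgD i3 i4)).
rewrite (RintegralD measurableT i1 i2) (RintegralD measurableT i3 i4).
rewrite (complete_case_Rintegral hrho hf hpi hY hdelta mku ms
  (pik mku (intgM mk mu' (coef2 i) u2)) (score_intg hf)).
rewrite (complete_case_Rintegral hrho hf hpi hY hdelta mkt2 ms2 (pik mkt2 ikt2) (score2_intg hf)).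
rewrite (complete_case_Rintegral hrho hf hpi hY hdelta mk msc (pik mk k1) isc).
rewrite (complete_case_Rintegral hrho hf hpi hY hdelta mkw' ms
  (pik mkw' (intgM mk mkw (coef2 i) w2)) (score_intg hf)).
rewrite (score_mean0 hf) !mulr0 add0r addr0.
have intk h := @complete_case_integral R m theta rho f f' pi G Gt d Omega P U V Y
  delta hrho hf hpi hY hdelta hGt h.
rewrite (intk k)//; last exact/(intGt mk).
rewrite kmean mulr0 mul0r addr0 intk//; last exact/(intGt mkt2).
by rewrite -mulrA [X in _ * X]mulrC kdot mulrA divff ?mul1r// gt_eqF.
Qed.

End inner_product.

Lemma mar_gradient_canonical :
  canonical_gradient P U V Y delta theta rho f f' pi G mar_gradient.
Proof.
split; first exact: mar_gradient_measurable.
- move=> i; have [a [b [hab E]]] := mar_gradient_tangent i.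
  exists (fun=> 0), (fun=> 0), a, b, (fun=> 0).
  by split; [exact: tangent_G0|exact: tangent_pi0| |apply: aeW].
- move=> u w a b c hu hw hbc i.
  by rewrite EFin_Rintegral ?mar_gradient_inner//; exact: mar_gradient_tangent_intg.
Qed.

Lemma observe_measurable : measurable_fun setT (fun om => observe (Xw om) (Y om) (delta om)).
Proof.
have [_ _ mY _] := hY; have [md _ _] := hdelta.
apply: measurable_fun_pair => //; apply: measurable_fun_pair.
  exact: covariate_measurable hY.
by apply: measurable_funM => //; exact: indicator_measurable hdelta.
Qed.

(* Both gradients are tangents that represent the derivative, so their squared norms and
   their inner product coincide. *)
Lemma canonical_gradient_unique g i :
  canonical_gradient P U V Y delta theta rho f f' pi G g ->
  {ae P, forall om, g (observe (Xw om) (Y om) (delta om)) i 0 -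
                    mar_gradient (observe (Xw om) (Y om) (delta om)) i 0 = 0}.
Proof.
move=> [mg tg ig]; have [u [w [a [b [c [hu hw hbc E]]]]]] := tg i.
have [a0 [b0 [hab0 E0]]] := mar_gradient_tangent i.
pose g1 om := g (observe (Xw om) (Y om) (delta om)) i 0.
pose g0 om := mar_gradient (observe (Xw om) (Y om) (delta om)) i 0.
pose t1 := tangent U V Y delta theta rho f f' pi u w a b c.
have mg1 : measurable_fun setT g1 := measurableT_comp (mg i) observe_measurable.
have mg0 : measurable_fun setT g0 := measurableT_comp (mar_gradient_measurable i) observe_measurable.
have mt1 : measurable_fun setT t1 := tangent_measurable a hu hw hbc.
have ae1 (h : Omega -> R) : measurable_fun setT h ->
    (\int[P]_om (h om * g1 om)%:E = \int[P]_om (h om * t1 om)%:E)%E.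
  move=> mh; apply: ae_eq_integral => //.
  - by apply/measurable_EFinP; exact: measurable_funM.
  - by apply/measurable_EFinP; exact: measurable_funM.
  - apply: (@filterS _ _ (ae_filter_ringOfSetsType P) _ _ _ E) => om Eom _.
    by congr EFin; rewrite -[g1 om]/(g _ i 0) Eom.
have g11 : (\int[P]_om (g1 om ^+ 2)%:E = (a i 0)%:E)%E.
  under eq_integral do rewrite expr2.
  by rewrite ae1//; exact: (ig u w a b c hu hw hbc i).
have g12 : P.-integrable setT (fun om => (g1 om ^+ 2)%:E).
  apply: ge0_intg; [exact: measurable_funX|by move=> ?; exact: sqr_ge0|].
  by rewrite g11 ltry.
have g02 : P.-integrable setT (fun om => (g0 om ^+ 2)%:E).
  have := mar_gradient_tangent_intg a0 tangent_G0 tangent_pi0 hab0 i.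
  by under eq_fun do rewrite -E0 -expr2.
have g00 : \int[P]_om (g0 om ^+ 2) = a0 i 0.
  rewrite -(mar_gradient_inner a0 tangent_G0 tangent_pi0 hab0 i).
  by apply: eq_Rintegral => om _; rewrite -E0 expr2.
have g10 : \int[P]_om (g0 om * g1 om) = a0 i 0.
  have := ig _ _ _ _ _ tangent_G0 tangent_pi0 hab0 i; rewrite /Rintegral => H.
  rewrite -[RHS]/(fine (a0 i 0)%:E) -H; congr fine.
  by apply: eq_integral => om _; rewrite -E0 mulrC.
have g01 : \int[P]_om (g0 om * g1 om) = a i 0.
  by rewrite /Rintegral ae1// -(mar_gradient_inner a hu hw hbc i).
have ig01 := intgM mg0 mg1 g02 g12.
have iB : P.-integrable setT (fun om => ((g1 om - g0 om) ^+ 2)%:E).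
  apply: intg_sqrD => //; first exact: measurableT_comp.
  by under eq_fun do rewrite sqrrN.
apply: (sqr_Rintegral_eq0 iB).
transitivity (\int[P]_om (g1 om ^+ 2 + g0 om ^+ 2 - 2 * (g0 om * g1 om))).
  by apply: eq_Rintegral => om _; rewrite -/(g1 om) -/(g0 om); ring.
rewrite (RintegralB measurableT (intgD g12 g02) (intgZl 2 ig01)).
rewrite (RintegralD measurableT g12 g02) (RintegralZl 2 measurableT ig01).
rewrite g00 {1}/Rintegral g11/= g10 -{1}g01 g10; ring.
Qed.

End efficient_influence.

Lemma ae_eq_measure {R : realType} {d} {T : measurableType d} (P : probability T R)
    (A B : set T) : measurable A -> measurable B ->
  {ae P, forall x, A x <-> B x} -> P A = P B.
Proof.
move=> mA mB AB.
have := @ae_eq_integral _ _ _ P setT (fun x => (\1_B x)%:E) (fun x => (\1_A x)%:E) measurableT.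
rewrite !integral_indic// !setIT; apply.
- by apply/measurable_EFinP; exact: measurable_indic.
- by apply/measurable_EFinP; exact: measurable_indic.
- apply: (@filterS _ _ (ae_filter_ringOfSetsType P) _ _ _ AB) => x xAB _.
  by congr EFin; rewrite !indicE (_ : (x \in A) = (x \in B))//; apply/idP/idP;
    rewrite !inE => /xAB.
Qed.

Lemma ae_forall_ord {R : realType} {d} {T : measurableType d} (P : probability T R)
    (n : nat) (A : 'I_n -> T -> Prop) :
  (forall j, {ae P, forall x, A j x}) -> {ae P, forall x, forall j, A j x}.
Proof.
move=> H; have F := ae_filter_ringOfSetsType P.
suff : {ae P, forall x, forall j, j \in enum 'I_n -> A j x}.
  by apply: (@filterS _ _ F) => x Hx j; apply: Hx; rewrite mem_enum.
elim: (enum 'I_n) => [|j s IH]; first by apply: aeW.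
apply: (@filterS2 _ _ F _ _ _ _ (H j) IH) => x Aj As l.
by rewrite inE => /orP[/eqP ->//|]; exact: As.
Qed.

Lemma copies_ae {R : realType} {d d'} {T : measurableType d} {T' : measurableType d'}
    (P : probability T R) (Z : T -> T') (Z_ : nat -> T -> T') (h : T' -> R) (j : nat) :
  measurable_fun setT Z -> measurable_fun setT h -> independent_copies P Z Z_ ->
  {ae P, forall x, h (Z x) = 0} -> {ae P, forall x, h (Z_ j x) = 0}.
Proof.
move=> mZ mh [mZ_ same _] H.
pose B := h @^-1` [set~ 0].
have mB : measurable B.
  by apply: measurable_preimageT => //; apply: measurableC; exact: measurable_set1.
have PZ : P (Z @^-1` B) = 0%E.
  apply/(negligibleP P (measurable_preimageT mZ mB)).
  by move: H; rewrite /almost_everywhere.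
exists (Z_ j @^-1` B); split; first exact: measurable_preimageT.
  by rewrite same.
by [].
Qed.

Lemma scaled_remainder_measurable {R : realType} {d} {T : measurableType d} (m n : nat)
    (theta : 'cV[R]_m) (t : T -> 'cV[R]_m) (psi : 'I_n -> T -> 'cV[R]_m) :
  (forall i, measurable_fun setT (fun x => t x i 0)) ->
  (forall j i, measurable_fun setT (fun x => psi j x i 0)) ->
  measurable_fun setT (fun x => scaled_remainder theta (t x) (fun j => psi j x)).
Proof.
move=> mt mpsi; apply: measurable_funM => //; apply: measurable_mx_norm => i j.
rewrite (ord1 j); under eq_fun do rewrite mxE [X in _ + X]mxE mxE [X in _ - X]mxE summxE.
apply: measurable_funB; last by apply: measurable_funM => //; exact: measurable_sum.
by apply: measurable_funD => //; exact: mt.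
Qed.

Lemma measurable_gt {R : realType} {d} {T : measurableType d} (X : T -> R) (e : R) :
  measurable_fun setT X -> measurable [set x | e < X x].
Proof.
move=> mX; rewrite (_ : [set x | e < X x] = X @^-1` `]e, +oo[%classic).
  exact: measurable_preimageT.
by apply/seteqP; split => x /=; rewrite in_itv/= andbT.
Qed.

Section expansions.
Context {R : realType} {m : nat}.
Local Notation X := (m.-tuple R * R)%type.
Context {d : measure_display} {Omega : measurableType d}.
Variables (P : probability Omega R) (U : Omega -> m.-tuple R) (V Y : Omega -> R)
  (delta : Omega -> bool).
Variables (U_ : nat -> Omega -> m.-tuple R) (V_ Y_ : nat -> Omega -> R)
  (delta_ : nat -> Omega -> bool).
Hypothesis mZ : measurable_fun setT (fun w => (U w, V w, Y w, delta w)).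
Hypothesis copies : independent_copies P (fun w => (U w, V w, Y w, delta w))
  (fun j w => (U_ j w, V_ j w, Y_ j w, delta_ j w)).

Definition raw_observe (z : X * R * bool) : X * R * bool := observe z.1.1 z.1.2 z.2.

Lemma raw_observe_measurable : measurable_fun setT raw_observe.
Proof.
have m1 : measurable_fun setT (fun z : X * R * bool => z.1) by exact: measurable_fst.
apply: measurable_fun_pair; last exact: measurable_snd.
apply: measurable_fun_pair; first exact: (measurableT_comp measurable_fst m1).
rewrite (_ : (fun z : X * R * bool => _) = (fun z : X * R * bool => if z.2 then z.1.2 else 0)).
  apply: measurable_fun_ifT => //.
  exact: (measurableT_comp measurable_snd m1).
by apply/funext => z; case: z.2; rewrite ?mul1r ?mul0r.
Qed.

Let mobs j : measurable_fun setT (fun om => observe (U_ j om, V_ j om) (Y_ j om) (delta_ j om)).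
Proof. by have [mZ_ _ _] := copies; exact: (measurableT_comp raw_observe_measurable (mZ_ j)). Qed.

Lemma sample_measurable n : measurable_fun setT (fun om =>
  [tuple observe (U_ j om, V_ j om) (Y_ j om) (delta_ j om) | j < n]).
Proof.
apply/measurable_fun_tnthP => j; rewrite (_ : _ \o _ =
  (fun om => observe (U_ j om, V_ j om) (Y_ j om) (delta_ j om))); first exact: mobs.
by apply/funext => om /=; rewrite tnth_mktuple.
Qed.

Lemma remainder_event_measurable (theta : 'cV[R]_m)
    (T : forall n, n.-tuple (X * R * bool) -> 'cV[R]_m) (k : X * R * bool -> 'cV[R]_m) (e : R) n :
  mar_estimator T -> (forall i, measurable_fun setT (fun z => k z i 0)) ->
  measurable [set om | e < scaled_remainder theta
    (T n [tuple observe (U_ j om, V_ j om) (Y_ j om) (delta_ j om) | j < n])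
    (fun j : 'I_n => k (observe (U_ j om, V_ j om) (Y_ j om) (delta_ j om)))].
Proof.
move=> mT mk; apply: measurable_gt; apply: scaled_remainder_measurable => [i|j i].
  exact: (@measurableT_comp _ _ _ _ _ _ (fun s => T n s i 0) setT _ (mT n i) (@sample_measurable n)).
exact: (measurableT_comp (mk i) (mobs j)).
Qed.

Lemma mar_expansion_ae (theta : 'cV[R]_m)
    (T : forall n, n.-tuple (X * R * bool) -> 'cV[R]_m) (g h : X * R * bool -> 'cV[R]_m) :
  mar_estimator T ->
  (forall i, measurable_fun setT (fun z => g z i 0)) ->
  (forall i, measurable_fun setT (fun z => h z i 0)) ->
  (forall i, {ae P, forall om, g (observe (U om, V om) (Y om) (delta om)) i 0 -
                               h (observe (U om, V om) (Y om) (delta om)) i 0 = 0}) ->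
  mar_expansion P U_ V_ Y_ delta_ theta T (fun x y b => g (observe x y b)) ->
  mar_expansion P U_ V_ Y_ delta_ theta T (fun x y b => h (observe x y b)).
Proof.
move=> mT mg mh gh exp e e0; have {}exp := exp e e0.
pose r (k : X * R * bool -> 'cV[R]_m) n := P [set om | e < scaled_remainder theta
  (T n [tuple observe (U_ j om, V_ j om) (Y_ j om) (delta_ j om) | j < n])
  (fun j : 'I_n => k (observe (U_ j om, V_ j om) (Y_ j om) (delta_ j om)))].
suff E : r g = r h by rewrite -[X in X @ _]/(r h) -E.
apply/funext => n.
apply: ae_eq_measure; [exact: remainder_event_measurable|exact: remainder_event_measurable|].
have F := ae_filter_ringOfSetsType P.
have H (j : nat) : forall i : 'I_m, {ae P, forall om,
    g (observe (U_ j om, V_ j om) (Y_ j om) (delta_ j om)) i 0 -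
    h (observe (U_ j om, V_ j om) (Y_ j om) (delta_ j om)) i 0 = 0}.
  move=> i'.
  pose q (z : X * R * bool) := g (raw_observe z) i' 0 - h (raw_observe z) i' 0.
  have mq : measurable_fun setT q.
    apply: measurable_funB; first exact: (measurableT_comp (mg i') raw_observe_measurable).
    exact: (measurableT_comp (mh i') raw_observe_measurable).
  exact: (copies_ae j mZ mq copies (gh i')).
have {}H : {ae P, forall om, forall (j : 'I_n) (i : 'I_m),
    g (observe (U_ j om, V_ j om) (Y_ j om) (delta_ j om)) i 0 -
    h (observe (U_ j om, V_ j om) (Y_ j om) (delta_ j om)) i 0 = 0}.
  by apply: ae_forall_ord => j; apply: ae_forall_ord => i; exact: H.
apply: (@filterS _ _ F _ _ _ H) => om Hom /=.
rewrite (_ : (fun j : 'I_n => g _) =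
  (fun j : 'I_n => h (observe (U_ j om, V_ j om) (Y_ j om) (delta_ j om))))//.
apply/funext => j; apply/colP => i; apply/eqP; rewrite -subr_eq0; apply/eqP; exact: Hom.
Qed.

End expansions.

Section characterization.
Context {R : realType} {m : nat}.
Local Notation X := (m.-tuple R * R)%type.
Variables (theta : 'cV[R]_m) (rho f f' : R -> R) (pi : X -> R) (G Gt : probability X R).
Context {d : measure_display} {Omega : measurableType d}.
Variables (P : probability Omega R) (U : Omega -> m.-tuple R) (V Y : Omega -> R)
  (delta : Omega -> bool).
Variables (U_ : nat -> Omega -> m.-tuple R) (V_ Y_ : nat -> Omega -> R)
  (delta_ : nat -> Omega -> bool).
Hypotheses (hrho : twice_continuously_differentiable rho) (hf : error_density f f')
  (hG1 : G1 G) (hG2 : G2 G) (hpi : propensity_assumptions pi)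
  (hY : partially_linear P U V Y theta rho f G)
  (hdelta : missing_at_random P U V Y delta pi) (hGt : conditional_law P U V delta Gt).
Hypothesis copies : independent_copies P (fun w => (U w, V w, Y w, delta w))
  (fun j w => (U_ j w, V_ j w, Y_ j w, delta_ j w)).

Lemma raw_measurable : measurable_fun setT (fun w => (U w, V w, Y w, delta w)).
Proof.
have [md _ _] := hdelta; apply: measurable_fun_pair => //.
exact: observation_measurable hY.
Qed.

Lemma efficient_mar_iff (T : forall n, n.-tuple (X * R * bool) -> 'cV[R]_m) :
  mar_estimator T ->
  (efficient_mar P U V Y delta U_ V_ Y_ delta_ theta rho f f' pi G T <->
   mar_expansion P U_ V_ Y_ delta_ theta T
     (mar_influence theta rho f f' Gt (\int[P]_w (delta w)%:R))).
Proof.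
move=> mT; pose g0 := mar_gradient theta rho f f' Gt P delta.
have E : mar_influence theta rho f f' Gt (\int[P]_w (delta w)%:R) =
    (fun x y b => g0 (observe x y b)).
  by apply/funext => x; apply/funext => y; apply/funext => b; rewrite /g0 mar_gradient_observe.
have mg0 := mar_gradient_measurable hrho hf hG2 hpi hY hdelta hGt.
rewrite E; split=> [[g [cg]]|H]; last first.
  by exists g0; split=> //; exact: (mar_gradient_canonical hrho hf hG1 hG2 hpi hY hdelta hGt).
apply: (mar_expansion_ae raw_measurable copies) => //; first by case: cg.
move=> i; exact: (canonical_gradient_unique hrho hf hG1 hG2 hpi hY hdelta hGt).
Qed.

End characterization.

(** * Complete case estimators *)

Lemma in_tuple_cast (S A : Type) (t : forall n, n.-tuple S -> A) (s : seq S) (k : nat)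
    (u : k.-tuple S) : val u = s -> t (size s) (in_tuple s) = t k u.
Proof.
move=> us; have uk : size s = k by rewrite -us size_tuple.
rewrite -{}uk in u us *; congr t; exact/val_inj.
Qed.

Lemma enum_val_imset (T : finType) (A : {set T}) (l : T) :
  (l \in [set enum_val j | j in 'I_#|A|]%SET) = (l \in A).
Proof.
apply/imsetP/idP => [[j _ ->]|lA]; first exact: enum_valP.
by exists (enum_rank_in lA l) => //; rewrite enum_rankK_in.
Qed.

Lemma pattern_enum_val {d} {Omega : measurableType d} (delta_ : nat -> Omega -> bool) n
    (A : {set 'I_n}) w :
  pattern delta_ (@enum_val _ A) w <-> forall l : 'I_n, delta_ l w = (l \in A).
Proof. by split=> H l; rewrite H enum_val_imset. Qed.

Section complete_case_estimators.
Context {R : realType} {m : nat}.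
Local Notation X := (m.-tuple R * R)%type.
Variables (t : forall n, n.-tuple (X * R) -> 'cV[R]_m) (c : 'cV[R]_m).

Lemma complete_case_selected n (o : n.-tuple (X * R * bool)) (A : {set 'I_n}) :
  (forall l, (tnth o l).2 = (l \in A)) ->
  complete_case t c o = if #|A| == 0%N then c else
    t [tuple (tnth o (enum_val j)).1 | j < #|A|].
Proof.
move=> oA; rewrite /complete_case.
set s := [seq z.1 | z <- o & z.2].
set u := [tuple _ | _ < _].
have sE : val u = s.
  have -> : u = [tuple of [seq (tnth o j).1 | j <- enum_tuple A]].
    by apply: eq_from_tnth => j; rewrite tnth_mktuple tnth_map (tnth_nth (enum_default j)).
  rewrite /= /s -[in RHS](map_tnth_enum o) filter_map -map_comp /=.
  congr map; rewrite [LHS]/enum_mem -enumT; apply: eq_filter => l /=.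
  by rewrite oA.
by rewrite (in_tuple_cast t sE) -sE size_tuple.
Qed.


Lemma complete_case_estimator : full_estimator t -> mar_estimator (complete_case t c).
Proof.
move=> mt n i; pose F (A : {set 'I_n}) :=
  [set o : n.-tuple (X * R * bool) | forall l, (tnth o l).2 = (l \in A)].
have mtnth l : measurable_fun setT (fun o : n.-tuple (X * R * bool) => tnth o l).
  exact: measurable_tnth.
have mF A : measurable (F A).
  apply: measurable_forall => l.
  apply: (measurable_preimageT (B := [set (l \in A)])) => //.
  exact: (measurableT_comp measurable_snd (mtnth l)).
have covF o : exists A, F A o.
  by exists [set l | (tnth o l).2]%SET => l; rewrite inE.
apply: (measurable_fun_piecewise mF covF (g := fun A o => if #|A| == 0%N then c i 0 else
    t [tuple (tnth o (enum_val j)).1 | j < #|A|] i 0)) => [A|A o /complete_case_selected ->].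
  case: (#|A| == 0%N); first exact: measurable_cst.
  apply: (measurableT_comp (mt #|A| i)).
  apply/measurable_fun_tnthP => j; rewrite (_ : _ \o _ = (fun o => (tnth o (enum_val j)).1)).
    exact: (measurableT_comp measurable_fst (mtnth _)).
  by apply/funext => o /=; rewrite tnth_mktuple.
by case: (#|A| == 0%N).
Qed.

Lemma complete_case_pattern {d} {Omega : measurableType d} (U_ : nat -> Omega -> m.-tuple R)
    (V_ Y_ : nat -> Omega -> R) (delta_ : nat -> Omega -> bool) n (A : {set 'I_n}) om :
  pattern delta_ (@enum_val _ A) om ->
  complete_case t c [tuple observe (U_ j om, V_ j om) (Y_ j om) (delta_ j om) | j < n] =
  if #|A| == 0%N then c else
    t (selected (fun j om => (U_ j om, V_ j om, Y_ j om)) (@enum_val _ A) om).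
Proof.
move=> /pattern_enum_val dA.
rewrite (@complete_case_selected _ _ A); last by move=> l; rewrite tnth_mktuple; exact: dA.
case: (#|A| == 0%N) => //; congr t; apply: eq_from_tnth => j.
by rewrite !tnth_mktuple /observe/= dA enum_valP mul1r.
Qed.

End complete_case_estimators.

Lemma cvge0_near {R : realType} (u : nat -> \bar R) (e : R) :
  u @ \oo --> 0%E -> 0 < e -> \forall n \near \oo, (u n <= e%:E)%E.
Proof.
move=> /fine_cvgP[fu /cvgrPdist_le/(_ e) H] e0; have {}H := H e0.
near=> n; have un : u n \is a fin_num by near: n.
rewrite -(fineK un) lee_fin; apply: (le_trans (ler_norm _)).
by rewrite -normrN -[X in `|X|]add0r; near: n.
Unshelve. all: by end_near. Qed.

Lemma near_cvge0 {R : realType} (u : nat -> \bar R) : (forall n, 0 <= u n)%E ->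
  (forall e, 0 < e -> \forall n \near \oo, (u n <= e%:E)%E) -> u @ \oo --> 0%E.
Proof.
move=> u0 H; apply/fine_cvgP; split.
  near=> n; rewrite ge0_fin_numE//; apply: (@le_lt_trans _ _ 1%:E); last exact: ltry.
  by near: n; exact: H.
apply/cvgrPdist_le => e e0; near=> n.
have un : (u n <= e%:E)%E by near: n; exact: H.
rewrite sub0r normrN ger0_norm ?fine_ge0//= -lee_fin fineK//.
by rewrite ge0_fin_numE//; exact: (le_lt_trans un (ltry _)).
Unshelve. all: by end_near. Qed.

(* [n p H] is the sum of the influence functions over the subsample; replacing the
   factor [(n p)^-1] by [N^-1] costs [|N - n p| |H| / (N n p)], which AM-GM bounds
   by the second moments in the hypothesis. *)
Lemma subsample_remainder {R : realType} (m n N : nat) (theta T H : 'cV[R]_m) (p e a : R) :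
  (0 < n)%N -> 0 < p -> a <= e * p / 2 -> a <= p ^+ 2 / 4 ->
  (N%:R - n%:R * p) ^+ 2 + \sum_i ((N%:R - n%:R * p) ^+ 2 + H i 0 ^+ 2) <=
    a * (n%:R * Num.sqrt n%:R) ->
  n%:R * p / 2 <= N%:R /\
  (e < Num.sqrt n%:R * `|T - theta - n%:R^-1 *: H| ->
   e / 2 / Num.sqrt (2 / p) < Num.sqrt N%:R * `|T - theta - N%:R^-1 *: (p *: H)|).
Proof.
move=> n0 p0 ae ap; set x : R := n%:R; set s := Num.sqrt x; set y : R := N%:R.
set D := (y - x * p) ^+ 2 => HS.
have x1 : 1 <= x by rewrite /x ler1n.
have x0 : 0 < x by exact: lt_le_trans x1.
have s0 : 0 < s by rewrite sqrtr_gt0.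
have ss : s ^+ 2 = x by rewrite sqr_sqrtr// ltW.
have sx : s <= x by rewrite -ss expr2 ler_peMl ?(ltW s0)// -[1]sqrtr1 ler_sqrt.
have D0 : 0 <= D by rewrite sqr_ge0.
have S0 : 0 <= \sum_i (D + H i 0 ^+ 2) by apply: sumr_ge0 => i _; rewrite addr_ge0// sqr_ge0.
have Ny : x * p / 2 <= y.
  rewrite leNgt; apply/negP => Hlt.
  have : D <= p ^+ 2 / 4 * (x * x).
    apply: (@le_trans _ _ (a * (x * s))); first by move: HS S0; lra.
    apply: (@le_trans _ _ (p ^+ 2 / 4 * (x * s)));
      rewrite ?ler_wpM2l ?ler_wpM2r ?mulr_ge0 ?sqr_ge0 ?invr_ge0// ltW//.
  suff : p ^+ 2 / 4 * (x * x) < D by move=> /lt_le_trans H1 /H1; rewrite ltxx.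
  have : 0 < (x * p - y - x * p / 2) * (x * p - y + x * p / 2).
    have xp := mulr_gt0 x0 p0; apply: mulr_gt0; lra.
  by rewrite /D; lra.
split=> //; apply: contraTT; rewrite -!leNgt.
have r0 : 0 < Num.sqrt (2 / p) by rewrite sqrtr_gt0 divr_gt0.
rewrite ler_pdivlMr// => HA.
have y0 : 0 < y by apply: lt_le_trans Ny; rewrite !mulr_gt0// invr_gt0.
set A := `|_ - y^-1 *: _| in HA.
have -> : T - theta - x^-1 *: H = (T - theta - y^-1 *: (p *: H)) + ((y^-1 * p - x^-1) *: H).
  by rewrite scalerBl scalerA addrA subrK.
apply: (@le_trans _ _ (s * (A + `|y^-1 * p - x^-1| * `|H|))).
  by rewrite ler_pM2l// -normrZ ler_normD.
rewrite mulrDr; have A0 : 0 <= A by exact: normr_ge0.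
have H1 : s * A <= e / 2.
  apply: le_trans HA; rewrite mulrAC ler_wpM2r// -sqrtrM ?ler0n//.
  rewrite ler_wsqrtr// mulrA ler_pdivlMr//; lra.
suff : s * (`|y^-1 * p - x^-1| * `|H|) <= e / 2 by lra.
have E1 : `|y^-1 * p - x^-1| = `|y - x * p| / (y * x).
  have -> : y^-1 * p - x^-1 = - ((y - x * p) / (y * x)).
    by field; rewrite !gt_eqF.
  by rewrite normrN normrM [X in _ * X]gtr0_norm// invr_gt0 mulr_gt0.
have H2 : `|y - x * p| * `|H| <= a * (x * s) / 2.
  apply: (@le_trans _ _ (\sum_i (D + H i 0 ^+ 2) / 2)); last first.
    by rewrite -mulr_suml ler_pM2r ?invr_gt0//; move: HS D0; lra.
  apply: (@le_trans _ _ (`|y - x * p| * \sum_i `|H i 0|)).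
    rewrite ler_wpM2l// (le_trans (ler_mx_norm_sum H))// -(pair_bigA _ (fun i j => `|H i j|))/=.
    by apply: ler_sum => i _; rewrite big_ord1.
  rewrite mulr_sumr; apply: ler_sum => i _.
  have := sqr_ge0 (`|y - x * p| - `|H i 0|); rewrite sqrrB !real_normK ?num_real// -/D.
  by lra.
apply: (@le_trans _ _ (a / p)); last first.
  by rewrite ler_pdivrMr//; move: ae; lra.
rewrite E1 (_ : s * _ = (`|y - x * p| * `|H|) * (s / (y * x))); last first.
  by move: (`|_|) (`|H|) => ? ?; ring.
apply: (@le_trans _ _ (a * (x * s) / 2 * (s / (y * x)))).
  by rewrite ler_wpM2r// divr_ge0 ?mulr_ge0 ?(ltW s0)// ltW.
have a0 : 0 <= a by move: HS; rewrite -(pmulr_lge0 _ (mulr_gt0 x0 s0)) mulrC; lra.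
have -> : a * (x * s) / 2 * (s / (y * x)) = a * (s ^+ 2 / (2 * y)).
  by field; rewrite !gt_eqF.
rewrite ss ler_wpM2l// ler_pdivrMr ?mulr_gt0// ler_pdivlMl//; lra.
Qed.

Section complete_case_efficiency.
Context {R : realType} {m : nat}.
Local Notation X := (m.-tuple R * R)%type.
Variables (theta : 'cV[R]_m) (rho f f' : R -> R) (pi : X -> R) (G Gt : probability X R).
Context {d : measure_display} {Omega : measurableType d}.
Variables (P : probability Omega R) (U : Omega -> m.-tuple R) (V Y : Omega -> R)
  (delta : Omega -> bool).
Variables (U_ : nat -> Omega -> m.-tuple R) (V_ Y_ : nat -> Omega -> R)
  (delta_ : nat -> Omega -> bool).
Hypotheses (hrho : twice_continuously_differentiable rho) (hf : error_density f f')
  (hG1 : G1 G) (hG2 : G2 G) (hpi : propensity_assumptions pi)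
  (hY : partially_linear P U V Y theta rho f G)
  (hdelta : missing_at_random P U V Y delta pi) (hGt : conditional_law P U V delta Gt).
Hypothesis copies : independent_copies P (fun w => (U w, V w, Y w, delta w))
  (fun j w => (U_ j w, V_ j w, Y_ j w, delta_ j w)).

Local Notation lam := (@lebesgue_measure R).
Local Notation p := (\int[P]_w (delta w)%:R).
Local Notation D := (fun w => (U w, V w, Y w)).
Local Notation D_ := (fun j w => (U_ j w, V_ j w, Y_ j w)).
Local Notation Z_ := (fun j w => (U_ j w, V_ j w, Y_ j w, delta_ j w)).

Let p0 : 0 < p := response_rate_gt0 hrho hf hpi hY hdelta.
Let mD : measurable_fun setT D := observation_measurable hY.
Let mdelta : measurable_fun setT delta. Proof. by case: hdelta. Qed.
Let Pdelta : P [set w | delta w] != 0%E.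
Proof. by rewrite (response_rate_prob hdelta) eqe gt_eqF. Qed.

Let Q := @complete_sample _ _ _ _ _ P D delta D_ delta_ copies.

Lemma complete_sample_partially_linear n (j : 'I_n) : partially_linear (Q n)
  (fun s => (tnth s j).1.1) (fun s => (tnth s j).1.2) (fun s => (tnth s j).2)
  theta rho f Gt.
Proof.
have mt : measurable_fun setT (fun s : n.-tuple (X * R) => tnth s j) by exact: measurable_tnth.
have mt1 := measurableT_comp measurable_fst mt.
split; [exact: (measurableT_comp measurable_fst mt1)|exact: (measurableT_comp measurable_snd mt1)|
  exact: (measurableT_comp measurable_snd mt)|move=> A B mA mB].
pose C := [set z : X * R | A z.1 /\ B (residual theta rho z.1 z.2)].
have mC : measurable C.
  apply: measurableI; first exact: (measurable_preimageT measurable_fst mA).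
  exact: (measurable_preimageT (residual_measurable theta hrho) mB).
have md : measurable [set w | delta w] by exact: (measurable_preimageT (B := [set true]) mdelta).
pose iA : X -> R := \1_A; pose iB : R -> R := \1_B.
have mA1 : measurable_fun setT iA by exact: measurable_indic.
have mB1 : measurable_fun setT iB by exact: measurable_indic.
have i01 S (E : set S) x : `|\1_E x : R| <= 1.
  by rewrite indicE; case: (_ \in _); rewrite ?normr1 ?normr0.
have iAG : Gt.-integrable setT (fun x => (iA x)%:E).
  by apply: (intg_le mA1 (intg_cst Gt 1)) => x; exact: i01.
have iBf : lam.-integrable setT (fun y : R => (iB y * f y)%:E).
  apply: (intg_le _ (error_density_intg hf)) => [|y].
    by apply: measurable_funM => //; exact: error_density_measurable hf.
  have fy := error_density_ge0 hf y.
  by rewrite normrM [X in _ * X]ger0_norm// ler_piMl//; exact: i01.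
transitivity (Q n [set s | C (tnth s j)]).
  by congr (Q n _); apply/funext => s /=; rewrite /C/=; case: (tnth s j) => -[].
rewrite {1}/Q (complete_sample_marginal mD mdelta copies Pdelta j mC) (response_rate_prob hdelta)/=.
have Pk : P.-integrable setT (fun w => ((delta w)%:R *
    (iA (U w, V w) * iB (residual theta rho (U w, V w) (Y w))))%:E).
  apply: (complete_case_intg hrho hf hpi hY hdelta mA1 mB1 _ iBf).
  exact/(complete_case_integrable hrho hf hpi hY hdelta hGt mA1).
have -> : P [set w | C (U w, V w, Y w) /\ delta w] =
    (p * \int[Gt]_x iA x * \int[lam]_y (iB y * f y))%:E.
  rewrite -(complete_case_integral hrho hf hpi hY hdelta hGt mA1 iAG).
  rewrite -(complete_case_Rintegral hrho hf hpi hY hdelta mA1 mB1 _ iBf); last first.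
    exact/(complete_case_integrable hrho hf hpi hY hdelta hGt mA1).
  rewrite -EFin_Rintegral// -[X in P X]setIT -integral_indic//; last first.
    by apply: measurableI => //; exact: measurable_preimageT mD mC.
  apply: eq_integral => w _; congr EFin; rewrite /iA /iB !indicE -!natrM !mulnb.
  congr ((nat_of_bool _)%:R : R).
  apply/idP/idP => [/set_mem[[Aw Bw] dw]|/and3P[dw /set_mem Aw /set_mem Bw]].
    by rewrite dw !mem_set.
  exact/mem_set.
rewrite [fine _]/= -mulrA mulrC mulKf ?gt_eqF// EFinM -!EFin_Rintegral// integral_indic// setIT.
congr (_ * _)%E; rewrite [RHS]integral_mkcond epatch_indic.
by apply: eq_integral => y _; rewrite muleC.
Qed.

Variables (t : forall n, n.-tuple (X * R) -> 'cV[R]_m) (c : 'cV[R]_m).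
Hypotheses (mt : full_estimator t) (eff : efficient_full t).

Lemma complete_sample_efficient (e : R) : 0 < e ->
  Q n [set s | e < scaled_remainder theta (t s)
     (fun j => full_influence theta rho f f' Gt (tnth s j))] @[n --> \oo] --> 0%E.
Proof.
have ind n : mutually_independent (Q n) (fun (j : 'I_n) (s : n.-tuple (X * R)) => tnth s j).
  by move=> A mA; exact: (complete_sample_independent mD mdelta copies Pdelta mA).
exact: (eff hrho hf (complete_case_G1 hrho hf hG1 hpi hY hdelta hGt)
  (complete_case_G2 hrho hf hG2 hpi hY hdelta hGt) complete_sample_partially_linear ind).
Qed.

Local Notation s := (score f f').
Local Notation count z := ((z : X * R * bool).2%:R - p).
Local Notation infl i z := (mar_gradient theta rho f f' Gt P delta z i 0).

Let mZ := raw_measurable hY hdelta.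

Let count_measurable : measurable_fun setT (fun z => count z).
Proof.
apply: measurable_funB => //.
rewrite (_ : (fun z : X * R * bool => _) = (fun z : X * R * bool => if z.2 then 1 else 0)).
  exact: measurable_fun_ifT.
by apply/funext => z; case: z.2.
Qed.

Let infl_measurable i : measurable_fun setT (fun z => infl i z).
Proof. exact: (mar_gradient_measurable hrho hf hG2 hpi hY hdelta hGt). Qed.

Let dl_intg : P.-integrable setT (fun w => ((delta w)%:R : R)%:E).
Proof.
apply: (intg_le (indicator_measurable hdelta) (intg_cst P 1)) => w.
by case: (delta w); rewrite ?normr1 ?normr0.
Qed.

Lemma count_sqr_intg : P.-integrable setT (fun w => (count (U w, V w, Y w, delta w) ^+ 2)%:E).
Proof.
have mc := measurableT_comp count_measurable mZ.
apply: (intg_le (measurable_funX 2 mc) (intg_cst P ((1 + p) ^+ 2))) => w /=.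
rewrite normrX ler_pXn2r ?nnegrE ?normr_ge0 ?addr_ge0 ?(ltW p0)//.
rewrite (le_trans (ler_normB _ _))// (ger0_norm (ltW p0)) lerD2r.
by case: (delta w); rewrite ?normr1 ?normr0.
Qed.

Lemma count_mean : \int[P]_w count (U w, V w, Y w, delta w) = 0.
Proof.
rewrite (RintegralB measurableT dl_intg (intg_cst P p)) Rintegral_cst//.
by rewrite [X in fine X](_ : _ = 1%E) ?mulr1 ?subrr//; exact: probability_setT.
Qed.

Lemma infl_sqr_intg i : P.-integrable setT (fun w => (infl i (U w, V w, Y w, delta w) ^+ 2)%:E).
Proof.
under eq_fun do rewrite /mar_gradient/= mar_influenceE.
have mk := influence_coef_measurable hrho hf hG2 hpi hY hdelta hGt i.
have k2 := influence_coef_sqr_intg hrho hf hG2 hpi hY hdelta hGt i.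
have ik := (complete_case_integrable hrho hf hpi hY hdelta hGt (measurable_funX 2 mk)).2 k2.
have := complete_case_intg hrho hf hpi hY hdelta (measurable_funX 2 mk)
  (measurable_funX 2 (score_measurable hf)) ik (score2_intg hf).
congr (P.-integrable setT _); apply/funext => w; rewrite -exprMn [in RHS]exprMn.
by case: (delta w); rewrite ?expr1n ?expr0n.
Qed.

Lemma infl_mean i : \int[P]_w infl i (U w, V w, Y w, delta w) = 0.
Proof.
under eq_Rintegral do rewrite /mar_gradient/= mar_influenceE.
have mk := influence_coef_measurable hrho hf hG2 hpi hY hdelta hGt i.
have k1 := sqr_intg mk (influence_coef_sqr_intg hrho hf hG2 hpi hY hdelta hGt i).
rewrite (complete_case_Rintegral hrho hf hpi hY hdelta mk (score_measurable hf) _ (score_intg hf)).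
  by rewrite (score_mean0 hf) mulr0.
exact/(complete_case_integrable hrho hf hpi hY hdelta hGt mk).
Qed.

Definition deviation n w : R := (\sum_(j < n) count (Z_ j w)) ^+ 2 +
  \sum_i ((\sum_(j < n) count (Z_ j w)) ^+ 2 + (\sum_(j < n) infl i (Z_ j w)) ^+ 2).

Lemma deviation_intg n : P.-integrable setT (fun w => (deviation n w)%:E).
Proof.
have c2 := copies_sum_sqr_intg mZ copies count_measurable count_sqr_intg n.
apply: intgD => //; apply: intg_sum => i; apply: intgD => //.
exact: (copies_sum_sqr_intg (k := fun z => infl i z) mZ copies (infl_measurable i) (infl_sqr_intg i) n).
Qed.

Lemma deviation_mean : exists2 C, 0 <= C & forall n, \int[P]_w deviation n w = n%:R * C.
Proof.
pose v : R := \int[P]_w (count (U w, V w, Y w, delta w) ^+ 2).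
pose vi i : R := \int[P]_w (infl i (U w, V w, Y w, delta w) ^+ 2).
exists (v + \sum_i (v + vi i)).
  have v0 : 0 <= v by apply: Rintegral_ge0 => w _; rewrite sqr_ge0.
  rewrite addr_ge0// sumr_ge0// => i _; rewrite addr_ge0//.
  by apply: Rintegral_ge0 => w _; rewrite sqr_ge0.
move=> n.
have c2 := copies_sum_sqr_intg mZ copies count_measurable count_sqr_intg n.
have i2 i := copies_sum_sqr_intg (k := fun z => infl i z) mZ copies
  (infl_measurable i) (infl_sqr_intg i) n.
rewrite (RintegralD measurableT c2); last by apply: intg_sum => i; exact: intgD.
rewrite Rintegral_sum; last by move=> i; exact: intgD.
rewrite (copies_sum_sqr mZ copies count_measurable count_sqr_intg n count_mean) mulrDr mulr_sumr.
congr (_ + _); apply: eq_bigr => i _; rewrite (RintegralD measurableT c2 (i2 i)).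
rewrite (copies_sum_sqr mZ copies count_measurable count_sqr_intg n count_mean).
by rewrite (copies_sum_sqr (k := fun z => infl i z) mZ copies (infl_measurable i)
  (infl_sqr_intg i) n (infl_mean i)) mulrDr.
Qed.

Lemma deviation_tail (a r : R) : 0 < a -> 0 < r ->
  \forall n \near \oo, (P [set w | a * (n%:R * Num.sqrt n%:R) < deviation n w]%R <= r%:E)%E.
Proof.
move=> a0 r0; have [C C0 HC] := deviation_mean.
near=> n; have n0 : (0 < n)%N by near: n; exists 1%N.
have x0 : 0 < (n%:R : R) by rewrite ltr0n.
have s0 : 0 < Num.sqrt (n%:R : R) by rewrite sqrtr_gt0.
apply: (le_trans (markov_ineq (deviation_intg n) _ _)).
- move=> w; rewrite addr_ge0 ?sqr_ge0// sumr_ge0// => i _.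
  by rewrite addr_ge0// sqr_ge0.
- by rewrite !mulr_gt0.
rewrite lee_fin HC [leLHS](_ : _ = C / a / Num.sqrt n%:R); last by field; rewrite !gt_eqF.
suff : C / a / r <= Num.sqrt n%:R by rewrite [_ <= r]ler_pdivrMr// [r * _]mulrC -ler_pdivrMr.
rewrite -[leLHS]ger0_norm; last by rewrite !divr_ge0// ltW.
rewrite -sqrtr_sqr ler_wsqrtr//.
by near: n; exact: nbhs_infty_ger.
Unshelve. all: by end_near. Qed.

Local Notation subsample A := (selected D_ (@enum_val _ A)).
Local Notation observed A := (pattern delta_ (@enum_val _ A)).

Lemma full_influenceE x y :
  full_influence theta rho f f' Gt (x, y) = p *: mar_influence theta rho f f' Gt p x y true.
Proof.
rewrite /mar_influence scalerA /full_influence/=; congr (_ *: _).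
by rewrite mulrA mul1r divff ?mul1r// gt_eqF.
Qed.

Lemma full_influence_measurable i :
  measurable_fun setT (fun z => full_influence theta rho f f' Gt z i 0).
Proof.
have mt' : measurable_fun setT (fun z : X * R => (z, true)).
  exact: (measurable_fun_pair (@measurable_id _ _ _) (measurable_cst true)).
rewrite (_ : (fun z => _) = (fun z => p * infl i (z, true))).
  exact: (measurable_funM (measurable_cst _) (measurableT_comp (infl_measurable i) mt')).
by apply/funext => -[x y]; rewrite full_influenceE mxE.
Qed.

Lemma observed_sums n (A : {set 'I_n}) w : observed A w ->
  \sum_(j < n) count (Z_ j w) = #|A|%:R - n%:R * p /\
  \sum_(j < #|A|) full_influence theta rho f f' Gt (tnth (subsample A w) j) =
  p *: \sum_(j < n) mar_influence theta rho f f' Gt p (U_ j w, V_ j w) (Y_ j w) (delta_ j w).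
Proof.
move=> /pattern_enum_val dA.
split.
  rewrite sumrB sumr_const card_ord -[X in _ - X]mulr_natl; congr (_ - _).
  rewrite -natr_sum -sum1_card [in RHS]big_mkcond/=; congr (_%:R).
  by apply: eq_bigr => l _; rewrite dA; case: (l \in A).
transitivity (\sum_(l in A) full_influence theta rho f f' Gt (D_ l w)).
  rewrite (big_enum_val (fun l : 'I_n => full_influence theta rho f f' Gt (D_ l w))).
  by apply: eq_bigr => j _; rewrite tnth_mktuple.
rewrite scaler_sumr [RHS](bigID (mem A))/= [X in _ + X]big1 ?addr0 => [|l /negPf lA].
  by apply: eq_bigr => l lA; rewrite full_influenceE dA lA.
by rewrite /mar_influence dA lA mul0r mul0r scale0r scaler0.
Qed.

Lemma complete_case_expansion : mar_expansion P U_ V_ Y_ delta_ theta (complete_case t c)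
  (mar_influence theta rho f f' Gt p).
Proof.
move=> e e0; pose e' := e / 2 / Num.sqrt (2 / p).
have e'0 : 0 < e' by rewrite !divr_gt0// sqrtr_gt0 divr_gt0.
pose a := Num.min (e * p / 2) (p ^+ 2 / 4).
have a0 : 0 < a by rewrite lt_min !divr_gt0// ?mulr_gt0// exprn_gt0.
have ae : a <= e * p / 2 by rewrite ge_min lexx.
have ap : a <= p ^+ 2 / 4 by rewrite ge_min lexx orbT.
apply: near_cvge0 => // r r0.
have r20 : 0 < r / 2 by rewrite divr_gt0.
have [K _ HK] := cvge0_near (complete_sample_efficient e'0) r20.
pose B k := [set s : k.-tuple (X * R) | e' < scaled_remainder theta (t s)
  (fun j => full_influence theta rho f f' Gt (tnth s j))].
have mB k : measurable (B k).
  apply: measurable_gt; apply: scaled_remainder_measurable => [|j i]; first exact: mt.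
  exact: (measurableT_comp (full_influence_measurable i) (measurable_tnth j)).
have fQ k : Q k (B k) \is a fin_num by exact: fin_num_measure (Q k) _ (mB k).
near=> n.
have n0 : (0 < n)%N by near: n; exists 1%N.
have nK : K.+1%:R <= n%:R * p / 2.
  rewrite -mulrA -ler_pdivrMr; last by rewrite divr_gt0.
  by near: n; exact: nbhs_infty_ger.
pose J (A : {set 'I_n}) := (K < #|A|)%N.
have mbad (A : {set 'I_n}) : measurable (subsample A @^-1` B #|A|).
  exact: (measurable_preimageT (selected_measurable copies (@enum_val _ A)) (mB _)).
have mF (A : {set 'I_n}) : measurable (observed A) by exact: (pattern_measurable copies).
have disF (A A' : {set 'I_n}) w : observed A w -> observed A' w -> A = A'.
  move=> /pattern_enum_val oA /pattern_enum_val oA'; apply/setP => l.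
  by rewrite -oA; exact: oA'.
have mE : measurable [set w | exists2 A, J A & (observed A `&` (subsample A @^-1` B #|A|)) w].
  by apply: measurable_fin_bigcup => A; apply: measurableI; [exact: mF|exact: mbad].
have mdev : measurable [set w | a * (n%:R * Num.sqrt n%:R) < deviation n w].
  exact/measurable_gt/(intg_measurable (deviation_intg n)).
have H1 : (P [set w | exists2 A, J A & (observed A `&` (subsample A @^-1` B #|A|)) w] <=
    (r / 2)%:E)%E.
  apply: (partition_bound mF disF (a := fun A : {set 'I_n} => fine (Q #|A| (B #|A|)))) => //.
  - exact: ltW.
  - move=> A _; rewrite (pattern_law mD mdelta copies Pdelta enum_val_inj (mB _)).
    congr (_ * _)%E; apply/esym/fineK; exact: fQ.
  - move=> A JA; rewrite -lee_fin fineK; last exact: fQ.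
    by apply: HK => /=; exact: ltnW.
have H2 : (P [set w | a * (n%:R * Num.sqrt n%:R) < deviation n w]%R <= (r / 2)%:E)%E.
  by near: n; exact: deviation_tail.
pose H w := \sum_(j < n) mar_influence theta rho f f' Gt p (U_ j w, V_ j w) (Y_ j w) (delta_ j w).
have incl : [set w | e < scaled_remainder theta (complete_case t c
      [tuple observe (U_ j w, V_ j w) (Y_ j w) (delta_ j w) | j < n])
      (fun j : 'I_n => mar_influence theta rho f f' Gt p (U_ j w, V_ j w) (Y_ j w) (delta_ j w))] `<=`
    [set w | exists2 A, J A & (observed A `&` (subsample A @^-1` B #|A|)) w] `|`
    [set w | a * (n%:R * Num.sqrt n%:R) < deviation n w]%R.
  move=> w /= ew; have [dev|] := ltP (a * (n%:R * Num.sqrt n%:R)) (deviation n w); first by right.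
  pose A := [set l : 'I_n | delta_ l w]%SET.
  have oA : observed A w by apply/pattern_enum_val => l; rewrite inE.
  have [cA fA] := observed_sums oA.
  rewrite /deviation cA.
  have HE i : \sum_(j < n) infl i (Z_ j w) = H w i 0 by rewrite summxE.
  under eq_bigr do rewrite HE.
  move=> dev; have [Ny key] := subsample_remainder theta (complete_case t c
    [tuple observe (U_ j w, V_ j w) (Y_ j w) (delta_ j w) | j < n]) n0 p0 ae ap dev.
  have JA : J A by rewrite /J -(ltr_nat R) (lt_le_trans _ (le_trans nK Ny))// ltr_nat.
  left; exists A => //; split => //=; rewrite /B/= /scaled_remainder fA.
  have := key ew; rewrite (complete_case_pattern t c U_ V_ Y_ oA) ifN//.
  by rewrite -lt0n (leq_ltn_trans _ JA).
apply: (le_trans (le_measure P _ _ incl)).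
- apply/mem_set; have := remainder_event_measurable copies theta
    (k := mar_gradient theta rho f f' Gt P delta) e n (complete_case_estimator c mt) infl_measurable.
  congr (measurable _); apply/funext => w /=; congr (is_true (e < scaled_remainder _ _ _)).
  by apply/funext => j; rewrite mar_gradient_observe.
- exact/mem_set/measurableU.
apply: (le_trans (measureU2 P mE mdev)).
by rewrite [r in leRHS]splitr EFinD; exact: leeD.
Unshelve. all: by end_near. Qed.

Lemma complete_case_efficient : mar_estimator (complete_case t c) /\
  efficient_mar P U V Y delta U_ V_ Y_ delta_ theta rho f f' pi G (complete_case t c).
Proof.
have mT := complete_case_estimator c mt; split=> //.
by apply/(efficient_mar_iff hrho hf hG1 hG2 hpi hY hdelta hGt copies mT)/complete_case_expansion.
Qed.

End complete_case_efficiency.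

Unset Implicit Arguments.

Theorem lemma3p1 (R : realType) (m : nat) (theta : 'cV[R]_m)
    (rho f f' : R -> R) (pi : m.-tuple R * R -> R)
    (G Gt : probability (m.-tuple R * R)%type R)
    (d : measure_display) (Omega : measurableType d) (P : probability Omega R)
    (U : Omega -> m.-tuple R) (V Y : Omega -> R) (delta : Omega -> bool)
    (U_ : nat -> Omega -> m.-tuple R) (V_ Y_ : nat -> Omega -> R)
    (delta_ : nat -> Omega -> bool)
    (hrho : twice_continuously_differentiable rho)
    (hf : error_density f f')
    (hG1 : G1 G) (hG2 : G2 G)
    (hpi : propensity_assumptions pi)
    (hY : partially_linear P U V Y theta rho f G)
    (hdelta : missing_at_random P U V Y delta pi)
    (hGt : conditional_law P U V delta Gt)
    (hcopies : independent_copies P (fun w => (U w, V w, Y w, delta w))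
       (fun j w => (U_ j w, V_ j w, Y_ j w, delta_ j w))) :
  (forall T : forall n, n.-tuple (m.-tuple R * R * R * bool) -> 'cV[R]_m,
     mar_estimator T ->
     (efficient_mar P U V Y delta U_ V_ Y_ delta_ theta rho f f' pi G T <->
      mar_expansion P U_ V_ Y_ delta_ theta T
        (mar_influence theta rho f f' Gt (\int[P]_w (delta w)%:R)))) /\
  (forall (t : forall n, n.-tuple (m.-tuple R * R * R) -> 'cV[R]_m)
      (c : 'cV[R]_m),
     full_estimator t -> efficient_full t ->
     mar_estimator (complete_case t c) /\
     efficient_mar P U V Y delta U_ V_ Y_ delta_ theta rho f f' pi G
       (complete_case t c)).
Proof.
split=> [T mT|t c mt eff]; first exact: (efficient_mar_iff hrho hf hG1 hG2 hpi hY hdelta hGt).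
exact: (complete_case_efficient hrho hf hG1 hG2 hpi hY hdelta hGt hcopies).
Qed.
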